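(* Let $\mathbb B$ be the unit ball in $\mathbb R^d$ and let $\lambda_1^{(m)}(\mathbb B)$ be the first eigenvalue of $(-\Delta)^m u=\lambda u$ in $\mathbb B$ with Dirichlet boundary conditions $u=\frac{\partial u}{\partial\nu}=\dots=\frac{\partial^{m-1}u}{\partial\nu^{m-1}}=0$ on $\partial\mathbb B$. Then $$\left[\lambda_1^{(m)}(\mathbb B)\right]^{\frac1{2m}}=\frac{2m}{e}+\frac{d}{2e}\log m+O(1),\quad\text{as } m\to\infty.$$
   Context: Here $d\ge1$ is fixed. The eigenvalue problem is understood in the weak sense in $H^m_0(\mathbb B)$; with $\nabla^m u=\Delta^j u$ if $m=2j$ and $\nabla^m u=\nabla\Delta^j u$ if $m=2j+1$, one has $\lambda_1^{(m)}(\mathbb B)=\min_{0\ne u\in H^m_0(\mathbb B)}\int_{\mathbb B}|\nabla^m u|^2\big/\int_{\mathbb B}u^2$. *)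

(* Defs.v *)
(* MathComp / MathComp-Analysis *)
From HB Require Import structures.
From mathcomp Require Import all_boot all_order all_algebra.
From mathcomp Require Import all_classical all_reals all_analysis.

Set Implicit Arguments.
Unset Strict Implicit.
Unset Printing Implicit Defensive.

Import Order.TTheory GRing.Theory Num.Theory.
Import numFieldNormedType.Exports.

Local Open Scope classical_set_scope.
Local Open Scope ring_scope.

Definition rV_display : measure_display. Proof. exact. Qed.

Section measurable_rV.
Context {R : realType} (n : nat).

Let coord (i : 'I_n) (x : 'rV[R]_n) : R := x 0 i.

Let rV_set0 : g_sigma_preimage coord set0.
Proof. exact: sigma_algebra0. Qed.

Let rV_setC A : g_sigma_preimage coord A -> g_sigma_preimage coord (~` A).
Proof. exact: sigma_algebraC. Qed.

Let rV_bigcup (F : _^nat) : (forall i, g_sigma_preimage coord (F i)) ->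
  g_sigma_preimage coord (\bigcup_i (F i)).
Proof. exact: sigma_algebra_bigcup. Qed.

(* The product sigma-algebra, generated by the coordinates; on 'rV[R]_n it is
   the Borel sigma-algebra. *)
HB.instance Definition _ := @isMeasurable.Build rV_display
  'rV[R]_n (g_sigma_preimage coord) rV_set0 rV_setC rV_bigcup.

End measurable_rV.

Section lebesgue_rV.
Context {R : realType}.

Definition rV_cons n (p : measurableTypeR R * 'rV[R]_n) : 'rV[R]_n.+1 :=
  row_mx p.1%:M p.2 : 'rV[R]_(1 + n).

Definition rV_uncons n (x : 'rV[R]_n.+1) : measurableTypeR R * 'rV[R]_n :=
  (x 0 0, \row_j x 0 (lift 0 j)).

Lemma rV_cons0 n p : @rV_cons n p 0 0 = p.1.
Proof.
have := row_mxEl (p.1%:M : 'M[R]_1) p.2 0 0; rewrite [RHS]mxE mulr1n => <-.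
by congr (row_mx _ _ _ _); exact: val_inj.
Qed.

Lemma rV_consS n p j : @rV_cons n p 0 (lift 0 j) = p.2 0 j.
Proof.
have <- := row_mxEr (p.1%:M : 'M[R]_1) p.2 0 j.
by congr (row_mx _ _ _ _); exact: val_inj.
Qed.

Lemma rV_consK n : cancel (@rV_cons n) (@rV_uncons n).
Proof.
move=> [a v]; rewrite /rV_uncons rV_cons0; congr pair => /=.
by apply/rowP => j; rewrite mxE rV_consS.
Qed.

Lemma rV_unconsK n : cancel (@rV_uncons n) (@rV_cons n).
Proof.
move=> x; apply/rowP => i; have [j ->|->] := unliftP 0 i.
  by rewrite rV_consS mxE.
by rewrite rV_cons0.
Qed.

Lemma measurable_coord n (i : 'I_n) :
  measurable_fun [set: 'rV[R]_n] (fun x : 'rV[R]_n => x 0 i : R).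
Proof.
move=> _ Y mY; rewrite setTI; apply: sub_sigma_algebra => /=.
rewrite -bigcup_seq/=; exists i => /=; first by rewrite mem_index_enum.
by exists Y => //; rewrite setTI.
Qed.

Lemma measurable_fun_rV d (T : measurableType d) n (f : T -> 'rV[R]_n) :
  (forall i, measurable_fun [set: T] (fun t => f t 0 i : R)) ->
  measurable_fun [set: T] f.
Proof.
move=> mf.
suff : g_sigma_preimage (fun (i : 'I_n) (x : 'rV[R]_n) => x 0 i : R) `<=`
    [set A | measurable (f @^-1` A)].
  by move=> sub _ A /sub; rewrite setTI.
apply: smallest_sub.
  split=> [|A mA|F mF] /=.
  - by rewrite preimage_set0; exact: measurable0.
  - by rewrite setTD preimage_setC; exact: measurableC.
  - by rewrite preimage_bigcup; apply: bigcup_measurable => k _; exact: mF.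
rewrite -bigcup_seq => A [i _ [Y mY <-]] /=; rewrite setTI.
by have := mf i measurableT _ mY; rewrite setTI.
Qed.

Lemma measurable_rV_cons n : measurable_fun setT (@rV_cons n).
Proof.
apply: measurable_fun_rV => i; have [j ->|->] := unliftP 0 i.
  under eq_fun do rewrite rV_consS.
  exact: (measurableT_comp (measurable_coord j) measurable_snd).
under eq_fun do rewrite rV_cons0.
exact: measurable_fst.
Qed.

Lemma measurable_rV_uncons n : measurable_fun setT (@rV_uncons n).
Proof.
apply/measurable_fun_pairP; split => /=.
  exact: (@measurable_coord n.+1 0).
apply: measurable_fun_rV => j.
under eq_fun do rewrite mxE.
exact: measurable_coord.
Qed.

Section step.
Local Open Scope ereal_scope.
Variables (n : nat) (mu : {sigma_finite_measure set 'rV[R]_n -> \bar R}).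

Definition lebesgue_rV_step : set 'rV[R]_n.+1 -> \bar R :=
  pushforward (@lebesgue_measure R \x mu) (@rV_cons n).

Let step0 : lebesgue_rV_step set0 = 0.
Proof. by rewrite /lebesgue_rV_step /pushforward preimage_set0 measure0. Qed.

Let step_ge0 A : 0 <= lebesgue_rV_step A.
Proof. rewrite /lebesgue_rV_step /pushforward; exact: measure_ge0. Qed.

Let step_sigma_additive : semi_sigma_additive lebesgue_rV_step.
Proof.
move=> F mF tF mUF; rewrite /lebesgue_rV_step /pushforward preimage_bigcup.
have mc := @measurable_rV_cons n.
apply: measure_semi_sigma_additive.
- by move=> k; rewrite -[X in measurable X]setTI; exact: mc.
- apply/trivIsetP => /= i j _ _ ij; rewrite -preimage_setI.
  by move/trivIsetP : tF => /(_ _ _ _ _ ij) ->//; rewrite preimage_set0.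
- by rewrite -preimage_bigcup -[X in measurable X]setTI; exact: mc.
Qed.

HB.instance Definition _ := isMeasure.Build _ _ _ lebesgue_rV_step
  step0 step_ge0 step_sigma_additive.

Let step_sigma_finite : sigma_finite setT lebesgue_rV_step.
Proof.
have /sigma_finiteP[F [TF ndF Foo]] := sigma_finiteT (@lebesgue_measure R).
have /sigma_finiteP[G [TG ndG Goo]] := sigma_finiteT mu.
exists (fun k => @rV_uncons n @^-1` (F k `*` G k)).
  rewrite -preimage_bigcup; apply/esym; rewrite -subTset => x _ /=.
  have [k _ Fk] : (\bigcup_k F k) (rV_uncons x).1 by rewrite -TF.
  have [l _ Gl] : (\bigcup_l G l) (rV_uncons x).2 by rewrite -TG.
  exists (maxn k l) => //; split.
    by move: Fk; exact/subsetPset/ndF/leq_maxl.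
  by move: Gl; exact/subsetPset/ndG/leq_maxr.
move=> k; have [mF Fk] := Foo k; have [mG Gk] := Goo k; split.
  rewrite -[X in measurable X]setTI; apply: measurable_rV_uncons => //.
  exact: measurableX.
rewrite /lebesgue_rV_step /pushforward -comp_preimage.
rewrite (_ : _ \o _ = id); last by apply/funext; exact: rV_consK.
rewrite preimage_id product_measure1E// lte_mul_pinfty// ge0_fin_numE//.
Qed.

HB.instance Definition _ := Measure_isSigmaFinite.Build _ _ _ lebesgue_rV_step
  step_sigma_finite.

End step.

Definition lebesgue_rV :
    forall n, {sigma_finite_measure set 'rV[R]_n -> \bar R} :=
  fix leb n := match n with
  | 0 => [the {sigma_finite_measure set 'rV[R]_0 -> \bar R} of \d_(0 : 'rV[R]_0)]
  | n'.+1 => [the {sigma_finite_measure set 'rV[R]_n'.+1 -> \bar R} of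
               lebesgue_rV_step (leb n')]
  end.

Lemma lebesgue_rV_box n (A : 'I_n -> set R) :
    (forall i, measurable (A i)) ->
  lebesgue_rV n [set x | forall i, A i (x 0 i)] =
  (\prod_(i < n) @lebesgue_measure R (A i))%E.
Proof.
elim: n A => [|n IH] A mA.
  by rewrite big_ord0 /= diracE mem_set//= => -[].
have mA' : measurable [set x : 'rV[R]_n | forall i, A (lift 0 i) (x 0 i)].
  rewrite (_ : mkset _ =
      \bigcap_(i in setT) ((fun x : 'rV[R]_n => x 0 i) @^-1` A (lift 0 i))).
    apply: fin_bigcap_measurable => [|i _]; first exact: finite_finset.
    by rewrite -[X in measurable X]setTI; exact: measurable_coord.
  by apply/seteqP; split => x /= Ax i; [move=> _; exact: Ax|exact: (Ax i I)].
rewrite big_ord_recl -IH//= -product_measure1E//; last exact: mA.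
rewrite /= /lebesgue_rV_step /pushforward; congr (product_measure1 _ _ _); apply/seteqP; split => [p Ap|p [p1 p2] i].
  split; first by have := Ap 0; rewrite rV_cons0.
  by move=> i; have := Ap (lift 0 i); rewrite rV_consS.
by have [j ->|->] := unliftP 0 i; rewrite ?rV_cons0 ?rV_consS.
Qed.

End lebesgue_rV.

Section sobolev.
Context {R : realType} {d : nat}.
Implicit Types (Omega : set 'rV[R]_d) (u v g phi : 'rV[R]_d -> R).
Implicit Types (s : seq 'I_d) (m : nat) (lam : R).

Local Notation mu := (@lebesgue_rV R d).

Definition partial (i : 'I_d) phi : 'rV[R]_d -> R :=
  fun x => 'D_(delta_mx 0 i) phi x.

(* Multi-indices of order k are encoded by words of length k over 'I_d, one
   letter per differentiation. *)
Definition partials s phi : 'rV[R]_d -> R := foldr partial phi s.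

Definition smooth phi := forall s,
  continuous (partials s phi) /\
  forall (i : 'I_d) x, derivable (partials s phi) x (delta_mx 0 i).

Definition test_function Omega phi :=
  [/\ smooth phi, compact (closure [set x | phi x != 0]) &
      closure [set x | phi x != 0] `<=` Omega].

Definition L2 Omega u :=
  measurable_fun Omega u /\ mu.-integrable Omega (fun x => (u x ^+ 2)%:E).

Definition weak_derivative Omega s u g := forall phi, test_function Omega phi ->
  \int[mu]_(x in Omega) (u x * partials s phi x) =
  (-1) ^+ size s * \int[mu]_(x in Omega) (g x * phi x).

(* An L2 weak derivative of u if there is one (it is then unique up to a null
   set), the zero function otherwise. *)
Definition weakD Omega s u : 'rV[R]_d -> R :=
  xget (cst 0) [set g | L2 Omega g /\ weak_derivative Omega s u g].

Definition sobolev Omega m u := L2 Omega u /\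
  forall s, (size s <= m)%N -> exists g, L2 Omega g /\ weak_derivative Omega s u g.

(* The closure of the test functions in H^m: convergence in H^m is L2
   convergence of all weak derivatives of order at most m. *)
Definition sobolev0 Omega m u := sobolev Omega m u /\
  exists phi : nat -> 'rV[R]_d -> R, (forall k, test_function Omega (phi k)) /\
    forall s, (size s <= m)%N ->
      \int[mu]_(x in Omega) ((partials s (phi k) x - weakD Omega s u x) ^+ 2)
        @[k --> \oo] --> (0 : R).

Definition laplacian Omega u : 'rV[R]_d -> R :=
  fun x => \sum_(i < d) weakD Omega [:: i; i] u x.

(* The pointwise product of nabla^m u and nabla^m v, where nabla^m is Delta^j if
   m = 2j and grad Delta^j if m = 2j+1. *)
Definition nabla_dot Omega m u v : 'rV[R]_d -> R :=
  let u' := iter m./2 (laplacian Omega) u in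
  let v' := iter m./2 (laplacian Omega) v in
  fun x => if odd m
           then \sum_(i < d) weakD Omega [:: i] u' x * weakD Omega [:: i] v' x
           else u' x * v' x.

(* Weak form of (-Delta)^m u = lam u with Dirichlet conditions on Omega. *)
Definition dirichlet_eigenvalue Omega m lam := exists u,
  [/\ sobolev0 Omega m u,
      ~ (u = cst 0 %[ae mu in Omega]) &
      forall v, sobolev0 Omega m v ->
        \int[mu]_(x in Omega) nabla_dot Omega m u v x =
        lam * \int[mu]_(x in Omega) (u x * v x)].

(* The least eigenvalue; the default 0 is returned only if there is none. *)
Definition first_eigenvalue Omega m : R :=
  xget 0 [set lam | dirichlet_eigenvalue Omega m lam /\
                    forall lam', dirichlet_eigenvalue Omega m lam' -> lam <= lam'].

End sobolev.

(* The norm of 'rV[R]_d is the sup norm, so its balls are cubes. *)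
Definition unit_ball (R : realType) (d : nat) : set 'rV[R]_d :=
  [set x | \sum_(i < d) x 0 i ^+ 2 < 1].
Arguments unit_ball : clear implicits.

(* Main.v *)
(* With rho = 1 - |x|^2, the operator p |-> L p = (-Delta)^m (p rho^m) is a product
   Q_(m-1) ... Q_0 of second-order operators satisfying a maximum principle, and
   L 1 = C_m, where C_m = prod_(k < m) 2 (k + 1) (2 k + d). Hence L is onto on
   polynomials and |p| <= sup |L p| / C_m.  If u is an eigenfunction of eigenvalue
   lam, then int u L p = lam int u p rho^m for every polynomial p, so lam < C_m
   would force u = 0.  Testing the Rayleigh quotient with rho^m gives
   lam <= C_m int rho^m / int rho^(2m) <= e^(d/2) C_m, so the first eigenvalue is
   C_m up to a bounded factor, and ln C_m = 2m ln(2m) - 2m + (d/2) ln m + O(1).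
   Since m -> oo one may assume m > d; then the energy bounds sup |f| and
   sup |grad f| for test functions, so minimizing sequences are precompact by
   Arzela-Ascoli and no general compact embedding is needed for existence. *)
From HB Require Import structures.
From mathcomp Require Import all_boot all_order all_algebra.
From mathcomp Require Import all_classical all_reals all_analysis.
From mathcomp Require Import measurable_realfun.
From mathcomp Require Import ring lra.
Require Import Defs.

Set Implicit Arguments.
Unset Strict Implicit.
Unset Printing Implicit Defensive.

Import Order.TTheory GRing.Theory Num.Theory.
Import numFieldNormedType.Exports.

Local Open Scope classical_set_scope.
Local Open Scope ring_scope.

(** * Square-integrable functions *)

(** A bounded factor in the eigenvalue is what the error term can absorb: it moves ln lam by O(1),
    hence the 2m-th root, itself of size 2m/e, by O(1). The factors are Q_k = - rho Delta + 4 (k+1)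
    x.grad + 2 (k+1) (2k+d). Their second-order part degenerates on the sphere, where a maximum has
    nonnegative outward derivative, so the maximum principle involves no boundary condition. Each
    Q_k keeps the degree of a polynomial, so in bounded degree injectivity already gives
    surjectivity and no regularity theory for (-Delta)^m is required. The identity for u is used as
    a contraction: solving L p = q replaces q by p rho^m, whose supremum is smaller by the factor
    1/C_m, at the price of a factor lam; iterating forces int u q = 0 for every polynomial q. One
    obstacle is that p rho^m belongs to H^m_0 without being a test function; it is approximated by p
    F(rho), where F is smooth, vanishes below a small positive level, and converges to t^m together
    with its derivatives of order at most m. *)

Lemma discriminant_le0 (R : realFieldType) (a b c : R) :
  (forall t, 0 <= a + 2 * t * b + t ^+ 2 * c) -> b ^+ 2 <= a * c.
Proof.
move=> H.
have a0 : 0 <= a by have := H 0; rewrite !(mulr0, mul0r, addr0, expr0n).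
have [c0|c0|c0] := ltgtP c 0; last first.
- rewrite c0 mulr0; have [->|b0] := eqVneq b 0; first by rewrite expr0n.
  have := H (- (a + 1) / (2 * b)).
  rewrite c0 mulr0 addr0 (_ : _ + _ = -1); first by rewrite oppr_ge0 lt_geF// ltr01.
  by field.
- have := H (- b / c).
  rewrite (_ : _ + _ = (a * c - b ^+ 2) / c); last by field; rewrite gt_eqF.
  by rewrite pmulr_lge0 ?invr_gt0// subr_ge0.
- exfalso.
  (* This t is at least 1 and makes 2b + tc at most -(a + 1), so the quadratic is at most -1
     there. *)
  pose t := (a + 1 - c + `|b| *+ 2) / - c.
  have nc : 0 < - c by rewrite oppr_gt0.
  have t1 : 1 <= t.
    rewrite ler_pdivlMr// mul1r.
    have := normr_ge0 b; lra.
  have := H t.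
  have tc : t * c = - (a + 1 - c + `|b| *+ 2) by rewrite /t; field; rewrite lt_eqF.
  have -> : a + 2 * t * b + t ^+ 2 * c = a + t * (2 * b + t * c) by ring.
  rewrite tc => h.
  have b1 := ler_norm b.
  have : t * (2 * b + - (a + 1 - c + `|b| *+ 2)) <= t * (- (a + 1)).
    rewrite ler_wpM2l//; first exact: le_trans t1.
    have : c < 0 by []. lra.
  have : t * (- (a + 1)) <= - (a + 1) by rewrite mulrN lerN2 ler_peMl// addr_ge0.
  lra.
Qed.

Section square_integrable.
Context d (T : measurableType d) (R : realType).
Variable mu : {measure set T -> \bar R}.
Variable D : set T.
Hypothesis mD : measurable D.
Implicit Types f g : T -> R.

(** [L2] over an arbitrary measure and set: [sqint mu B] is convertible to [L2 B], so the results
    below apply directly to the notions of the statement. *)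
Definition sqint f := measurable_fun D f /\
  mu.-integrable D (fun x => (f x ^+ 2)%:E).

Lemma sqint_mul f g : sqint f -> sqint g ->
  mu.-integrable D (fun x => (f x * g x)%:E).
Proof.
move=> [mf If] [mg Ig].
apply: (le_integrable mD _ _ (integrableD mD If Ig)).
  exact/measurable_EFinP/measurable_funM.
move=> x Dx /=; rewrite lee_fin.
rewrite (@ger0_norm _ (_ + _)); last by rewrite addr_ge0// sqr_ge0.
rewrite ler_norml; have := sqr_ge0 (f x - g x); have := sqr_ge0 (f x + g x).
rewrite !(sqrrD, sqrrB) => h1 h2; apply/andP; split.
  have := sqr_ge0 (f x); have := sqr_ge0 (g x); lra.
have := sqr_ge0 (f x); have := sqr_ge0 (g x); lra.
Qed.

Lemma sqintZ a f : sqint f -> sqint (fun x => a * f x).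
Proof.
move=> [mf If]; split; first exact: measurable_funM.
rewrite (_ : (fun x => _) = (fun x => (a ^+ 2)%:E * (f x ^+ 2)%:E)%E).
  exact: integrableZl.
by apply/funext => x; rewrite exprMn EFinM.
Qed.

Lemma sqintD f g : sqint f -> sqint g -> sqint (fun x => f x + g x).
Proof.
move=> sf sg; have [mf If] := sf; have [mg Ig] := sg.
split; first exact: measurable_funD.
rewrite (_ : (fun x => _) = ((fun x => (f x ^+ 2)%:E) \+ (fun x => (g x ^+ 2)%:E)
   \+ (fun x => 2%:E * (f x * g x)%:E))%E).
  by apply: integrableD => //; [exact: integrableD|apply/integrableZl => //; exact: sqint_mul].
by apply/funext => x /=; rewrite -EFinM -!EFinD sqrrD; congr EFin; ring.
Qed.

Lemma sqintN f : sqint f -> sqint (fun x => - f x).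
Proof.
move=> /(sqintZ (-1)); rewrite (_ : (fun x => _) = (fun x => - f x))//.
by apply/funext => x; rewrite mulN1r.
Qed.

Lemma sqintB f g : sqint f -> sqint g -> sqint (fun x => f x - g x).
Proof. by move=> sf sg; apply: sqintD => //; exact: sqintN. Qed.

Lemma sqint0 : sqint (cst 0).
Proof.
split; first exact: measurable_cst.
rewrite (_ : (fun x => _) = cst 0%E); first exact: integrable0.
by apply/funext => x /=; rewrite expr0n.
Qed.

Lemma sqint_sum (I : Type) (r : seq I) (f : I -> T -> R) :
  (forall i, sqint (f i)) -> sqint (fun x => \sum_(i <- r) f i x).
Proof.
move=> sf; elim: r => [|i r IH].
  rewrite (_ : (fun x => _) = cst 0); first exact: sqint0.
  by apply/funext => x; rewrite big_nil.
rewrite (_ : (fun x => _) = (fun x => f i x + \sum_(j <- r) f j x)).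
  exact: sqintD.
by apply/funext => x; rewrite big_cons.
Qed.

Lemma Rintegral0 : \int[mu]_(x in D) (0 : R) = 0.
Proof. by rewrite Rintegral_cst// mul0r. Qed.

Definition ip f g := \int[mu]_(x in D) (f x * g x).
Definition nsq f := \int[mu]_(x in D) (f x ^+ 2).

Lemma ipC f g : ip f g = ip g f.
Proof. by apply: eq_Rintegral => x _; rewrite mulrC. Qed.

Lemma ipff f : ip f f = nsq f.
Proof. by apply: eq_Rintegral => x _; rewrite expr2. Qed.

Lemma nsq_ge0 f : 0 <= nsq f.
Proof. by apply: Rintegral_ge0 => x _; exact: sqr_ge0. Qed.

Lemma ipDl f g h : sqint f -> sqint g -> sqint h ->
  ip (fun x => f x + g x) h = ip f h + ip g h.
Proof.
move=> sf sg sh; rewrite -RintegralD//; [|exact: sqint_mul..].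
by apply: eq_Rintegral => x _ /=; rewrite mulrDl.
Qed.

Lemma ipZl a f g : sqint f -> sqint g -> ip (fun x => a * f x) g = a * ip f g.
Proof.
move=> sf sg; rewrite -RintegralZl//; last exact: sqint_mul.
by apply: eq_Rintegral => x _ /=; rewrite mulrA.
Qed.

Lemma ipNl f g : sqint f -> sqint g -> ip (fun x => - f x) g = - ip f g.
Proof.
move=> sf sg; rewrite -mulN1r -ipZl//.
by apply: eq_Rintegral => x _; rewrite mulN1r.
Qed.

Lemma ipBl f g h : sqint f -> sqint g -> sqint h ->
  ip (fun x => f x - g x) h = ip f h - ip g h.
Proof. by move=> sf sg sh; rewrite ipDl ?ipNl//; exact: sqintN. Qed.

Lemma ip_suml (I : Type) (r : seq I) (f : I -> T -> R) g :
  (forall i, sqint (f i)) -> sqint g ->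
  ip (fun x => \sum_(i <- r) f i x) g = \sum_(i <- r) ip (f i) g.
Proof.
move=> sf sg; elim: r => [|i r IH].
  rewrite big_nil -[RHS]Rintegral0.
  by apply: eq_Rintegral => x _; rewrite big_nil mul0r.
rewrite big_cons -IH -ipDl//; last exact: sqint_sum.
by apply: eq_Rintegral => x _; rewrite big_cons.
Qed.

Lemma nsqD f g : sqint f -> sqint g ->
  nsq (fun x => f x + g x) = nsq f + 2 * ip f g + nsq g.
Proof.
move=> sf sg; have sfg := sqintD sf sg.
rewrite -!ipff ipDl// ![ip _ (fun x => _ + _)]ipC !ipDl// (ipC g f); ring.
Qed.

Lemma nsqZ a f : sqint f -> nsq (fun x => a * f x) = a ^+ 2 * nsq f.
Proof.
move=> sf; rewrite -!ipff ipZl//; last exact: sqintZ.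
by rewrite ipC ipZl// mulrA expr2.
Qed.

Lemma nsqN f : nsq (fun x => - f x) = nsq f.
Proof. by apply: eq_Rintegral => x _; rewrite sqrrN. Qed.

Lemma nsqB f g : sqint f -> sqint g ->
  nsq (fun x => f x - g x) = nsq f - 2 * ip f g + nsq g.
Proof.
move=> sf sg; rewrite nsqD ?nsqN//; last exact: sqintN.
by rewrite ipC ipNl// (ipC g f); ring.
Qed.

Lemma ip_cauchy_schwarz f g : sqint f -> sqint g ->
  ip f g ^+ 2 <= nsq f * nsq g.
Proof.
move=> sf sg; apply: discriminant_le0 => t.
have := nsq_ge0 (fun x => f x + t * g x).
rewrite nsqD//; last exact: sqintZ.
rewrite ipC ipZl// nsqZ// (ipC g f).
by rewrite (_ : _ + _ = nsq f + 2 * t * ip f g + t ^+ 2 * nsq g)//; ring.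
Qed.

Lemma nsqD_le f g : sqint f -> sqint g ->
  nsq (fun x => f x + g x) <= 2 * nsq f + 2 * nsq g.
Proof.
move=> sf sg; rewrite nsqD//.
by have := nsq_ge0 (fun x => f x - g x); rewrite nsqB//; lra.
Qed.

Lemma nsq_tri f g h : sqint f -> sqint g -> sqint h ->
  nsq (fun x => f x - h x) <=
  2 * nsq (fun x => f x - g x) + 2 * nsq (fun x => g x - h x).
Proof.
move=> sf sg sh; apply: le_trans (nsqD_le _ _); [|exact: sqintB..].
by rewrite /nsq; under [X in _ <= X]eq_Rintegral do rewrite addrA subrK.
Qed.

Definition cvgL2 (f : nat -> T -> R) g := nsq (fun x => f k x - g x) @[k --> \oo] --> 0.

(** The difference of the two products splits as <f-u, g-v> + <f-u, v> + <g-v, u>, and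
    Cauchy-Schwarz sends each term to 0. *)
Lemma cvgL2_ip (f g : nat -> T -> R) u v : (forall k, sqint (f k)) -> (forall k, sqint (g k)) ->
  sqint u -> sqint v -> cvgL2 f u -> cvgL2 g v ->
  ip (f k) (g k) @[k --> \oo] --> ip u v.
Proof.
move=> sf sg su sv fu gv.
have E k : ip (f k) (g k) - ip u v = ip (fun x => f k x - u x) (fun x => g k x - v x)
   + ip (fun x => f k x - u x) v + ip (fun x => g k x - v x) u.
  have h1 := sqintB (sf k) su; have h2 := sqintB (sg k) sv.
  rewrite !ipBl// 2![ip _ (fun x => _ - _)]ipC !ipBl//.
  by rewrite (ipC (g k) (f k)) (ipC v u) (ipC v (f k)) (ipC (g k) u); ring.
suff H : (fun k => ip (f k) (g k) - ip u v) @ \oo --> (0 : R).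
  rewrite (_ : (fun k => _) = (fun k => ip (f k) (g k) - ip u v + ip u v)).
    by rewrite -[X in _ --> X]add0r; apply: cvgD => //; exact: cvg_cst.
  by apply/funext => k; rewrite subrK.
have B (a b : nat -> T -> R) (M : nat -> R) : (forall k, sqint (a k)) ->
    (forall k, sqint (b k)) ->
    (fun k => nsq (a k) * nsq (b k)) @ \oo --> 0 ->
    (fun k => ip (a k) (b k)) @ \oo --> (0 : R).
  move=> sa sb ab.
  apply/cvgr0Pnorm_lt => e e0.
  have /cvgr0Pnorm_lt/(_ (e ^+ 2)) := ab; rewrite exprn_gt0// => /(_ isT).
  apply: filterS => k; rewrite ger0_norm ?mulr_ge0 ?nsq_ge0// => h.
  have := ip_cauchy_schwarz (sa k) (sb k) => h'.
  rewrite -(@ltr_pXn2r _ 2)// ?nnegrE// ?ltW// real_normK ?num_real//.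
  exact: le_lt_trans h' h.
under eq_fun do rewrite E.
have -> : (0 : R) = 0 + 0 + 0 by rewrite !addr0.
apply: cvgD; first apply: cvgD.
- apply: (B _ _ (fun=> 0)) => [k|k|]; [exact: sqintB..|].
  by rewrite -(mulr0 (0 : R)); exact: cvgM.
- apply: (B _ (fun=> v) (fun=> 0)) => [k|//|]; first exact: sqintB.
  by rewrite -(mul0r (nsq v)); apply: cvgM => //; exact: cvg_cst.
- apply: (B _ (fun=> u) (fun=> 0)) => [k|//|]; first exact: sqintB.
  by rewrite -(mul0r (nsq u)); apply: cvgM => //; exact: cvg_cst.
Qed.

Lemma cvgL2_cst f : cvgL2 (fun=> f) f.
Proof.
rewrite /cvgL2 (_ : (fun k => _) = cst 0); first exact: cvg_cst.
apply/funext => k /=; rewrite -[RHS]Rintegral0.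
by apply: eq_Rintegral => x _; rewrite subrr expr0n.
Qed.

Lemma cvgL2D (f g : nat -> T -> R) u v : (forall k, sqint (f k)) -> (forall k, sqint (g k)) ->
  sqint u -> sqint v -> cvgL2 f u -> cvgL2 g v ->
  cvgL2 (fun k x => f k x + g k x) (fun x => u x + v x).
Proof.
move=> sf sg su sv fu gv.
have H : (fun k => 2 * nsq (fun x => f k x - u x) + 2 * nsq (fun x => g k x - v x)) @ \oo --> (0 : R).
  have -> : (0 : R) = 2 * 0 + 2 * 0 by rewrite !mulr0 addr0.
  by apply: cvgD; apply: cvgM => //; exact: cvg_cst.
apply: (squeeze_cvgr _ (cvg_cst (0 : R)) H).
near=> k; rewrite nsq_ge0 /=; apply: le_trans (nsqD_le _ _); [|exact: sqintB..].
rewrite le_eqVlt; apply/orP; left; apply/eqP.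
by apply: eq_Rintegral => x _; rewrite opprD addrACA.
Unshelve. all: by end_near.
Qed.

Lemma cvgL2_sum (I : Type) (r : seq I) (f : I -> nat -> T -> R) u :
  (forall i k, sqint (f i k)) -> (forall i, sqint (u i)) ->
  (forall i, cvgL2 (f i) (u i)) ->
  cvgL2 (fun k x => \sum_(i <- r) f i k x) (fun x => \sum_(i <- r) u i x).
Proof.
move=> sf su fu; elim: r => [|i r IH].
  rewrite (_ : (fun k x => _) = (fun k => cst 0)); last first.
    by apply/funext => k; apply/funext => x; rewrite big_nil.
  rewrite (_ : (fun x => _) = cst 0); last by apply/funext => x; rewrite big_nil.
  exact: cvgL2_cst.
rewrite (_ : (fun k x => _) = (fun k x => f i k x + \sum_(j <- r) f j k x)); last first.
  by apply/funext => k; apply/funext => x; rewrite big_cons.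
rewrite (_ : (fun x => _) = (fun x => u i x + \sum_(j <- r) u j x)); last first.
  by apply/funext => x; rewrite big_cons.
by apply: cvgL2D => // [k|]; exact: sqint_sum.
Qed.

Lemma nsq_eq0 f : sqint f -> nsq f = 0 -> ae_eq mu D f (cst 0).
Proof.
move=> [mf If] f0.
have : (\int[mu]_(x in D) `|(f x ^+ 2)%:E|)%E = 0%E.
  rewrite (_ : (\int[mu]_(x in D) _)%E = (\int[mu]_(x in D) (f x ^+ 2)%:E)%E).
    rewrite -(fineK (integrable_fin_num mD If)); congr EFin; exact: f0.
  by apply: eq_integral => x _; rewrite /= ger0_norm// sqr_ge0.
move/ae_eq_integral_abs => -/(_ mD).
have m2 : measurable_fun D (fun x => (f x ^+ 2)%:E).
  exact/measurable_EFinP/measurable_funX.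
move=> /(_ m2); apply: filterS => x /= h Dx.
by have [] := h Dx; move/eqP; rewrite sqrf_eq0 => /eqP.
Qed.

Lemma ae_eq_Rintegral f g : measurable_fun D f -> measurable_fun D g ->
  ae_eq mu D f g -> \int[mu]_(x in D) f x = \int[mu]_(x in D) g x.
Proof.
move=> mf mg fg; congr fine; apply: ae_eq_integral => //.
- exact/measurable_EFinP.
- exact/measurable_EFinP.
- by apply: filterS fg => x /= h /h ->.
Qed.

Lemma nsq_ae_eq f g : sqint f -> sqint g -> ae_eq mu D f g ->
  nsq (fun x => f x - g x) = 0.
Proof.
move=> sf sg fg; have [m _] := sqintB sf sg.
rewrite -[RHS]Rintegral0; apply: ae_eq_Rintegral.
- exact: (@measurable_funX _ _ _ D (fun x => f x - g x)).
- exact: measurable_cst.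
- by apply: filterS fg => x /= h /h ->; rewrite subrr expr0n.
Qed.

Lemma cvgL2_ae (f : nat -> T -> R) u v : (forall k, sqint (f k)) -> sqint u -> sqint v ->
  ae_eq mu D u v -> cvgL2 f u -> cvgL2 f v.
Proof.
move=> sf su sv uv fu.
have H : (fun k => 2 * nsq (fun x => f k x - u x)) @ \oo --> (0 : R).
  by rewrite -(mulr0 2); apply: cvgM => //; exact: cvg_cst.
apply: (squeeze_cvgr _ (cvg_cst (0 : R)) H).
near=> k; rewrite nsq_ge0 /=; apply: le_trans (nsq_tri (sf k) su sv) _.
by rewrite (nsq_ae_eq su sv uv) mulr0 addr0.
Unshelve. all: by end_near.
Qed.

Lemma cvgL2_unique (f : nat -> T -> R) u v : (forall k, sqint (f k)) -> sqint u -> sqint v ->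
  cvgL2 f u -> cvgL2 f v -> ae_eq mu D u v.
Proof.
move=> sf su sv fu fv.
suff h : nsq (fun x => u x - v x) = 0.
  have := nsq_eq0 (sqintB su sv) h.
  by apply: filterS => x /= H /H /eqP; rewrite subr_eq0 => /eqP.
apply/eqP; rewrite eq_le nsq_ge0 andbT; apply/ler_addgt0Pl => e e0; rewrite addr0.
have e4 : 0 < e / 4 by rewrite divr_gt0.
have /cvgr0Pnorm_lt/(_ _ e4) F1 := fu; have /cvgr0Pnorm_lt/(_ _ e4) F2 := fv.
have [k []] := @filter_ex _ \oo _ _ (filterI F1 F2).
rewrite !ger0_norm ?nsq_ge0// => h1 h2.
have := nsq_tri su (sf k) sv.
have -> : nsq (fun x => u x - f k x) = nsq (fun x => f k x - u x).
  by rewrite -nsqN; apply: eq_Rintegral => x _; rewrite opprB.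
lra.
Qed.

Section finite.
Hypothesis muD : (mu D < +oo)%E.

Lemma bounded_integrable f M : measurable_fun D f -> (forall x, D x -> `|f x| <= M) ->
  mu.-integrable D (EFin \o f).
Proof.
move=> mf fM; apply: measurable_bounded_integrable => //.
exists M; split => [|x Mx y Dy]; first exact: num_real.
exact: le_trans (fM _ Dy) (ltW Mx).
Qed.

Lemma bounded_sqint f M : measurable_fun D f -> (forall x, D x -> `|f x| <= M) ->
  sqint f.
Proof.
move=> mf fM; split => //; apply: (@bounded_integrable (fun x => f x ^+ 2) (M ^+ 2)).
  exact: measurable_funX.
move=> x Dx; have h := fM x Dx.
by rewrite normrX lerXn2r// nnegrE; exact: le_trans h.
Qed.

Lemma sqint_integrable f : sqint f -> mu.-integrable D (EFin \o f).
Proof.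
move=> sf; have s1 : sqint (cst 1).
  by apply: (@bounded_sqint _ 1) => [|x _]; [exact: measurable_cst|rewrite normr1].
have := sqint_mul sf s1; rewrite (_ : (fun x => _) = EFin \o f)//.
by apply/funext => x; rewrite /= mulr1.
Qed.

End finite.

End square_integrable.

Lemma cvg_sqr (R : realType) (f : nat -> R) (l : R) : f k @[k --> \oo] --> l ->
  f k ^+ 2 @[k --> \oo] --> l ^+ 2.
Proof.
move=> fl; rewrite (_ : (fun k => _) = f * f); first by rewrite expr2; exact: cvgM.
by apply/funext => k; rewrite expr2.
Qed.

(** * Completeness of L2 on a set of finite measure *)

Section complete.
Context d (T : measurableType d) (R : realType).
Variable mu : {measure set T -> \bar R}.
Variable D : set T.
Hypothesis mD : measurable D.
Hypothesis muD : (mu D < +oo)%E.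

Lemma cvg_Rintegral_bounded (f : nat -> T -> R) (g : T -> R) (M : R) :
  (forall k, measurable_fun D (f k)) -> measurable_fun D g ->
  (forall k x, D x -> `|f k x| <= M) ->
  (forall x, D x -> f k x @[k --> \oo] --> g x) ->
  \int[mu]_(x in D) f k x @[k --> \oo] --> \int[mu]_(x in D) g x.
Proof.
move=> mf mg fM fg.
have iM : mu.-integrable D (cst M%:E).
  apply: (bounded_integrable mD muD (M := `|M|)) => //; exact: measurable_cst.
have [||||ig _ H] := @dominated_convergence _ _ _ mu D mD (fun k x => (f k x)%:E)
  (fun x => (g x)%:E) (cst M%:E) _ _ _ iM.
- by move=> k; exact/measurable_EFinP.
- exact/measurable_EFinP.
- apply: aeW => x Dx; apply: cvg_EFin; last exact: fg.
  by apply: nearW.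
- by apply: aeW => x k Dx; rewrite lee_fin; exact: fM.
- by apply: fine_cvg; rewrite fineK//; exact: integrable_fin_num.
Qed.

Lemma cvgL2_bounded (f : nat -> T -> R) (g : T -> R) (M : R) :
  (forall k, measurable_fun D (f k)) -> measurable_fun D g ->
  (forall k x, D x -> `|f k x| <= M) ->
  (forall x, D x -> f k x @[k --> \oo] --> g x) ->
  cvgL2 mu D f g.
Proof.
move=> mf mg fM fg.
have gM x : D x -> `|g x| <= M.
  move=> Dx; have h : `|f k x| @[k --> \oo] --> `|g x| by apply: cvg_norm; exact: fg.
  rewrite -(cvg_lim _ h)//; apply: limr_le; first by apply/cvg_ex; eexists; exact: h.
  by apply: nearW => k; exact: fM.
rewrite /cvgL2 -(Rintegral0 mu mD); apply: (cvg_Rintegral_bounded (M := (M + M) ^+ 2)).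
- move=> k; apply: (@measurable_funX _ _ _ D (fun x => f k x - g x)).
  exact: measurable_funB.
- exact: measurable_cst.
- move=> k x Dx; rewrite normrX lerXn2r// ?nnegrE//.
    by have := le_trans (normr_ge0 _) (gM x Dx); lra.
  by rewrite (le_trans (ler_normB _ _))// lerD// ?fM ?gM.
- move=> x Dx; have h : (fun k => f k x - g x) @ \oo --> g x - g x.
    by apply: cvgB; [exact (fg x Dx)|exact: cvg_cst].
  rewrite subrr in h.
  by have := cvg_sqr h; rewrite expr0n.
Qed.

(** The sum of the absolute increments has finite integral, hence is finite almost everywhere, and
    there the telescoping series converges absolutely. *)
Lemma integrable_abs_series_cvg (h : nat -> T -> R) :
  (forall k, measurable_fun D (h k)) ->
  (\sum_(0 <= k <oo) \int[mu]_(x in D) (`|h k.+1 x - h k x|)%:E < +oo)%E ->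
  {ae mu, forall x, D x -> cvgn (h ^~ x)}.
Proof.
move=> mh Hs.
pose a k x := (`|h k.+1 x - h k x|)%:E.
have ma k : measurable_fun D (a k).
  by apply/measurable_EFinP/measurableT_comp => //; exact: measurable_funB.
have a0 k x : D x -> (0 <= a k x)%E by move=> _; rewrite lee_fin.
have mS : measurable_fun D (fun x => \sum_(0 <= k <oo) a k x)%E.
  by apply: (@ge0_emeasurable_sum _ _ _ D a xpredT) => k *; [exact: a0|exact: ma].
have iS : mu.-integrable D (fun x => \sum_(0 <= k <oo) a k x)%E.
  apply/integrableP; split => //.
  under eq_integral => x Dx.
    rewrite gee0_abs; last by apply: nneseries_ge0 => k _ _; rewrite lee_fin.
    over.
  by rewrite integral_nneseries.
have := integrable_ae mD iS; apply: filterS => x /= H Dx.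
have {}H := H Dx.
have -> : h ^~ x = (fun k => h 0%N x + series (fun k => h k.+1 x - h k x) k).
  by apply/funext => k; rewrite /series /= telescope_sumr// addrC subrK.
apply: is_cvgD; first exact: is_cvg_cst.
apply: normed_cvg.
apply: nondecreasing_is_cvgn.
  apply/nondecreasing_seqP => n.
  rewrite -[leRHS]/(series (fun k => `|h k.+1 x - h k x|) n.+1) seriesSr lerDl.
  exact: normr_ge0.
exists (fine (\sum_(0 <= k <oo) a k x)%E) => _ [n _ <-].
rewrite -lee_fin fineK//.
rewrite (_ : _ n = \sum_(0 <= k < n) `|h k.+1 x - h k x|)// -sumEFin.
by apply: nneseries_lim_ge => k _ _; rewrite lee_fin.
Qed.

(** Expanding (|f| - e)^2 / e >= 0 gives a bound linear in [nsq]; with e = 2^-k and [nsq] at most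
    4^-k both terms are of order 2^-k. *)
Lemma abs_integral_le (f : T -> R) e : sqint mu D f -> 0 < e ->
  (\int[mu]_(x in D) (`|f x|)%:E <= (e^-1 * nsq mu D f + e * fine (mu D))%:E)%E.
Proof.
move=> sf e0.
have i1 := sqint_integrable mD muD sf.
have [mf i2] := sf.
have mcst (r : R) : mu.-integrable D (EFin \o cst r).
  by apply: (bounded_integrable mD muD (M := `|r|)).
have i3 : mu.-integrable D (EFin \o (fun x => e^-1 * f x ^+ 2)) by exact: (integrableZl mD e^-1 i2).
have fmu : mu D \is a fin_num by rewrite ge0_fin_numE.
have -> : ((e^-1 * nsq mu D f + e * fine (mu D))%:E =
   \int[mu]_(x in D) (e^-1 * f x ^+ 2 + e)%:E)%E.
  rewrite (integralD_EFin mD i3 (mcst e)).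
  rewrite EFinD; congr (_ + _)%E.
    rewrite -(@RintegralZl _ _ _ mu D (fun x => f x ^+ 2))// fineK//.
    exact: (integrable_fin_num mD i3).
  rewrite [RHS](_ : _ = e%:E * mu D)%E ?EFinM ?fineK//.
  by rewrite -integral_cst.
apply: ge0_le_integral.
- exact: mD.
- by move=> x _; rewrite lee_fin.
- exact/measurable_EFinP/measurableT_comp.
- apply/measurable_EFinP/measurable_funD; last exact: measurable_cst.
  by apply: measurable_funM; [exact: measurable_cst|exact: measurable_funX].
move=> x Dx; rewrite lee_fin.
have : 0 <= e^-1 * (`|f x| - e) ^+ 2 by rewrite mulr_ge0 ?sqr_ge0// invr_ge0 ltW.
rewrite sqrrB real_normK ?num_real// !mulrDr mulrN.
have -> : e^-1 * (`|f x| * e *+ 2) = `|f x| *+ 2 by field; rewrite gt_eqF.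
have -> : e^-1 * e ^+ 2 = e by field; rewrite gt_eqF.
by have := normr_ge0 (f x); lra.
Qed.

(** Stated with extended integrals because the square-integrability of the limit is one of the
    things it is used to prove. *)
Lemma fatou_nsq (h : nat -> T -> R) (g : T -> R) c : (forall k, measurable_fun D (h k)) ->
  measurable_fun D g -> {ae mu, forall x, D x -> h k x @[k --> \oo] --> g x} ->
  (\forall k \near \oo, (\int[mu]_(x in D) (h k x ^+ 2)%:E <= c%:E)%E) ->
  (\int[mu]_(x in D) (g x ^+ 2)%:E <= c%:E)%E.
Proof.
move=> mh mg hg hc.
have mh2 k : measurable_fun D (fun x => (h k x ^+ 2)%:E).
  by apply/measurable_EFinP/measurable_funX.
have mg2 : measurable_fun D (fun x => (g x ^+ 2)%:E).
  by apply/measurable_EFinP/measurable_funX.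
have h0 k x : D x -> (0 <= (h k x ^+ 2)%:E)%E by rewrite lee_fin sqr_ge0.
have := fatou mu mD mh2 h0.
have -> : (\int[mu]_(x in D) limn_einf (fun k => (h k x ^+ 2)%:E) =
    \int[mu]_(x in D) (g x ^+ 2)%:E)%E.
  apply: ae_eq_integral => //.
    have mO := @oppe_measurable R setT.
    apply: (measurableT_comp mO (g := fun x => limn_esup (fun k => - (h k x ^+ 2)%:E)%E)).
    apply: measurable_fun_limn_esup => k.
    exact: (measurableT_comp mO (mh2 k)).
  apply: filterS hg => x /= H Dx.
  have H2 : (h k x ^+ 2)%:E @[k --> \oo] --> (g x ^+ 2)%:E.
    apply: cvg_EFin; first exact: nearW.
    exact: cvg_sqr (H Dx).
  by rewrite (cvg_limn_einf_sup H2).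
move=> /le_trans; apply.
rewrite limn_einf_lim; apply: lime_le; first exact: is_cvg_einfs.
have [N _ HN] := hc.
apply: nearW => n.
apply: (@le_trans _ _ (\int[mu]_(x in D) (h (maxn n N) x ^+ 2)%:E)%E).
  by apply: ereal_inf_lbound => /=; exists (maxn n N) => //=; rewrite leq_maxl.
by apply: HN => /=; rewrite leq_maxr.
Qed.

Lemma nsqE (f : T -> R) : sqint mu D f -> (\int[mu]_(x in D) (f x ^+ 2)%:E)%E = (nsq mu D f)%:E.
Proof. by move=> [_ If]; rewrite fineK//; exact: integrable_fin_num. Qed.

(** Riesz-Fischer: a subsequence with squared increments at most 4^-j converges almost everywhere,
    and Fatou turns the Cauchy bounds into bounds on the distance to that limit. *)
Theorem sqint_complete (f : nat -> T -> R) : (forall k, sqint mu D (f k)) ->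
  (forall e, 0 < e -> exists N, forall k l, (N <= k)%N -> (N <= l)%N ->
     nsq mu D (fun x => f k x - f l x) <= e) ->
  exists g, sqint mu D g /\ cvgL2 mu D f g.
Proof.
move=> sf Cf.
have /choice[N HN] : forall j : nat, exists N, forall k l, (N <= k)%N -> (N <= l)%N ->
    nsq mu D (fun x => f k x - f l x) <= 4^-1 ^+ j.
  by move=> j; apply: Cf; rewrite exprn_gt0.
(* Summing the thresholds makes the indices nondecreasing while keeping [n j] above [N j]. *)
pose n j := (\sum_(i < j.+1) N i)%N.
have nS j : (n j <= n j.+1)%N by rewrite /n [leqRHS]big_ord_recr /= leq_addr.
have nN j : (N j <= n j)%N by rewrite /n big_ord_recr /= leq_addl.
pose h j := f (n j).
have sh j : sqint mu D (h j) by exact: sf.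
have mh j : measurable_fun D (h j) by case: (sh j).
have hcv : {ae mu, forall x, D x -> cvgn (h ^~ x)}.
  apply: integrable_abs_series_cvg => //.
  pose C := 1 + fine (mu D).
  (* The majorant C 2^-k is written as two halves, each a geometric series summing to C. *)
  apply: (@le_lt_trans _ _ (\sum_(0 <= k <oo) (C / (2 ^ (k + 1))%:R + C / (2 ^ (k + 1))%:R)%:E)%E).
    apply: lee_nneseries => k *; first by apply: integral_ge0 => x _; rewrite lee_fin.
    have sk := sqintB mD (sh k.+1) (sh k).
    have e0 : 0 < 2^-1 ^+ k :> R by rewrite exprn_gt0.
    apply: le_trans (abs_integral_le sk e0) _.
    have -> : C / (2 ^ (k + 1))%:R = C * (2^-1 * 2^-1 ^+ k).
      by rewrite addn1 natrX exprS invfM exprVn.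
    rewrite lee_fin /C.
    have := HN k (n k.+1) (n k) (leq_trans (nN k) (nS k)) (nN k).
    rewrite -/(h k.+1) -/(h k) => H.
    have : (2^-1 ^+ k)^-1 * nsq mu D (fun x => h k.+1 x - h k x) <= 2^-1 ^+ k.
      rewrite ler_pdivrMl// -exprMn.
      by rewrite -invfM -natrM.
    move=> hk; apply: le_trans (lerD hk (lexx _)) _.
    by rewrite le_eqVlt; apply/orP; left; apply/eqP; field.
  rewrite (_ : (\sum_(0 <= k <oo) _)%E = (C + C)%:E) ?ltry//.
  under eq_eseriesr do rewrite EFinD.
  rewrite nneseriesD; [|by move=> k _ _; rewrite lee_fin divr_ge0// addr_ge0// fine_ge0..].
  have H : (\sum_(0 <= k <oo) (C / (2 ^ (k + 1))%:R)%:E = C%:E)%E.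
    rewrite [in RHS](_ : C = C / 2 ^+ 0); last by rewrite expr0 divr1.
    by apply/cvg_lim => //; exact: (@cvg_geometric_eseries_half R C 0).
  by rewrite H.
(* The upper limit is measurable and defined at every point; it agrees with the limit wherever the
   subsequence converges. *)
pose G x := limn_esup (fun j => (h j x)%:E).
pose g x := fine (G x).
have mG : measurable_fun D G.
  by apply: measurable_fun_limn_esup => k; exact/measurable_EFinP.
have mg : measurable_fun D g.
  exact: (measurableT_comp (fine_measurable measurableT) mG).
have hg : {ae mu, forall x, D x -> h k x @[k --> \oo] --> g x}.
  apply: filterS hcv => x /= H Dx; have {}H := H Dx.
  have H2 : (h k x)%:E @[k --> \oo] --> (limn (h ^~ x))%:E.
    by apply: cvg_EFin => //; exact: nearW.
  by rewrite /g /G (cvg_limn_einf_sup H2).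
have key j k : (N j <= k)%N ->
    (\int[mu]_(x in D) ((f k x - g x) ^+ 2)%:E <= (4^-1 ^+ j)%:E)%E.
  move=> Nk; apply: (@fatou_nsq (fun i x => f k x - h i x)).
  - by move=> i; apply: measurable_funB => //; case: (sf k).
  - by apply: measurable_funB => //; case: (sf k).
  - by apply: filterS hg => x /= H Dx; apply: cvgB; [exact: cvg_cst|exact: H].
  - exists j => // i /= ji; rewrite nsqE; last exact: sqintB.
    rewrite lee_fin; apply: HN => //.
    apply: leq_trans (nN j) _; rewrite -(subnKC ji).
    by elim: (i - j)%N => [|p IH]; rewrite ?addn0// addnS (leq_trans IH).
have sfg j k : (N j <= k)%N -> sqint mu D (fun x => f k x - g x).
  move=> Nk; have m : measurable_fun D (fun x => f k x - g x).
    by apply: measurable_funB => //; case: (sf k).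
  split => //; apply/integrableP; split.
    by apply/measurable_EFinP/measurable_funX.
  under eq_integral do rewrite /= ger0_norm ?sqr_ge0//.
  exact: le_lt_trans (key j k Nk) (ltry _).
exists g; split.
  have := sqintB mD (sf (N 0%N)) (sfg 0%N (N 0%N) (leqnn _)).
  by rewrite (_ : (fun x => _) = g)//; apply/funext => x; rewrite opprB addrC subrK.
apply/cvgr0Pnorm_lt => e e0.
have [j je] : exists j, 4^-1 ^+ j < e.
  have := @cvg_expr R 4^-1; rewrite ger0_norm// => /(_ _)/cvgr0Pnorm_lt H.
  have h14 : (4^-1 : R) < 1 by rewrite invf_lt1// ltr1n.
  have [j _ /(_ j (leqnn _))] := H h14 _ e0.
  by move=> /(le_lt_trans (ler_norm _)) ?; exists j.
exists (N j) => // k /= Nk.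
rewrite ger0_norm ?nsq_ge0//; apply: le_lt_trans je.
by rewrite -lee_fin -nsqE; [exact: key|exact: sfg Nk].
Qed.

End complete.

(** * Partial derivatives and smooth functions *)

(* Locked copies of the notions of the statement: unfolding them is what makes
   conversion of terms with iterated derivatives diverge. *)
HB.lock Definition pd (R : realType) (d : nat) (i : 'I_d) (f : 'rV[R]_d -> R) :
  'rV[R]_d -> R := partial i f.
HB.lock Definition smth (R : realType) (d : nat) (f : 'rV[R]_d -> R) : Prop :=
  smooth f.
Definition pds (R : realType) (d : nat) (s : seq 'I_d) (f : 'rV[R]_d -> R) :
  'rV[R]_d -> R := foldr (@pd R d) f s.

Lemma pdsE (R : realType) (d : nat) (s : seq 'I_d) (f : 'rV[R]_d -> R) :
  pds s f = partials s f.
Proof. by rewrite /pds pd.unlock. Qed.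

Section calculus.
Context {R : realType} {d : nat}.
Local Notation V := 'rV[R]_d.
Local Notation e_ i := (delta_mx 0 i : V).
Implicit Types (f g : V -> R) (i j : 'I_d).

Lemma is_derive_line f (v x : V) (t : R) : derivable f (t *: v + x) v ->
  is_derive t (1 : R) (fun s => f (s *: v + x)) ('D_v f (t *: v + x)).
Proof.
have E : (fun h : R => h^-1 *: (((fun s => f (s *: v + x)) \o shift t) (h *: 1) -
    f (t *: v + x))) =
    (fun h => h^-1 *: ((f \o shift (t *: v + x)) (h *: v) - f (t *: v + x))).
  apply/funext => h /=; congr (_ *: (f _ - _)).
  by rewrite scalerDl addrA -scalerA scale1r.
by move=> df; split; rewrite /derivable /derive E.
Qed.

Lemma partialE f i x a : is_derive x (e_ i) f a -> pd i f x = a.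
Proof. by rewrite pd.unlock => -[_ <-]. Qed.

(** Recursion on the order lets Leibniz and chain rules be proved one order at a time; [smoothP]
    relates it to the quantification over words. *)
Fixpoint Ck k f : Prop := match k with
  | 0 => continuous f
  | k'.+1 => continuous f /\
      forall i, (forall x, derivable f x (e_ i)) /\ Ck k' (pd i f)
  end.

Lemma smooth_partial f i : smth f -> smth (pd i f).
Proof.
rewrite smth.unlock pd.unlock => sf s; have := sf (rcons s i).
by rewrite /partials foldr_rcons.
Qed.

Lemma smooth_partials f s : smth f -> smth (pds s f).
Proof. by move=> sf; elim: s => [|i s]; [exact: sf|exact: smooth_partial]. Qed.

Lemma smooth_continuous f : smth f -> continuous f.
Proof. by rewrite smth.unlock => /(_ [::])[]. Qed.

Lemma smooth_derivable f i x : smth f -> derivable f x (e_ i).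
Proof. by rewrite smth.unlock => /(_ [::])[]. Qed.

Lemma smooth_is_derive f i x : smth f -> is_derive x (e_ i) f (pd i f x).
Proof. by move=> sf; rewrite pd.unlock; split => //; exact: smooth_derivable. Qed.

Lemma is_derive_line_pd f i x t : smth f ->
  is_derive t (1 : R) (fun s => f (s *: e_ i + x)) (pd i f (t *: e_ i + x)).
Proof. by move=> sf; rewrite pd.unlock; apply/is_derive_line/smooth_derivable. Qed.

Lemma smoothP f : smth f <-> forall k, Ck k f.
Proof.
split => [sf k|cf].
  elim: k f sf => [|k IH] f sf /=; first exact: smooth_continuous.
  split => [|i]; first exact: smooth_continuous.
  split => [x|]; first exact: smooth_derivable.
  exact/IH/smooth_partial.
rewrite smth.unlock => s; elim/last_ind: s f cf => [|s i IH] f cf.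
  by have [cf1 H] := cf 1%N; split => // i x; have [] := H i.
rewrite /partials foldr_rcons; apply: IH => k.
have -> : partial i f = pd i f by rewrite pd.unlock.
by have [_ H] := cf k.+1; have [] := H i.
Qed.

Lemma partialD f g i : (forall x, derivable f x (e_ i)) ->
  (forall x, derivable g x (e_ i)) ->
  pd i (fun x => f x + g x) = fun x => pd i f x + pd i g x.
Proof. by rewrite pd.unlock => df dg; apply/funext => x; exact: deriveD. Qed.

Lemma partialM f g i : (forall x, derivable f x (e_ i)) ->
  (forall x, derivable g x (e_ i)) ->
  pd i (fun x => f x * g x) = fun x => pd i f x * g x + f x * pd i g x.
Proof.
rewrite pd.unlock => df dg; apply/funext => x.
rewrite -[LHS]/('D_(e_ i) (f * g) x) deriveM//; rewrite /GRing.scale /=; rewrite /partial; ring.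
Qed.

Lemma partial_cst c i : pd i (cst c : V -> R) = cst 0.
Proof. by rewrite pd.unlock; apply/funext => x; exact: derive_cst. Qed.

Lemma CkD k f g : Ck k f -> Ck k g -> Ck k (fun x => f x + g x).
Proof.
elim: k f g => [|k IH] f g /=.
  by move=> cf cg x; exact: (cvgD (cf x) (cg x)).
move=> [cf df] [cg dg]; split.
  by move=> x; exact: (cvgD (cf x) (cg x)).
move=> i; have [dfi Cfi] := df i; have [dgi Cgi] := dg i; split.
  by move=> x; exact: derivableD.
by rewrite partialD//; exact: IH.
Qed.

Lemma Ck_sub k f : Ck k.+1 f -> Ck k f.
Proof.
elim: k f => [|k IH] f; first by case.
by move=> [cf df]; split => // i; have [? ?] := df i; split => //; exact: IH.
Qed.

Lemma CkM k f g : Ck k f -> Ck k g -> Ck k (fun x => f x * g x).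
Proof.
elim: k f g => [|k IH] f g.
  by move=> cf cg x; exact: (cvgM (cf x) (cg x)).
move=> Cf Cg; have /= [cf df] := Cf; have /= [cg dg] := Cg; split.
  by move=> x; exact: (cvgM (cf x) (cg x)).
move=> i; have [dfi Cfi] := df i; have [dgi Cgi] := dg i; split.
  by move=> x; exact: derivableM.
by rewrite partialM//; apply: CkD; apply: IH => //; exact: Ck_sub.
Qed.

Lemma smoothD f g : smth f -> smth g -> smth (fun x => f x + g x).
Proof. by move=> /smoothP cf /smoothP cg; apply/smoothP => k; exact: CkD. Qed.

Lemma smoothM f g : smth f -> smth g -> smth (fun x => f x * g x).
Proof. by move=> /smoothP cf /smoothP cg; apply/smoothP => k; exact: CkM. Qed.

Lemma Ck_cst k c : Ck k (cst c).
Proof.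
elim: k c => [|k IH] c /=; first exact: cst_continuous.
split; first exact: cst_continuous.
by move=> i; rewrite partial_cst; split => // x; exact: derivable_cst.
Qed.

Lemma smooth_cst c : smth (cst c : V -> R).
Proof. by apply/smoothP => k; exact: Ck_cst. Qed.

Definition coord j : V -> R := fun x => x 0 j.

Lemma is_derive_coord j i x : is_derive x (e_ i) (coord j) (i == j)%:R.
Proof.
have E : (fun h : R => h^-1 *: ((coord j \o shift x) (h *: e_ i) - coord j x)) @ 0^'
    --> ((i == j)%:R : R).
  apply: (@cvg_trans _ ((cst ((i == j)%:R : R)) @ (0 : R)^')); last exact: cvg_cst.
  apply: near_eq_cvg; near=> h.
  rewrite /coord /= !mxE eqxx /= addrK (eq_sym j) /GRing.scale /= mulrA mulVf ?mul1r//.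
  by near: h; exact: nbhs_dnbhs_neq.
split; first by apply/cvg_ex; eexists; exact: E.
exact/cvg_lim.
Unshelve. all: by end_near.
Qed.

Lemma partial_coord j i : pd i (coord j) = cst (i == j)%:R.
Proof. by apply/funext => x; exact/partialE/is_derive_coord. Qed.

Lemma smooth_coord j : smth (coord j).
Proof.
apply/smoothP; case=> [|k] /=; first exact: coord_continuous.
split; first exact: coord_continuous.
move=> i; split; first by move=> x; have [] := is_derive_coord j i x.
by rewrite partial_coord; exact: Ck_cst.
Qed.

Lemma smoothZ c f : smth f -> smth (fun x => c * f x).
Proof. by apply: smoothM; exact: smooth_cst. Qed.

Lemma smoothN f : smth f -> smth (fun x => - f x).
Proof.
move=> /(smoothZ (-1)); rewrite (_ : (fun x => _) = fun x => - f x)//.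
by apply/funext => x; rewrite mulN1r.
Qed.

Lemma smoothB f g : smth f -> smth g -> smth (fun x => f x - g x).
Proof. by move=> sf sg; apply: smoothD; [exact: sf|exact: smoothN]. Qed.

Lemma smooth_sum (I : Type) (r : seq I) (F : I -> V -> R) :
  (forall a, smth (F a)) -> smth (fun x => \sum_(a <- r) F a x).
Proof.
move=> sF; elim: r => [|a r IH].
  rewrite (_ : (fun x => _) = cst 0); first exact: smooth_cst.
  by apply/funext => x; rewrite big_nil.
rewrite (_ : (fun x => _) = (fun x => F a x + \sum_(b <- r) F b x)).
  by apply: smoothD; [exact: sF|exact: IH].
by apply/funext => x; rewrite big_cons.
Qed.

Lemma partialDs f g i : smth f -> smth g ->
  pd i (fun x => f x + g x) = fun x => pd i f x + pd i g x.
Proof. by move=> sf sg; apply: partialD => x; exact: smooth_derivable. Qed.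

Lemma partialMs f g i : smth f -> smth g ->
  pd i (fun x => f x * g x) = fun x => pd i f x * g x + f x * pd i g x.
Proof. by move=> sf sg; apply: partialM => x; exact: smooth_derivable. Qed.

Lemma partialZ c f i : smth f -> pd i (fun x => c * f x) = fun x => c * pd i f x.
Proof.
move=> sf; rewrite (partialMs i (smooth_cst c) sf) partial_cst.
by apply/funext => x; rewrite mul0r add0r.
Qed.

Lemma partialNs f i : smth f -> pd i (fun x => - f x) = fun x => - pd i f x.
Proof.
move=> sf; rewrite -[RHS]/(fun x => - pd i f x).
rewrite (_ : (fun x => - f x) = fun x => -1 * f x); last first.
  by apply/funext => x; rewrite mulN1r.
by rewrite partialZ//; apply/funext => x; rewrite mulN1r.
Qed.

Lemma partial_sum (I : Type) (r : seq I) (F : I -> V -> R) i :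
  (forall a, smth (F a)) ->
  pd i (fun x => \sum_(a <- r) F a x) = fun x => \sum_(a <- r) pd i (F a) x.
Proof.
move=> sF; elim: r => [|a r IH].
  rewrite (_ : (fun x => _) = cst 0); last by apply/funext => x; rewrite big_nil.
  by rewrite partial_cst; apply/funext => x; rewrite big_nil.
rewrite (_ : (fun x => _) = (fun x => F a x + \sum_(b <- r) F b x)); last first.
  by apply/funext => x; rewrite big_cons.
rewrite (partialDs i (sF a) (smooth_sum r sF)).
by rewrite IH; apply/funext => x; rewrite big_cons.
Qed.

Lemma partials_sum (I : Type) (r : seq I) (F : I -> V -> R) s :
  (forall a, smth (F a)) ->
  pds s (fun x => \sum_(a <- r) F a x) = fun x => \sum_(a <- r) pds s (F a) x.
Proof.
move=> sF; elim: s => [//|i s /= ->]; apply: partial_sum => a.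
exact: smooth_partials.
Qed.

Lemma partialsD f g s : smth f -> smth g ->
  pds s (fun x => f x + g x) = fun x => pds s f x + pds s g x.
Proof.
move=> sf sg; elim: s => [//|i s /= ->].
exact: (partialDs i (smooth_partials s sf) (smooth_partials s sg)).
Qed.

Lemma partialsZ c f s : smth f -> pds s (fun x => c * f x) = fun x => c * pds s f x.
Proof.
move=> sf; elim: s => [//|i s /= ->].
exact: (partialZ c i (smooth_partials s sf)).
Qed.

(* Clairaut-Schwarz: the second difference of f over a small square is a value
   of either mixed derivative nearby. *)
Lemma second_difference f i j x (h : R) : smth f -> 0 < h ->
  exists s t : R, [/\ 0 < s < h, 0 < t < h &
    f (h *: e_ j + (h *: e_ i + x)) - f (h *: e_ j + x) - f (h *: e_ i + x) + f x =
    h ^+ 2 * pd j (pd i f) (t *: e_ j + (s *: e_ i + x))].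
Proof.
move=> sf h0.
(* The mean value theorem is applied first to the increment in direction j, as a function of the
   displacement along i, then to [pd i f] along j. *)
pose u s := f (s *: e_ i + (h *: e_ j + x)) - f (s *: e_ i + x).
have du s : is_derive s (1 : R) u
   (pd i f (s *: e_ i + (h *: e_ j + x)) - pd i f (s *: e_ i + x)).
  by apply: is_deriveB; exact: is_derive_line_pd.
have cont (w : R -> R) (dw : R -> R) : (forall s : R, is_derive s (1 : R) w (dw s)) ->
    {within `[0, h]%classic, continuous w}.
  move=> H; apply: continuous_subspaceT => s.
  by apply/differentiable_continuous/derivable1_diffP; have [] := H s.
have [s + E1] := MVT h0 (fun s _ => du s) (cont _ _ du).
rewrite in_itv /= => sh.
pose v t := pd i f (t *: e_ j + (s *: e_ i + x)).
have dv t : is_derive t (1 : R) v (pd j (pd i f) (t *: e_ j + (s *: e_ i + x))).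
  exact/is_derive_line_pd/smooth_partial.
have [t + E2] := MVT h0 (fun t _ => dv t) (cont _ _ dv).
rewrite in_itv /= => th; exists s, t; split => //.
move: E1 E2; rewrite /u /v !scale0r !add0r !subr0 => E1 E2.
have A (y z w : V) : y + (z + w) = z + (y + w) by rewrite addrCA.
rewrite (A (h *: e_ j)); move: E1; rewrite (A (s *: e_ i)) E2 => E1.
transitivity (f (h *: e_ i + (h *: e_ j + x)) - f (h *: e_ i + x) - (f (h *: e_ j + x) - f x)).
  by ring.
by rewrite E1; ring.
Qed.

(** The second difference is symmetric in i and j, so the two mixed derivatives share a value at
    points arbitrarily close to x; continuity concludes. *)
Lemma partialC f i j : smth f -> pd i (pd j f) = pd j (pd i f).
Proof.
move=> sf; apply/funext => x; apply/eqP; rewrite -subr_eq0 -normr_eq0 eq_le normr_ge0 andbT.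
apply/ler_addgt0Pl => e e0; rewrite addr0.
have cij : continuous (pd i (pd j f)).
  by apply: smooth_continuous; do 2 apply: smooth_partial.
have cji : continuous (pd j (pd i f)).
  by apply: smooth_continuous; do 2 apply: smooth_partial.
have e2 : 0 < e / 2 by rewrite divr_gt0.
have loc (F : V -> R) : continuous F ->
    exists2 a : R, 0 < a & forall y, ball x a y -> `|F x - F y| < e / 2.
  by move=> cF; have /cvgrPdist_lt/(_ _ e2)/nbhs_ballP[a a0 Ha] := cF x; exists a.
have [a a0 Ha] := loc _ cij; have [b b0 Hb] := loc _ cji.
(* The intermediate points are within 2h of x in the sup norm, so a third of the smaller radius
   keeps them inside both balls. *)
pose h := Num.min a b / 3.
have h0 : 0 < h by rewrite divr_gt0// lt_min a0.
have hh : h + h < Num.min a b.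
  have : 0 < Num.min a b by rewrite lt_min a0.
  by rewrite /h; lra.
have B k l (s t c : R) : 0 < s < h -> 0 < t < h -> Num.min a b <= c ->
    ball x c (t *: e_ k + (s *: e_ l + x)).
  move=> /andP[s0 sh] /andP[t0 th] hc.
  rewrite -ball_normE /= addrA opprD addrCA subrr addr0 normrN.
  apply: le_lt_trans (ler_normD _ _) _.
  have n1 m : `|e_ m| <= 1.
    rewrite [leLHS]mx_normrE; apply/bigmax_leP; split => // -[p q] _ /=.
    by rewrite mxE; case: (_ && _); rewrite ?normr1 ?normr0.
  rewrite !normrZ !gtr0_norm//.
  have h1 : t * `|e_ k| <= t by rewrite ler_piMr// ltW.
  have h2 : s * `|e_ l| <= s by rewrite ler_piMr// ltW.
  lra.
have [s [t [hs ht E1]]] := second_difference i j x sf h0.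
have [s' [t' [hs' ht' E2]]] := second_difference j i x sf h0.
have sym (a1 a2 : V) : f (a1 + (a2 + x)) - f (a1 + x) - f (a2 + x) + f x =
    f (a2 + (a1 + x)) - f (a2 + x) - f (a1 + x) + f x.
  by rewrite (addrCA a1); congr (_ + _); rewrite addrAC.
have E : pd j (pd i f) (t *: e_ j + (s *: e_ i + x)) =
         pd i (pd j f) (t' *: e_ i + (s' *: e_ j + x)).
  have h2 : h ^+ 2 != 0 by rewrite expf_neq0// gt_eqF.
  exact: (mulfI h2 (etrans (esym E1) (etrans (sym _ _) E2))).
have := Ha _ (B i j s' t' a hs' ht' _); rewrite ge_min lexx => /(_ isT) /= h1.
have := Hb _ (B j i s t b hs ht _); rewrite ge_min lexx orbT => /(_ isT) /= h2.
rewrite E in h2.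
set u := pd i (pd j f) (t' *: e_ i + (s' *: e_ j + x)) in h1 h2.
have -> : pd i (pd j f) x - pd j (pd i f) x =
  (pd i (pd j f) x - u) - (pd j (pd i f) x - u) by ring.
by apply: le_trans (ler_normB _ _) _; lra.
Qed.

Lemma partials_partialC f i s : smth f ->
  pds s (pd i f) = pd i (pds s f).
Proof.
move=> sf; elim: s => //= j s ->.
by rewrite (partialC _ _ (smooth_partials _ sf)).
Qed.

Definition lap f : V -> R := fun x => \sum_(i < d) pd i (pd i f) x.
Definition euler f : V -> R := fun x => \sum_(i < d) x 0 i * pd i f x.
Definition rho : V -> R := fun x => 1 - \sum_(i < d) x 0 i ^+ 2.

Lemma smooth_lap f : smth f -> smth (lap f).
Proof. by move=> sf; apply: smooth_sum => i; do 2 apply: smooth_partial. Qed.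

Lemma smooth_lapn k f : smth f -> smth (iter k lap f).
Proof. by move=> sf; elim: k => //= k; exact: smooth_lap. Qed.

Lemma smooth_euler f : smth f -> smth (euler f).
Proof.
move=> sf; apply: smooth_sum => i; apply: (smoothM (smooth_coord i)).
exact: smooth_partial.
Qed.

Lemma smooth_rho : smth rho.
Proof.
apply: (smoothB (smooth_cst 1)); apply: smooth_sum => i.
rewrite (_ : (fun x => _) = fun x => coord i x * coord i x).
  by apply: smoothM; exact: smooth_coord.
by apply/funext => x; rewrite expr2.
Qed.

Lemma partial_rho i : pd i rho = fun x => - 2 * x 0 i.
Proof.
have sq j : smth (fun x => coord j x * coord j x) by apply: smoothM; exact: smooth_coord.
have -> : rho = fun x => cst 1 x + - (\sum_(j < d) coord j x * coord j x).
  by apply/funext => x; rewrite /rho; congr (_ - _); apply: eq_bigr => j _; rewrite expr2.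
rewrite partialDs; [|exact: smooth_cst|by apply/smoothN/smooth_sum].
rewrite partial_cst partialNs ?partial_sum//; last exact: smooth_sum.
apply/funext => x; rewrite add0r (bigD1 i)//= big1 ?addr0.
  rewrite (partialMs i (smooth_coord i) (smooth_coord i)) partial_coord eqxx /= mul1r mulr1.
  by rewrite /coord; ring.
move=> j ji; rewrite (partialMs i (smooth_coord j) (smooth_coord j)) partial_coord.
by rewrite eq_sym (negbTE ji) /= mul0r mulr0 addr0.
Qed.

Lemma lapD f g : smth f -> smth g ->
  lap (fun x => f x + g x) = fun x => lap f x + lap g x.
Proof.
move=> sf sg; apply/funext => x; rewrite /lap -big_split; apply: eq_bigr => i _ /=.
by rewrite !partialDs//; exact: smooth_partial.
Qed.

Lemma lapZ c f : smth f -> lap (fun x => c * f x) = fun x => c * lap f x.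
Proof.
move=> sf; apply/funext => x; rewrite /lap mulr_sumr; apply: eq_bigr => i _ /=.
by rewrite !partialZ//; exact: smooth_partial.
Qed.

Lemma partial_lap i f : smth f -> pd i (lap f) = lap (pd i f).
Proof.
move=> sf; rewrite /lap partial_sum; last by move=> j; do 2 apply: smooth_partial.
apply/funext => x; apply: eq_bigr => j _.
by rewrite (partialC i j (smooth_partial j sf)) (partialC i j sf).
Qed.

Lemma partial_lapn k i f : smth f -> pd i (iter k lap f) = iter k lap (pd i f).
Proof.
move=> sf; elim: k => //= k IH; rewrite partial_lap; last exact: smooth_lapn.
by rewrite IH.
Qed.

(** The commutator of Delta and the Euler field is 2 Delta, since Delta lowers homogeneity by
    two. *)
Lemma lap_euler f : smth f -> lap (euler f) = fun x => euler (lap f) x + 2 * lap f x.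
Proof.
move=> sf; have sp := smooth_partial.
have E2 j g : smth g -> pd j (euler g) = fun x => pd j g x + euler (pd j g) x.
  move=> sg; rewrite /euler partial_sum; last by move=> i; apply: (smoothM (smooth_coord i)); exact: sp.
  apply/funext => x.
  under eq_bigr => i _ do rewrite (partialMs j (smooth_coord i) (sp _ _ sg)) partial_coord.
  rewrite big_split /=; congr (_ + _).
    by rewrite (bigD1 j)//= big1 ?addr0 ?eqxx ?mul1r// => i /negbTE; rewrite eq_sym => ->; rewrite mul0r.
  by apply: eq_bigr => i _; rewrite (partialC j i sg).
apply/funext => x; rewrite /lap.
under eq_bigr => j _.
  rewrite E2// partialDs; [|exact: sp|exact/smooth_euler/sp].
  rewrite E2; last exact: sp.
  rewrite addrA; over.
rewrite big_split /= addrC; congr (_ + _); last by rewrite big_split /=; ring.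
rewrite /euler exchange_big /=; apply: eq_bigr => i _.
rewrite -mulr_sumr; congr (_ * _); rewrite partial_sum//.
by move=> j; do 2 apply: smooth_partial.
Qed.

Lemma lap_rhoM f : smth f ->
  lap (fun x => rho x * f x) =
  fun x => rho x * lap f x - 4 * euler f x - 2 * d%:R * f x.
Proof.
move=> sf; apply/funext => x; rewrite /lap.
have sr := smooth_rho; have sp := smooth_partial.
have sx i : smth (fun x : V => - 2 * x 0 i) by apply/smoothZ/smooth_coord.
transitivity (\sum_(i < d) (rho x * pd i (pd i f) x - 4 * (x 0 i * pd i f x) - 2 * f x)).
  apply: eq_bigr => i _.
  rewrite (partialMs i sr sf) partial_rho partialDs; [|by apply: smoothM|by apply: smoothM => //; exact: sp].
  rewrite (partialMs i (sx i) sf) (partialMs i sr (sp _ i sf)) partial_rho.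
  rewrite (partialZ _ i (smooth_coord i)) partial_coord eqxx /coord /=.
  by ring.
rewrite !big_split /= -mulr_sumr sumrN -mulr_sumr; congr (_ + _ + _).
by rewrite sumrN sumr_const card_ord -mulr_natr; ring.
Qed.

(** Source of the second-order factors: apart from the outer rho, derivatives of f enter only
    through Delta^k f. The induction combines [lap_rhoM] with the commutator [lap_euler]. *)
Lemma lapn_rhoM k f : smth f ->
  iter k.+1 lap (fun x => rho x * f x) =
  fun x => rho x * iter k.+1 lap f x -
    (4 * k.+1%:R * euler (iter k lap f) x +
     2 * k.+1%:R * (2 * k%:R + d%:R) * iter k lap f x).
Proof.
move=> sf; elim: k => [|k IH].
  by rewrite /= lap_rhoM//; apply/funext => x; ring.
rewrite iterS IH.
have sg := smooth_lapn k sf; have sg1 := smooth_lapn k.+1 sf.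
rewrite lapD; [|apply: smoothM => //; exact: smooth_rho|]; last first.
  by apply: smoothN; apply: smoothD; apply: smoothZ => //; exact: smooth_euler.
rewrite lap_rhoM// (_ : (fun x => - _) = (fun x => -1 * (4 * k.+1%:R * euler (iter k lap f) x +
   2 * k.+1%:R * (2 * k%:R + d%:R) * iter k lap f x))); last first.
  by apply/funext => x; rewrite mulN1r.
rewrite lapZ; last by apply: smoothD; apply: smoothZ => //; exact: smooth_euler.
rewrite lapD; [|by apply: smoothZ; exact: smooth_euler|exact: smoothZ].
rewrite !lapZ//; last exact: smooth_euler.
rewrite lap_euler//; apply/funext => x /=; rewrite -!natr1; ring.
Qed.

(** Differentiating [F n \o r] leads to [F n.+1 \o r], so smoothness of every level follows by one
    induction on the order, uniformly in n. *)
Lemma smooth_tower (F : nat -> R -> R) (r : V -> R) : smth r ->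
  (forall n (t : R), is_derive t (1 : R) (F n) (F n.+1 t)) ->
  forall n, (forall i, pd i (F n \o r) = fun x => F n.+1 (r x) * pd i r x) /\
            smth (F n \o r).
Proof.
move=> sr dF.
have D n i x : is_derive x (e_ i) (F n \o r) (F n.+1 (r x) * pd i r x).
  have H1 := @is_derive_line_pd r i x 0 sr.
  rewrite scale0r add0r in H1.
  have dF' : is_derive ((fun s : R => r (s *: e_ i + x)) 0) (1 : R) (F n) (F n.+1 (r x)).
    by rewrite /= scale0r add0r; exact: dF.
  have [H2 H3] := @is_derive1_comp _ _ _ _ _ _ dF' H1.
  have DV : derivable (F n \o r) x (e_ i) by apply/derivable1P; exact: H2.
  split => //; rewrite -H3.
  have [_ ->] : is_derive (0:R) (1 : R) (fun s => (F n \o r) (s *: e_ i + x)) ('D_(e_ i) (F n \o r) x).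
    have := @is_derive_line (F n \o r) (e_ i) x 0.
    by rewrite scale0r add0r; apply.
  by [].
have P n i : pd i (F n \o r) = fun x => F n.+1 (r x) * pd i r x.
  by apply/funext => x; apply: partialE; exact: D.
move=> n; split; first exact: P.
apply/smoothP => k; elim: k n => [|k IH] n.
  move=> x; apply: continuous_comp; first exact: smooth_continuous.
  by apply/differentiable_continuous/derivable1_diffP; have [] := dF n (r x).
split.
  move=> x; apply: continuous_comp; first exact: smooth_continuous.
  by apply/differentiable_continuous/derivable1_diffP; have [] := dF n (r x).
move=> i; split; first by move=> x; have [] := D n i x.
rewrite P; apply: CkM; first exact: IH.
by have /smoothP := smooth_partial i sr; apply.
Qed.

End calculus.

(** * Borel sets and iterated integrals on row vectors *)

Section borel.
Context {R : realType}.

Lemma measurable_ball_rV n (c : 'rV[R]_n) (r : R) : measurable (ball c r : set 'rV[R]_n).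
Proof.
have [r0|r0] := ltP 0 r; last first.
  rewrite (_ : ball c r = set0); first exact: measurable0.
  by apply/seteqP; split => // x [] /lt_geF; rewrite r0.
rewrite (_ : ball c r =
    \bigcap_(i in [set: 'I_n]) ((fun x : 'rV[R]_n => x 0 i : R) @^-1` ball (c 0 i) r)).
  apply: fin_bigcap_measurable => [|i _]; first exact: finite_finset.
  rewrite -[X in measurable X]setTI; apply: (measurable_coord i) => //.
  by apply: open_measurable; exact: ball_open.
apply/seteqP; split => [x [_ H] i _ /=|x H]; first exact: H.
by split => // i j; rewrite ord1; exact: H.
Qed.

(** An open set is the union of the rational cubes it contains, and sup-norm balls are measurable as
    boxes; this links the topology with the coordinate sigma-algebra. *)
Lemma open_measurable_rV n (A : set 'rV[R]_n) : open A -> measurable A.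
Proof.
move=> oA.
pose F (p : 'rV[rat]_n * rat) : set 'rV[R]_n :=
  let D := ball (map_mx ratr p.1 : 'rV[R]_n) (ratr p.2 : R) in
  if `[< D `<=` A >] then D else set0.
suff -> : A = \bigcup_p F p.
  apply: countable_bigcupT_measurable; first exact: countableP.
  by move=> p; rewrite /F; case: ifP => _; [exact: measurable_ball_rV|exact: measurable0].
apply/seteqP; split => [x Ax|x [p _]]; last first.
  by rewrite /F; case: asboolP => // H; exact: H.
have /nbhs_ballP[e e0 He] : nbhs x A by exact: open_nbhs_nbhs.
(* A cube of radius q < e/2 whose centre is within q of x contains x and lies in the ball of radius
   e. *)
have /rat_in_itvoo[q] : (0 : R) < e / 2 by rewrite divr_gt0.
rewrite in_itv /= => /andP[q0 qe].
have /choice[c Hc] : forall i : 'I_n, exists a : rat, `|x 0 i - ratr a| < ratr q.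
  move=> i; have /rat_in_itvoo[a] : x 0 i - ratr q < x 0 i + ratr q.
    by rewrite ltrBlDr -addrA ltrDl addr_gt0.
  by rewrite in_itv /= => ha; exists a; rewrite distrC ltr_distl.
exists (\row_i c i, q) => //; rewrite /F.
have xD : ball (map_mx ratr (\row_i c i) : 'rV[R]_n) (ratr q : R) x.
  by split => // i j; rewrite ord1 !mxE -ball_normE /= distrC; exact: Hc.
case: asboolP => // H; exfalso; apply: H => /= y [_ Dy]; apply: He; split => // i j.
rewrite ord1 -ball_normE /=; have := Dy 0 j; rewrite !mxE -ball_normE /= => h1.
have h2 := Hc j.
have -> : x 0 j - y 0 j = (x 0 j - ratr (c j)) + (ratr (c j) - y 0 j) by rewrite addrA subrK.
by apply: le_lt_trans (ler_normD _ _) _; move: h1 h2 qe; lra.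
Qed.

Lemma continuous_measurable_rV n (f : 'rV[R]_n -> R) : continuous f ->
  measurable_fun setT f.
Proof.
move=> /continuousP cf; apply: (measurability _ (RGenOpens.measurableE R)).
move=> _ [_ [a [b ->] <-]]; rewrite setTI; apply: open_measurable_rV.
exact/cf/interval_open.
Qed.

End borel.

(** * Slices of functions and Fubini on row vectors *)

Section slices.
Context {R : realType} {n : nat}.
Implicit Types (F : 'rV[R]_n.+1 -> R) (t : R).
Local Notation mu1 := (@lebesgue_measure R).
Local Notation mun := (@lebesgue_rV R n).

Definition slice F t : 'rV[R]_n -> R := fun x => F (rV_cons (t, x)).

Lemma add_scale_delta m (h : R) (j : 'I_m) (x : 'rV[R]_m) i :
  (h *: delta_mx 0 j + x) 0 i = h * (i == j)%:R + x 0 i.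
Proof. by rewrite !mxE. Qed.

Lemma rV_cons_line0 (h t : R) (x : 'rV[R]_n) :
  rV_cons (h + t, x) = h *: delta_mx 0 0 + rV_cons (t, x).
Proof.
apply/rowP => i; rewrite add_scale_delta; have [j ->|->] := unliftP 0 i.
  by rewrite !rV_consS /= mulr0 add0r.
by rewrite !rV_cons0 /= mulr1.
Qed.

Lemma rV_cons_lineS (h t : R) (x : 'rV[R]_n) j :
  rV_cons (t, h *: delta_mx 0 j + x) = h *: delta_mx 0 (lift 0 j) + rV_cons (t, x).
Proof.
apply/rowP => i; rewrite add_scale_delta; have [k ->|->] := unliftP 0 i.
  by rewrite !rV_consS add_scale_delta (inj_eq lift_inj).
by rewrite !rV_cons0 /= mulr0 add0r.
Qed.

Lemma continuous_rV_cons t : continuous (fun x : 'rV[R]_n => rV_cons (t, x)).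
Proof.
move=> x A /nbhs_ballP[e e0 He]; apply/nbhs_ballP; exists e => // y [_ Hy].
apply: He; split => // i j; rewrite ord1; have [k ->|->] := unliftP 0 j.
  by rewrite !rV_consS; exact: Hy.
by rewrite !rV_cons0; exact: ballxx.
Qed.

Lemma is_derive_slice F t x j : derivable F (rV_cons (t, x)) (delta_mx 0 (lift 0 j)) ->
  is_derive x (delta_mx 0 j) (slice F t) (pd (lift 0 j) F (rV_cons (t, x))).
Proof.
have E : (fun h : R => h^-1 *: ((slice F t \o shift x) (h *: delta_mx 0 j) - slice F t x)) =
   (fun h => h^-1 *: ((F \o shift (rV_cons (t, x))) (h *: delta_mx 0 (lift 0 j)) - F (rV_cons (t, x)))).
  by apply/funext => h; rewrite /slice /= rV_cons_lineS.
by move=> dF; rewrite pd.unlock; split; rewrite /derivable /partial /derive E.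
Qed.

Lemma partial_slice F t j : smth F -> pd j (slice F t) = slice (pd (lift 0 j) F) t.
Proof.
move=> sF; apply/funext => x.
exact/partialE/is_derive_slice/smooth_derivable.
Qed.

Lemma smooth_slice F t : smth F -> smth (slice F t).
Proof.
move=> sF; apply/smoothP => k; elim: k F sF => [|k IH] F sF.
  by move=> x; apply: continuous_comp; [exact: continuous_rV_cons|exact: smooth_continuous].
split.
  by move=> x; apply: continuous_comp; [exact: continuous_rV_cons|exact: smooth_continuous].
move=> i; split; last by rewrite partial_slice//; exact/IH/smooth_partial.
move=> x.
by have [] := is_derive_slice (@smooth_derivable _ _ F (lift 0 i) (rV_cons (t, x)) sF).
Qed.

Lemma partials_slice F t s : smth F ->
  pds s (slice F t) = slice (pds (map (lift 0) s) F) t.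
Proof.
move=> sF; elim: s => [//|j s /= ->]; apply: partial_slice.
exact: smooth_partials.
Qed.

Lemma is_derive_cons0 F x t : smth F ->
  is_derive t (1 : R) (fun s => F (rV_cons (s, x))) (pd 0 F (rV_cons (t, x))).
Proof.
move=> sF; have := @is_derive_line_pd R _ F 0 (rV_cons (0, x)) t sF.
rewrite -rV_cons_line0 addr0.
by under eq_fun do rewrite -rV_cons_line0 addr0.
Qed.

Local Open Scope ereal_scope.

Lemma integral_rV_cons (f : 'rV[R]_n.+1 -> \bar R) : measurable_fun setT f ->
  (lebesgue_rV n.+1).-integrable setT f ->
  ((mu1 \x mun)%E).-integrable setT (f \o @rV_cons R n) /\
  \int[lebesgue_rV n.+1]_x f x = \int[(mu1 \x mun)%E]_p f (rV_cons p).
Proof.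
move=> mf If; have mc := @measurable_rV_cons R n.
have I2 : ((mu1 \x mun)%E).-integrable setT (f \o @rV_cons R n).
  apply/integrableP; split; first exact: measurableT_comp.
  move/integrableP : If => [_]; apply: le_lt_trans.
  rewrite [leRHS](@ge0_integral_pushforward _ _ _ _ _ _ mc (mu1 \x mun)%E setT (fun x => `|f x|))//.
  exact: measurableT_comp.
by split => //; rewrite [LHS](@integral_pushforward _ _ _ _ _ _ mc (mu1 \x mun)%E setT f).
Qed.

Lemma integral_rV_cons12 (f : 'rV[R]_n.+1 -> \bar R) : measurable_fun setT f ->
  (lebesgue_rV n.+1).-integrable setT f ->
  \int[lebesgue_rV n.+1]_x f x = \int[mu1]_t \int[mun]_x f (rV_cons (t, x)).
Proof.
move=> mf If; have [I2 ->] := integral_rV_cons mf If.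
by rewrite -(integral12_prod_meas1 I2).
Qed.

Lemma integral_rV_cons21 (f : 'rV[R]_n.+1 -> \bar R) : measurable_fun setT f ->
  (lebesgue_rV n.+1).-integrable setT f ->
  \int[lebesgue_rV n.+1]_x f x = \int[mun]_x \int[mu1]_t f (rV_cons (t, x)).
Proof.
move=> mf If; have [I2 ->] := integral_rV_cons mf If.
by rewrite -(integral21_prod_meas1 I2).
Qed.

Lemma ge0_integral_rV_cons21 (f : 'rV[R]_n.+1 -> \bar R) : measurable_fun setT f ->
  (forall x, 0 <= f x) ->
  \int[lebesgue_rV n.+1]_x f x = \int[mun]_x \int[mu1]_t f (rV_cons (t, x)).
Proof.
move=> mf f0; have mc := @measurable_rV_cons R n.
rewrite [LHS](@ge0_integral_pushforward _ _ _ _ _ _ mc (mu1 \x mun)%E setT f)//.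
rewrite preimage_setT (@fubini_tonelli2 _ _ _ _ _ mu1 mun (f \o @rV_cons R n))//.
  exact: measurableT_comp.
by move=> p; exact: f0.
Qed.

End slices.

(** * Supports in the cube: integration of derivatives and a Sobolev inequality *)

Section box.
Context {R : realType}.
Local Notation mu1 := (@lebesgue_measure R).

(** Slicing a product set leaves a product set, so inductions on the dimension run with supports in
    this cube, which contains the ball. *)
Definition cube n : set 'rV[R]_n := [set x | forall i, `|x 0 i| <= 1].

Definition cube_supp n (f : 'rV[R]_n -> R) := forall x, f x != 0 -> cube x.

Lemma cubeE n : cube (n := n) =
  [set x | forall i, ((fun _ : 'I_n => `[-1, 1]%classic) i) (x 0 i)].
Proof. by apply/seteqP; split => x /= H i; have := H i; rewrite /= in_itv /= ler_norml. Qed.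

Lemma cube_lty n : (@lebesgue_rV R n (@cube n) < +oo)%E.
Proof.
have H := @lebesgue_rV_box R n (fun=> `[-1, 1]%classic) (fun=> measurable_itv _).
rewrite cubeE; apply: le_lt_trans (_ : _ <= _)%E _; first by rewrite le_eqVlt; apply/orP; left; apply/eqP; exact: H.
rewrite (eq_bigr (fun=> 2%:E)) => [|i _].
  by rewrite prodEFin ltry.
rewrite lebesgue_measure_itv /= lte_fin ifT; last by lra.
by rewrite -EFinB opprK.
Qed.

Lemma compact_cube n : compact (@cube n).
Proof.
have H := @rV_compact R n (fun=> `[-1, 1]%classic) (fun=> @segment_compact R (-1) 1).
by rewrite cubeE; exact: H.
Qed.

Lemma measurable_cube n : measurable (@cube n).
Proof.
rewrite -[X in measurable X]setCK; apply: measurableC; apply: open_measurable_rV.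
by apply: closed_openC; apply: compact_closed; [exact: norm_hausdorff|exact: compact_cube].
Qed.

Lemma cube_bounded n (f : 'rV[R]_n -> R) : continuous f -> exists M, forall x, cube x -> `|f x| <= M.
Proof.
move=> cf.
have : compact (f @` (@cube n)).
  by apply: continuous_compact; [exact: continuous_subspaceT|exact: compact_cube].
move=> /compact_bounded[M [_ HM]]; exists (M + 1) => x cx.
by apply: (HM (M + 1)); [rewrite ltrDl|exists x].
Qed.

Lemma cube_supp_integrable n (f : 'rV[R]_n -> R) : continuous f -> cube_supp f ->
  (lebesgue_rV n).-integrable setT (EFin \o f).
Proof.
move=> cf sf; have [M HM] := cube_bounded cf.
have E : EFin \o f = (EFin \o f) \_ (@cube n).
  apply/funext => x; rewrite /patch; case: ifPn => // /negP h /=.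
  by have [->//|/sf h'] := eqVneq (f x) 0; exfalso; apply: h; rewrite inE.
rewrite E -integrable_mkcond; last exact: measurable_cube.
have mf := measurable_funTS (continuous_measurable_rV cf).
have H := @bounded_integrable _ _ R (lebesgue_rV n) _ (measurable_cube (n := n)) (cube_lty n) f M (mf _) HM.
exact: H.
Qed.

Lemma cube_supp_pd n (f : 'rV[R]_n -> R) i : smth f -> cube_supp f -> cube_supp (pd i f).
Proof.
move=> sf cf x nz; apply: contrapT => ncx.
have oC : open (~` @cube n).
  by apply: closed_openC; apply: compact_closed; [exact: norm_hausdorff|exact: compact_cube].
have fz : {near nbhs x, cst 0 =1 f}.
  have : nbhs x (~` @cube n) by apply: open_nbhs_nbhs; split.
  apply: filterS => y ncy /=; apply/eqP; rewrite eq_sym.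
  by have [//|/cf] := eqVneq (f y) 0.
have := near_eq_is_derive fz (is_derive_cst 0 x (delta_mx 0 i)).
by move=> H; move: nz; rewrite (partialE H) eqxx.
Qed.

Lemma cube_supp_pds n (f : 'rV[R]_n -> R) s : smth f -> cube_supp f -> cube_supp (pds s f).
Proof.
move=> sf cf; elim: s => //= i s IH; apply: cube_supp_pd => //.
exact: smooth_partials.
Qed.

Lemma rV_cons_cube n (t : R) (x : 'rV[R]_n) : cube (rV_cons (t, x)) -> `|t| <= 1 /\ cube x.
Proof.
move=> H; split; first by have := H 0; rewrite rV_cons0.
by move=> i; have := H (lift 0 i); rewrite rV_consS.
Qed.

Lemma FTC_line (g dg : R -> R) (a b : R) : a < b ->
  (forall t : R, is_derive t (1 : R) g (dg t)) -> continuous dg ->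
  (\int[mu1]_(t in `[a, b]) (dg t)%:E = (g b)%:E - (g a)%:E)%E.
Proof.
move=> ab dgg cdg.
have cg : continuous g.
  by move=> t; apply/differentiable_continuous/derivable1_diffP; have [] := dgg t.
apply: continuous_FTC2 => //.
- exact: continuous_subspaceT.
- split.
  + by move=> x _; have [] := dgg x.
  + exact: cvg_at_right_filter (cg a).
  + exact: cvg_at_left_filter (cg b).
- by move=> x _; rewrite derive1E; have [_ ->] := dgg x.
Qed.

Lemma integral_derive_line (g dg : R -> R) :
  (forall t : R, is_derive t (1 : R) g (dg t)) -> continuous dg ->
  (forall t, 1 < `|t| -> g t = 0) -> (forall t, 1 < `|t| -> dg t = 0) ->
  (\int[mu1]_t (dg t)%:E = 0)%E.
Proof.
move=> dgg cdg g0 dg0.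
(* The hypotheses give vanishing only where 1 < |t|, so the endpoints are taken beyond the unit
   interval. *)
have := @FTC_line g dg (-2) 2 _ dgg cdg.
rewrite !g0 ?normrN ?ger0_norm ?ltr1n// subee// => <-; last by lra.
rewrite [RHS]integral_mkcond; apply: eq_integral => t _.
rewrite patchE; case: ifPn => //; rewrite notin_setE /= in_itv /= => h.
rewrite dg0// ltNge; apply/negP => h1; apply: h; move: h1; rewrite ler_norml; lra.
Qed.

(** Since g(y) is the integral of its derivative from -2 to y, Cauchy-Schwarz gives the factor y +
    2, at most 3 when |y| <= 1 and rounded up to 4. *)
Lemma sqr_le_line (g dg : R -> R) y :
  (forall t : R, is_derive t (1 : R) g (dg t)) -> continuous dg ->
  (forall t, 1 < `|t| -> g t = 0) ->
  ((g y ^+ 2)%:E <= 4%:E * \int[mu1]_t (dg t ^+ 2)%:E)%E.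
Proof.
move=> dgg cdg g0.
have I0 (D : set R) : (0 <= \int[mu1]_(t in D) (dg t ^+ 2)%:E)%E.
  by apply: integral_ge0 => t _; rewrite lee_fin sqr_ge0.
have [y1|y1] := ltP 1 `|y|.
  by rewrite g0// expr0n mule_ge0.
move: y1; rewrite ler_norml => /andP[y1 y2].
have y3 : -2 < y by lra.
have F := FTC_line y3 dgg cdg.
have gm2 : g (-2) = 0 by rewrite g0// normrN ger0_norm ?ltr1n.
rewrite gm2 sube0 in F.
pose D := `[(-2 : R), y]%classic.
have mD : measurable D by exact: measurable_itv.
have muDE : mu1 D = (y + 2)%:E.
  by rewrite /D lebesgue_measure_itv /= lte_fin y3 -EFinB opprK.
have muD : (mu1 D < +oo)%E by rewrite muDE ltry.
have mdg : measurable_fun D dg.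
  exact: measurable_funTS (continuous_measurable_fun cdg).
have [M HM] : exists M, forall x, D x -> `|dg x| <= M.
  have : compact (dg @` D).
    by apply: continuous_compact; [exact: continuous_subspaceT|exact: segment_compact].
  move=> /compact_bounded[M [_ HM]]; exists (M + 1) => x cx.
  by apply: (HM (M + 1)); [rewrite ltrDl|exists x].
have sdg := @bounded_sqint _ (measurableTypeR R) R mu1 D mD muD dg M mdg HM.
have s1 : sqint mu1 D (cst 1).
  by apply: (@bounded_sqint _ (measurableTypeR R) R mu1 D mD muD (cst 1) 1) => [|x _]; [exact: measurable_cst|rewrite normr1].
have := @ip_cauchy_schwarz _ (measurableTypeR R) R mu1 D mD dg (cst 1) sdg s1.
have -> : ip mu1 D dg (cst 1) = g y.
  by rewrite /ip /Rintegral; under eq_integral do rewrite mulr1; rewrite F.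
have -> : nsq mu1 D (cst 1) = y + 2.
  rewrite /nsq; under eq_Rintegral do rewrite expr1n.
  by rewrite Rintegral_cst// mul1r -[LHS]/(fine (mu1 D)) muDE.
move=> H.
apply: (@le_trans _ _ (4%:E * \int[mu1]_(t in D) (dg t ^+ 2)%:E)%E); last first.
  rewrite lee_pmul2l//; apply: ge0_subset_integral => //.
    apply/measurable_EFinP/measurable_funX; exact: continuous_measurable_fun.
  by move=> t _; rewrite lee_fin sqr_ge0.
rewrite (@nsqE _ (measurableTypeR R) R mu1 D mD dg sdg) -EFinM lee_fin (le_trans H)// mulrC ler_wpM2r ?nsq_ge0//.
lra.
Qed.

(** Fubini is used in the order adapted to i: along direction 0 the inner integral is
    one-dimensional, in any other direction it falls under the induction hypothesis for slices. *)
Lemma integral_pd n (f : 'rV[R]_n -> R) i : smth f -> cube_supp f ->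
  (\int[lebesgue_rV n]_x (pd i f x)%:E = 0)%E.
Proof.
elim: n f i => [|n IH] f i sf cf; first by case: i.
have sp := smooth_partial i sf; have cp := @cube_supp_pd _ f i sf cf.
have mp : measurable_fun setT (EFin \o pd i f).
  by apply/measurable_EFinP; apply: continuous_measurable_rV; exact: smooth_continuous sp.
have Ip := cube_supp_integrable (smooth_continuous sp) cp.
have [j ij|i0] := unliftP 0 i.
- rewrite (integral_rV_cons12 mp Ip) /=.
  rewrite (eq_integral (cst 0%E)) ?integral0// => t _ /=.
  have := IH (slice f t) j (smooth_slice t sf); rewrite partial_slice// -ij; apply.
  by move=> x /cf /rV_cons_cube[].
- subst i; rewrite (integral_rV_cons21 mp Ip) /=.
  rewrite (eq_integral (cst 0%E)) ?integral0// => x _ /=.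
  have zero (h : 'rV[R]_n.+1 -> R) : cube_supp h -> forall t, 1 < `|t| -> h (rV_cons (t, x)) = 0.
    move=> ch t t1; have [//|/ch/rV_cons_cube[]] := eqVneq (h (rV_cons (t, x))) 0.
    by rewrite leNgt t1.
  apply: (@integral_derive_line (fun t => f (rV_cons (t, x)))).
  + by move=> t; exact: is_derive_cons0.
  + move=> t; apply/differentiable_continuous/derivable1_diffP.
    by have [] := is_derive_cons0 x t sp.
  + exact: zero.
  + exact: zero.
Qed.

Fixpoint all_dirs n : seq 'I_n :=
  match n with 0 => [::] | n'.+1 => ord0 :: map (lift ord0) (all_dirs n') end.

Lemma size_all_dirs n : size (all_dirs n) = n.
Proof. by elim: n => //= n IH; rewrite size_map IH. Qed.

(** The line estimate is applied once per variable, each time costing a factor 4 and one derivative.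
    A supremum is thus controlled by an L2 norm at the price of n derivatives. *)
Lemma sqr_le_all_dirs n (f : 'rV[R]_n -> R) y : smth f -> cube_supp f ->
  ((f y ^+ 2)%:E <= (4 ^+ n)%:E * \int[lebesgue_rV n]_x (pds (all_dirs n) f x ^+ 2)%:E)%E.
Proof.
elim: n f y => [|n IH] f y sf cf.
  rewrite expr0 mul1e /= (_ : y = 0); last by apply/rowP; case.
  rewrite integral_dirac//; first by rewrite diracE mem_set// mul1e.
  apply/measurable_EFinP; apply: measurable_funX; apply: continuous_measurable_rV.
  exact: smooth_continuous sf.
rewrite -(rV_unconsK y) /rV_uncons; set t0 := y 0 0; set y' := \row_j _.
have cs : cube_supp (slice f t0) by move=> x /cf/rV_cons_cube[].
apply: le_trans (IH (slice f t0) y' (smooth_slice t0 sf) cs) _.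
pose G := pds (map (lift ord0) (all_dirs n)) f.
rewrite -[pds (all_dirs n.+1) f]/(pd ord0 G).
have sG : smth G by exact: smooth_partials.
have cG : cube_supp G by exact: cube_supp_pds.
have sdG := smooth_partial 0 sG.
have md : measurable_fun setT (fun x => (pd 0 G x ^+ 2)%:E).
  apply/measurable_EFinP; apply: measurable_funX; apply: continuous_measurable_rV.
  exact: smooth_continuous sdG.
rewrite ge0_integral_rV_cons21//; last by move=> x; rewrite lee_fin sqr_ge0.
have mI : measurable_fun setT (fun x => \int[mu1]_t (pd 0 G (rV_cons (t, x)) ^+ 2)%:E)%E.
  apply: (@measurable_fun_fubini_tonelli_G _ _ _ _ _ mu1
     ((fun x => (pd 0 G x ^+ 2)%:E) \o @rV_cons R n)).
    exact: (measurableT_comp md (@measurable_rV_cons R n)).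
  by move=> p; rewrite lee_fin sqr_ge0.
rewrite exprSr EFinM -muleA lee_pmul2l ?lte_fin ?exprn_gt0//.
rewrite -ge0_integralZl//; last first.
  by move=> x _; apply: integral_ge0 => t _; rewrite lee_fin sqr_ge0.
apply: ge0_le_integral => //.
- by move=> x _; rewrite lee_fin sqr_ge0.
- apply/measurable_EFinP; apply: measurable_funX; apply: continuous_measurable_rV.
  by apply: smooth_continuous; apply: smooth_partials; exact: smooth_slice.
- exact: emeasurable_funM.
move=> x _; rewrite partials_slice// -/G /slice.
apply: (@sqr_le_line (fun t => G (rV_cons (t, x)))).
- by move=> t; exact: is_derive_cons0.
- move=> t; apply/differentiable_continuous/derivable1_diffP.
  by have [] := is_derive_cons0 x t sdG.
- move=> t t1; have [//|/cG/rV_cons_cube[]] := eqVneq (G (rV_cons (t, x))) 0.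
  by rewrite leNgt t1.
Qed.

End box.

(** * Flat truncations of t^m *)

Section towers.
Context {R : realType}.
Implicit Types (s t eps : R).

(** For n > 0, exp s = (exp (s/n))^n is at least (s/n)^n. *)
Lemma exprn_expRN_le n s : 0 <= s -> s ^+ n * expR (- s) <= n%:R ^+ n.
Proof.
move=> s0; rewrite expRN -ler_pdivlMr ?invr_gt0 ?expR_gt0// invrK.
case: n => [|n]; first by rewrite !expr0 mul1r; rewrite -expR0 ler_expR.
have -> : expR s = expR (s / n.+1%:R) ^+ n.+1.
  by rewrite -expRM_natl; congr expR; rewrite mulrC divfK// pnatr_eq0.
rewrite -exprMn; apply: lerXn2r; rewrite ?nnegrE ?mulr_ge0 ?expR_ge0//.
have := expR_ge1Dx (s / n.+1%:R) => h.
rewrite -ler_pdivrMl ?ltr0n//; apply: le_trans h; by rewrite [leLHS]mulrC lerDr ler01.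
Qed.

Lemma poly_expRN_bounded (P : {poly R}) : exists C, forall s, 0 <= s -> `|P.[s]| * expR (- s) <= C.
Proof.
exists (\sum_(i < size P) `|P`_i| * i%:R ^+ i) => s s0.
rewrite horner_coef; apply: le_trans (ler_wpM2r (expR_ge0 _) (ler_norm_sum _ _ _)) _.
rewrite mulr_suml; apply: ler_sum => i _.
rewrite normrM normrX (ger0_norm s0) -mulrA ler_wpM2l//.
exact: exprn_expRN_le.
Qed.

Lemma is_derive_ext (f g : R -> R) t (a b : R) : is_derive t (1 : R) f a ->
  f =1 g -> a = b -> is_derive t (1 : R) g b.
Proof. by move=> h /funext <- <-. Qed.

Lemma is_derive_exprn (f : R -> R) n t (df : R) : is_derive t (1 : R) f df ->
  is_derive t (1 : R) (fun t => f t ^+ n) (n%:R * f t ^+ n.-1 * df).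
Proof.
by move=> h; apply: (is_derive_ext (is_deriveX n h)) => // x; rewrite exprfctE.
Qed.

Variable m : nat.

(* Differentiating t^m exp(-1/t) j times gives t^(m-j) R_j(1/t) exp(-1/t). *)
Fixpoint flat_poly j : {poly R} := match j with
  | 0 => 1
  | j'.+1 => (m%:R - j'%:R) *: flat_poly j' - 'X * (flat_poly j')^`() + 'X * flat_poly j'
  end.

(** The exponential in s = eps / (t - eps) makes the function flat at t = eps. Since s is
    scale-invariant, polynomials in s times exp (-s) have bounds that do not depend on eps. *)
Definition flat_tower eps j t : R :=
  if eps < t then (t - eps) ^+ m * (t - eps)^-1 ^+ j *
     ((flat_poly j).[eps / (t - eps)] * expR (- (eps / (t - eps)))) else 0.

(** The limit of [flat_tower] as eps tends to 0. For j > m the falling factorial vanishes, so the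
    tower of derivatives continues correctly despite the truncated exponent. *)
Definition pow_tower j t : R := (m ^_ j)%:R * t ^+ (m - j).

(** For fixed t > 0 the argument eps / (t - eps) tends to 0, so this value is the coefficient that
    survives in the limit. *)
Lemma flat_poly0 j : (flat_poly j).[0] = (m ^_ j)%:R.
Proof.
elim: j => [|j IH] /=; first by rewrite hornerC.
rewrite !hornerE subr0 IH ffactnSr.
have [jm|mj] := leqP j m; first by rewrite natrM natrB// mulrC.
by rewrite ffact_small// mul0n mulr0.
Qed.

Lemma is_derive_pow_tower j t : is_derive t (1 : R) (pow_tower j) (pow_tower j.+1 t).
Proof.
rewrite /pow_tower.
have H : is_derive t (1 : R) (fun t : R => t ^+ (m - j)) ((m - j)%:R * t ^+ (m - j).-1).
  by have := is_derive_exprn (m - j) (is_derive_id t 1); rewrite mulr1.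
apply: (is_derive_ext (@is_deriveM _ _ (cst (m ^_ j)%:R) _ t 1 0 _ (is_derive_cst _ _ _) H)) => //.
rewrite /GRing.scale /= mulr0 addr0 mulrA -natrM -ffactnSr subnS.
by [].
Qed.

Lemma is_derive_flat_tower_gt eps j t : 0 < eps -> eps < t ->
  is_derive t (1 : R) (flat_tower eps j) (flat_tower eps j.+1 t).
Proof.
move=> e0 et; have u0 : t - eps != 0 by rewrite subr_eq0 gt_eqF.
pose P := flat_poly j.
pose g (t : R) := (t - eps) ^+ m * (t - eps)^-1 ^+ j *
     (P.[eps / (t - eps)] * expR (- (eps / (t - eps)))).
have du : is_derive t (1 : R) (fun t => t - eps) 1.
  apply: (is_derive_ext (is_deriveB (is_derive_id t 1) (is_derive_cst eps t 1))) => //.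
  by rewrite subr0.
pose v := (t - eps)^-1.
have dv : is_derive t (1 : R) (fun t => (t - eps)^-1) (- v ^+ 2).
  have [du1 du2] := du.
  have D1 := @derivableV _ _ (fun t : R => t - eps) t 1 u0 du1.
  have D2 := @deriveV _ _ (fun t : R => t - eps) t 1 u0 du1.
  apply: (DeriveDef D1); rewrite D2 du2 /GRing.scale /= mulr1.
  by rewrite /v exprVn.
have dum : is_derive t (1 : R) (fun t => (t - eps) ^+ m) (m%:R * (t - eps) ^+ m.-1).
  by have := is_derive_exprn m du; rewrite mulr1.
have dvj : is_derive t (1 : R) (fun t => (t - eps)^-1 ^+ j) (j%:R * v ^+ j.-1 * - v ^+ 2).
  exact: (is_derive_exprn j dv).
have ds : is_derive t (1 : R) (fun t => eps / (t - eps)) (- (eps * v ^+ 2)).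
  apply: (is_derive_ext (@is_deriveM _ _ (cst eps) _ t 1 0 _ (is_derive_cst _ _ _) dv)) => //.
  by rewrite /GRing.scale /= mulr0 addr0 mulrN.
have dP : is_derive t (1 : R) (fun t => P.[eps / (t - eps)]) (P^`().[eps * v] * - (eps * v ^+ 2)).
  have dh : is_derive (eps / (t - eps)) (1 : R) (horner P) (P^`().[eps * v]).
    have <- : 'D_1 (horner P) (eps / (t - eps)) = P^`().[eps * v].
      by rewrite -derive1E -derivE.
    by apply: derivableP; exact: derivable_horner.
  have H := @is_derive1_comp _ (horner P) (fun t => eps / (t - eps)) t _ _ dh ds.
  by apply: (is_derive_ext H).
have dE : is_derive t (1 : R) (fun t => expR (- (eps / (t - eps)))) (expR (- (eps * v)) * (eps * v ^+ 2)).
  have dn : is_derive t (1 : R) (fun t => - (eps / (t - eps))) (eps * v ^+ 2).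
    by have := is_deriveN ds; rewrite opprK.
  have H := @is_derive1_comp _ expR (fun t => - (eps / (t - eps))) t _ _ (is_derive_expR _) dn.
  by apply: (is_derive_ext H).
have dg : is_derive t (1 : R) g (flat_tower eps j.+1 t).
  apply: (is_derive_ext (is_deriveM (is_deriveM dum dvj) (is_deriveM dP dE))) => //.
  rewrite !mulrfctE /GRing.scale /= /flat_tower et /= hornerD hornerD hornerN hornerZ !hornerM hornerX.
  rewrite -/P -/v.
  have uv : (t - eps) * v = 1 by rewrite /v mulfV.
  (* At exponent 0 the predecessor is truncated, but the numerical factor in front vanishes; the
     same occurs for j just below. *)
  have um : m%:R * (t - eps) ^+ m.-1 = m%:R * (t - eps) ^+ m * v.
    case: (m) => [|k]; first by rewrite !mul0r.
    by rewrite exprSr /= -2!mulrA uv mulr1.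
  have vj : j%:R * v ^+ j.-1 * v = j%:R * v ^+ j.
    by case: (j) => [|k]; rewrite ?mul0r// exprSr mulrA.
  rewrite um (_ : j%:R * v ^+ j.-1 * - v ^+ 2 = - (j%:R * v ^+ j * v)).
    by rewrite (exprSr v j) expr2; ring.
  by rewrite mulrN expr2 mulrA vj.
apply: (near_eq_is_derive _ dg).
near=> s; rewrite /g /flat_tower ifT//.
near: s; exact: lt_nbhsr.
Unshelve. all: by end_near.
Qed.

Lemma is_derive_flat_tower_lt eps j t : t < eps ->
  is_derive t (1 : R) (flat_tower eps j) (flat_tower eps j.+1 t).
Proof.
move=> te; rewrite {2}/flat_tower ifF; last by apply/negbTE; rewrite -leNgt ltW.
apply: (near_eq_is_derive _ (is_derive_cst 0 t 1)).
near=> s; rewrite /flat_tower ifF//; apply/negbTE; rewrite -leNgt ltW//.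
near: s; exact: lt_nbhsl.
Unshelve. all: by end_near.
Qed.

(** The exponential absorbs (eps/u)^(j+2), which cancels u^-j and leaves u^2; this quadratic decay
    gives derivative zero at the gluing point. *)
Lemma flat_tower_small eps j : 0 < eps -> exists C, forall u, 0 < u -> u <= 1 ->
  `|flat_tower eps j (u + eps)| <= C * u ^+ 2.
Proof.
move=> e0; have [C HC] := poly_expRN_bounded ('X ^+ j.+2 * flat_poly j).
exists (eps^-1 ^+ j.+2 * C) => u u0 u1.
rewrite /flat_tower addrK ltrDr u0 normrM.
have s0 : 0 <= eps / u by rewrite divr_ge0// ltW.
have := HC _ s0; rewrite hornerM hornerXn normrM [`|(eps / u) ^+ _|]ger0_norm ?exprn_ge0// => H.
rewrite [X in _ * X]normrM (ger0_norm (expR_ge0 _)).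
rewrite ger0_norm; last by rewrite mulr_ge0// exprn_ge0// ?invr_ge0 ltW.
have h1 : u ^+ m <= 1 by apply: exprn_ile1 => //; exact: ltW.
have hv : 0 <= u^-1 ^+ j by rewrite exprn_ge0 ?invr_ge0 ?ltW.
have hX : 0 <= `|(flat_poly j).[eps / u]| * expR (- (eps / u)) by rewrite mulr_ge0 ?expR_ge0.
apply: (le_trans (ler_wpM2r hX (ler_piMl hv h1))).
have -> : u^-1 ^+ j * (`|(flat_poly j).[eps / u]| * expR (- (eps / u))) =
    eps^-1 ^+ j.+2 * u ^+ 2 * ((eps / u) ^+ j.+2 * `|(flat_poly j).[eps / u]| * expR (- (eps / u))).
  rewrite exprMn 2!(exprSr u^-1) -[RHS]mulrA; set X := `|_|; set Y := expR _.
  have -> : eps^-1 ^+ j.+2 * (u ^+ 2 * (eps ^+ j.+2 * (u^-1 ^+ j * u^-1 * u^-1) * X * Y)) =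
     (eps^-1 * eps) ^+ j.+2 * (u * u^-1) ^+ 2 * (u^-1 ^+ j * (X * Y)).
    by rewrite !exprMn; ring.
  by rewrite mulVf ?mulfV ?gt_eqF// !expr1n !mul1r.
rewrite [leRHS]mulrAC; apply: ler_wpM2l H.
by rewrite mulr_ge0 ?sqr_ge0// exprn_ge0// invr_ge0 ltW.
Qed.

Lemma is_derive_flat_tower eps j t : 0 < eps ->
  is_derive t (1 : R) (flat_tower eps j) (flat_tower eps j.+1 t).
Proof.
move=> e0; have [te|te|->] := ltgtP t eps.
- exact: is_derive_flat_tower_lt.
- exact: is_derive_flat_tower_gt.
have Z i : flat_tower eps i eps = 0 by rewrite /flat_tower ltxx.
rewrite Z; have [C HC] := flat_tower_small j e0.
have H : (fun h : R => h^-1 *: ((flat_tower eps j \o shift eps) (h *: 1) - flat_tower eps j eps)) @ 0^' --> (0 : R).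
  apply/cvgr0Pnorm_lt => e ee0.
  have C1 : 0 < `|C| + 1 by rewrite ltr_pwDr.
  near=> h.
  have h0 : h != 0 by near: h; exact: nbhs_dnbhs_neq.
  have hs : `|h| < Num.min 1 (e / (`|C| + 1)).
    near: h; apply: dnbhs0_lt; rewrite lt_min ltr01 /=; exact: divr_gt0.
  move: hs; rewrite lt_min => /andP[h1 h2].
  have -> : h^-1 *: ((flat_tower eps j \o shift eps) (h *: 1) - flat_tower eps j eps) =
      h^-1 * flat_tower eps j (h + eps).
    by rewrite Z subr0 /= /GRing.scale /= mulr1.
  rewrite normrM normfV.
  have [hp|hn] := ltP 0 h; last first.
    rewrite [flat_tower _ _ _](_ : _ = 0) ?normr0 ?mulr0//.
    by rewrite /flat_tower ifF//; apply/negbTE; rewrite -leNgt -lerBrDr subrr.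
  rewrite (gtr0_norm hp) in h1 h2; rewrite (gtr0_norm hp).
  rewrite ltr_pdivrMl//; apply: le_lt_trans (HC _ hp (ltW h1)) _.
  rewrite expr2 mulrCA ltr_pM2l//.
  move: h2; rewrite ltr_pdivlMr// => h2; apply: le_lt_trans h2.
  rewrite [leLHS]mulrC; apply: ler_wpM2l; first exact: ltW.
  by have := ler_norm C; lra.
split; first by apply/cvg_ex; eexists; exact: H.
exact/cvg_lim.
Unshelve. all: by end_near.
Qed.

Lemma flat_tower_supp eps j t : flat_tower eps j t != 0 -> eps <= t.
Proof. by rewrite /flat_tower; case: ifP => [/ltW//|_]; rewrite eqxx. Qed.

(** For j at most m no negative power of t - eps remains, so the constant can be chosen before eps,
    as dominated convergence requires. *)
Lemma flat_tower_bounded j : (j <= m)%N ->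
  exists C, forall eps t, 0 < eps -> t <= 1 -> `|flat_tower eps j t| <= C.
Proof.
move=> jm; have [C HC] := poly_expRN_bounded (flat_poly j).
have C0 : 0 <= C by apply: le_trans (HC 0 (lexx _)); rewrite mulr_ge0 ?expR_ge0.
exists C => eps t e0 t1; rewrite /flat_tower; case: ifP => et; last by rewrite normr0.
have u0 : 0 < t - eps by rewrite subr_gt0.
have u1 : t - eps <= 1 by rewrite lerBlDr (le_trans t1)// lerDl ltW.
have -> : (t - eps) ^+ m * (t - eps)^-1 ^+ j = (t - eps) ^+ (m - j).
  by rewrite -{1}(subnK jm) exprD -mulrA -exprMn mulfV ?gt_eqF// expr1n mulr1.
rewrite normrM normrX gtr0_norm// -[leRHS]mul1r ler_pM ?exprn_ge0 ?(ltW u0)//.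
  by apply: exprn_ile1 => //; exact: ltW.
by rewrite normrM (ger0_norm (expR_ge0 _)); apply: HC; rewrite divr_ge0// ltW.
Qed.

Lemma flat_tower_cvg j t : (j <= m)%N -> 0 < t ->
  flat_tower k.+1%:R^-1 j t @[k --> \oo] --> pow_tower j t.
Proof.
move=> jm t0.
have E0 : (k.+1%:R^-1 : R) @[k --> \oo] --> (0 : R) by exact: cvg_harmonic.
have U : (t - k.+1%:R^-1) @[k --> \oo] --> t.
  by rewrite -[X in _ --> X](subr0 t); apply: cvgB => //; exact: cvg_cst.
have V : (t - k.+1%:R^-1)^-1 @[k --> \oo] --> t^-1 by apply: cvgV => //; rewrite gt_eqF.
have S : (k.+1%:R^-1 / (t - k.+1%:R^-1)) @[k --> \oo] --> (0 : R).
  by rewrite -(mul0r t^-1); exact: cvgM.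
have H : ((t - k.+1%:R^-1) ^+ (m - j) * ((flat_poly j).[k.+1%:R^-1 / (t - k.+1%:R^-1)] *
    expR (- (k.+1%:R^-1 / (t - k.+1%:R^-1))))) @[k --> \oo] --> pow_tower j t.
  rewrite /pow_tower mulrC -flat_poly0; apply: cvgM.
    exact: (@continuous_cvg _ _ _ _ _ _ (fun x : R => x ^+ (m - j)) _ (@exprn_continuous R (m - j) t) U).
  have -> : (flat_poly j).[0] = (flat_poly j).[0] * expR (- 0) by rewrite oppr0 expR0 mulr1.
  apply: cvgM.
    exact: (@continuous_cvg _ _ _ _ _ _ (horner (flat_poly j)) _ (@continuous_horner _ (flat_poly j) 0) S).
  exact: (@continuous_cvg _ _ _ _ _ _ expR _ (@continuous_expR R _) (cvgN S)).
apply: cvg_trans H; apply: near_eq_cvg; near=> k.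
have kt : k.+1%:R^-1 < t by near: k; exact: (cvgr_lt 0).
have u0 : 0 < t - k.+1%:R^-1 by rewrite subr_gt0.
rewrite /flat_tower kt; congr (_ * _).
by rewrite -{2}(subnK jm) exprD -mulrA -exprMn mulfV ?gt_eqF// expr1n mulr1.
Unshelve. all: by end_near.
Qed.

End towers.

(** * Test functions on the unit ball *)

Section ball.
Context {R : realType} {d : nat}.
Local Notation V := 'rV[R]_d.
Local Notation B := (unit_ball R d).
Local Notation mu := (@lebesgue_rV R d).
Implicit Types (f g : V -> R) (i : 'I_d).

Lemma unit_ballE x : B x <-> 0 < rho x.
Proof. by rewrite /unit_ball /rho /= subr_gt0. Qed.

Lemma rho_le1 (x : V) : rho x <= 1.
Proof. by rewrite /rho lerBlDr lerDl sumr_ge0// => i _; exact: sqr_ge0. Qed.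

Lemma rho_ge0_cube (x : V) : 0 <= rho x -> cube x.
Proof.
rewrite /rho subr_ge0 => h i; rewrite -(@ler_pXn2r _ 2)// ?nnegrE// expr1n.
rewrite real_normK ?num_real//; apply: le_trans h.
by rewrite (bigD1 i)//= lerDl sumr_ge0// => j _; exact: sqr_ge0.
Qed.

Lemma continuous_rho : continuous (@rho R d).
Proof. exact/smooth_continuous/smooth_rho. Qed.

Lemma open_unit_ball : open B.
Proof.
rewrite (_ : B = (@rho R d) @^-1` [set t | 0 < t]).
  apply: (open_comp (D := [set t : R | 0 < t])); last exact: open_gt.
  by move=> x _; exact: continuous_rho.
by apply/seteqP; split => x /unit_ballE.
Qed.

Lemma measurable_unit_ball : measurable B.
Proof. by apply: open_measurable_rV; exact: open_unit_ball. Qed.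

Lemma unit_ball_cube : B `<=` @cube R d.
Proof. by move=> x /unit_ballE/ltW/rho_ge0_cube. Qed.

Lemma unit_ball_lty : (mu B < +oo)%E.
Proof.
apply: le_lt_trans (cube_lty d); apply: le_measure.
- by apply/mem_set; exact: measurable_unit_ball.
- by apply/mem_set; exact: measurable_cube.
- exact: unit_ball_cube.
Qed.

Lemma continuous_measurable_ball f : continuous f -> measurable_fun B f.
Proof. by move=> cf; apply: measurable_funTS; exact: continuous_measurable_rV. Qed.

Lemma continuous_bounded_ball f : continuous f -> exists M, forall x, B x -> `|f x| <= M.
Proof.
move=> /cube_bounded[M HM]; exists M => x Bx; apply: HM; exact: unit_ball_cube.
Qed.

Lemma continuous_sqint f : continuous f -> sqint mu B f.
Proof.
move=> cf; have [M HM] := continuous_bounded_ball cf.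
apply: (bounded_sqint measurable_unit_ball unit_ball_lty) HM.
exact: continuous_measurable_ball.
Qed.

Lemma smooth_sqint f : smth f -> sqint mu B f.
Proof. by move=> /smooth_continuous/continuous_sqint. Qed.

(** Compact support in the open ball, expressed as a uniform distance from the zero level of rho; no
    closures appear when sums, products or derivatives are taken. *)
Definition testf f := smth f /\ exists2 e, 0 < e & forall x, f x != 0 -> e <= rho x.

(** On a compact support rho attains a positive minimum; conversely each set e <= rho with e > 0 is
    closed, lies in the cube and stays inside the open ball. *)
Lemma test_functionP f : test_function B f <-> testf f.
Proof.
split=> [[sf cf sB]|[sf [e e0 He]]].
  split; first by rewrite smth.unlock.
  have [[x nx]|fz] := pselect (exists x, f x != 0); last first.
    by exists 1 => // x nx; exfalso; apply: fz; exists x.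
  have nz : closure [set x | f x != 0] !=set0.
    by exists x; apply: subset_closure.
  have [c Kc Hc] := EVT_min_rV nz cf (continuous_subspaceT continuous_rho).
  exists (rho c); first by apply/unit_ballE/sB; rewrite inE in Kc.
  by move=> y ny; apply: Hc; rewrite inE; exact: subset_closure.
have sub : closure [set x | f x != 0] `<=` [set x | e <= rho x].
  rewrite [X in _ `<=` X](closure_id _).1; first exact: closure_subset.
  apply: (preimage_closed (f := @rho R d) (D := [set t : R | e <= t])); last exact: closed_ge.
  by move=> y _; exact: continuous_rho.
split.
- by rewrite smth.unlock in sf.
- apply: (subclosed_compact _ (@compact_cube R d)); first exact: closed_closure.
  by move=> x /sub /= h; apply: rho_ge0_cube; exact: le_trans (ltW e0) h.
- by move=> x /sub /= h; apply/unit_ballE; exact: lt_le_trans h.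
Qed.

Lemma testf_smooth f : testf f -> smth f. Proof. by case. Qed.

Lemma testf_sqint f : testf f -> sqint mu B f.
Proof. by move=> /testf_smooth/smooth_sqint. Qed.

Lemma testf_cube_supp f : testf f -> cube_supp f.
Proof.
by move=> [_ [e e0 He]] x /He h; apply: rho_ge0_cube; exact: le_trans (ltW e0) h.
Qed.

Lemma testf_ball f x : testf f -> f x != 0 -> B x.
Proof. by move=> [_ [e e0 He]] /He h; apply/unit_ballE; exact: lt_le_trans h. Qed.

Lemma testf_mul f g : testf f -> smth g -> testf (fun x => f x * g x).
Proof.
move=> [sf [e e0 He]] sg; split; first exact: smoothM.
by exists e => // x; rewrite mulf_eq0 negb_or => /andP[/He].
Qed.

Lemma testfD f g : testf f -> testf g -> testf (fun x => f x + g x).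
Proof.
move=> [sf [a a0 Ha]] [sg [b b0 Hb]]; split; first exact: smoothD.
exists (Num.min a b); first by rewrite lt_min a0.
move=> x; have [->|/Ha h _] := eqVneq (f x) 0; last by rewrite ge_min h.
by rewrite add0r => /Hb h; rewrite ge_min h orbT.
Qed.

Lemma testfZ c f : testf f -> testf (fun x => c * f x).
Proof.
move=> tf; have := testf_mul tf (smooth_cst c).
by rewrite (_ : (fun x => _) = fun x => c * f x)//; apply/funext => x; rewrite mulrC.
Qed.

Lemma testf_pd f i : testf f -> testf (pd i f).
Proof.
move=> [sf [e e0 He]]; split; first exact: smooth_partial.
exists e => // x nz; apply: contrapT => /negP; rewrite -ltNge => re.
have fz : {near nbhs x, cst 0 =1 f}.
  have : nbhs x ((@rho R d) @^-1` [set t | t < e]).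
    by apply: continuous_rho; exact: (open_nbhs_nbhs (conj (@open_lt _ e) re)).
  apply: filterS => y /= ye; apply/eqP; rewrite eq_sym.
  by have [//|/He] := eqVneq (f y) 0; rewrite leNgt ye.
have := near_eq_is_derive fz (is_derive_cst 0 x (delta_mx 0 i)).
by move=> H; move: nz; rewrite (partialE H) eqxx.
Qed.

Lemma testf_pds f s : testf f -> testf (pds s f).
Proof. by move=> tf; elim: s => [//|i s IH]; exact: testf_pd. Qed.

Lemma testf0 : testf (cst 0).
Proof. by split; [exact: smooth_cst|exists 1 => // x; rewrite /= eqxx]. Qed.

Lemma testf_sum (I : Type) (r : seq I) (F : I -> V -> R) :
  (forall a, testf (F a)) -> testf (fun x => \sum_(a <- r) F a x).
Proof.
move=> tF; elim: r => [|a r IH].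
  rewrite (_ : (fun x => _) = cst 0); first exact: testf0.
  by apply/funext => x; rewrite big_nil.
rewrite (_ : (fun x => _) = (fun x => F a x + \sum_(b <- r) F b x)).
  exact: testfD.
by apply/funext => x; rewrite big_cons.
Qed.

Lemma testfN f : testf f -> testf (fun x => - f x).
Proof.
move=> /(testfZ (-1)); rewrite (_ : (fun x => _) = fun x => - f x)//.
by apply/funext => x; rewrite mulN1r.
Qed.

Lemma testfB f g : testf f -> testf g -> testf (fun x => f x - g x).
Proof. by move=> tf tg; apply: testfD => //; exact: testfN. Qed.

Lemma testf_lap f : testf f -> testf (lap f).
Proof. by move=> tf; apply: testf_sum => i; do 2 apply: testf_pd. Qed.

Lemma testf_lapn k f : testf f -> testf (iter k lap f).
Proof. by move=> tf; elim: k => //= k; exact: testf_lap. Qed.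

Lemma testf_integral f : testf f ->
  \int[mu]_(x in B) f x = \int[mu]_x f x.
Proof.
move=> tf; rewrite Rintegral_mkcond; apply: eq_Rintegral => x _.
rewrite patchE; case: ifPn => //; rewrite notin_setE => nB.
by have [//|/(testf_ball tf)] := eqVneq (f x) 0.
Qed.

Lemma testf_integral_pd f i : testf f -> \int[mu]_(x in B) pd i f x = 0.
Proof.
move=> tf; rewrite testf_integral; last exact: testf_pd.
by rewrite /Rintegral integral_pd//; [exact: testf_smooth|exact: testf_cube_supp].
Qed.

Local Notation "<< f , g >>" := (ip mu B f g).
Let mB := measurable_unit_ball.

Lemma ip_pd f g i : testf f -> smth g -> << pd i f, g >> = - << f, pd i g >>.
Proof.
move=> tf sg; apply/eqP; rewrite -addr_eq0; apply/eqP.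
have sf := testf_smooth tf.
have := testf_integral_pd i (testf_mul tf sg).
rewrite (partialMs i sf sg) RintegralD//.
- apply: sqint_mul => //; first exact/smooth_sqint/smooth_partial.
  exact: smooth_sqint.
- by apply: sqint_mul => //; [exact: smooth_sqint|exact/smooth_sqint/smooth_partial].
Qed.

Lemma ip_pd2 f g i : testf f -> smth g -> << pd i f, pd i g >> = - << f, pd i (pd i g) >>.
Proof. by move=> tf sg; rewrite ip_pd//; exact: smooth_partial. Qed.

Lemma ip_lap f g : testf f -> smth g -> << lap f, g >> = << f, lap g >>.
Proof.
move=> tf sg; have sf := testf_smooth tf.
rewrite /lap ip_suml//; last first.
- exact: smooth_sqint.
- by move=> i; apply: smooth_sqint; do 2 apply: smooth_partial.
rewrite [RHS]ipC ip_suml//; last first.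
- exact: smooth_sqint.
- by move=> i; apply: smooth_sqint; do 2 apply: smooth_partial.
apply: eq_bigr => i _; rewrite ip_pd//; last exact: testf_pd.
by rewrite ip_pd2// opprK ipC.
Qed.

Lemma ip_lapn k f g : testf f -> smth g -> << iter k lap f, g >> = << f, iter k lap g >>.
Proof.
move=> tf; elim: k g => //= k IH g sg; rewrite ip_lap//; last exact: testf_lapn.
by rewrite IH -?iterSr//; exact: smooth_lap.
Qed.

Lemma ip_pds s f g : testf f -> smth g ->
  << pds s f, g >> = (-1) ^+ size s * << f, pds s g >>.
Proof.
move=> tf; elim: s g => [|i s IH] g sg; first by rewrite expr0 mul1r.
rewrite -[pds (i :: s) f]/(pd i (pds s f)) ip_pd//; last exact: testf_pds.
rewrite IH; last exact: smooth_partial.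
rewrite -mulNr exprS mulN1r; congr (_ * << f, _ >>).
by rewrite partials_partialC.
Qed.

(* The coefficients c depend on p and s but not on the tower. *)
Lemma pds_tower s (p : V -> R) : smth p -> exists c : nat -> V -> R,
  [/\ forall j, smth (c j), forall j, (size s < j)%N -> c j = cst 0 &
  forall F : nat -> R -> R, (forall n (t : R), is_derive t (1 : R) (F n) (F n.+1 t)) ->
    pds s (fun x => p x * F 0%N (rho x)) =
    fun x => \sum_(j < (size s).+1) c j x * F j (rho x)].
Proof.
move=> sp; elim: s => [|i s [c [sc cz Hc]]].
  exists (fun j x => if j is 0 then p x else 0); split => [[|j]|[|j]|F dF] //.
    exact: smooth_cst.
  by apply/funext => x; rewrite big_ord_recl big_ord0 addr0.
have sx : smth (fun x : V => - 2 * x 0 i) by apply/smoothZ/smooth_coord.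
pose c' j : V -> R := fun x => pd i (c j) x + (if j is j'.+1 then c j' x * (- 2 * x 0 i) else 0).
exists c'; split.
- move=> [|j].
    exact: (smoothD (smooth_partial i (sc 0%N)) (smooth_cst 0)).
  exact: (smoothD (smooth_partial i (sc j.+1)) (smoothM (sc j) sx)).
- move=> [|j]// sj; apply/funext => x; rewrite /c' cz; last exact: ltnW.
  by rewrite cz// partial_cst /= mul0r addr0.
move=> F dF; have st := smooth_tower (@smooth_rho R d) dF.
rewrite -[LHS]/(pd i (pds s (fun x => p x * F 0%N (rho x)))) Hc//.
rewrite partial_sum; last first.
  by move=> j; exact: (smoothM (sc j) (st j).2).
apply/funext => x.
transitivity (\sum_(j < (size s).+1) (pd i (c j) x * F j (rho x)) +
   \sum_(j < (size s).+1) (c j x * (- 2 * x 0 i)) * F j.+1 (rho x)).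
  rewrite -big_split /=; apply: eq_bigr => j _.
  have [dFj sFj] := st j.
  by rewrite (partialMs i (sc j) sFj) dFj partial_rho /=; ring.
rewrite [RHS](eq_bigr (fun j : 'I__ => pd i (c j) x * F j (rho x) +
   (if (j : nat) is j'.+1 then c j' x * (- 2 * x 0 i) else 0) * F j (rho x))); last first.
  by move=> j _; rewrite /c' mulrDl.
rewrite big_split /=; congr (_ + _).
  rewrite [RHS]big_ord_recr /= cz// partial_cst /= mul0r addr0.
  by [].
by rewrite [RHS]big_ord_recl /= mul0r add0r.
Qed.

Definition cutoff m (p : V -> R) (k : nat) : V -> R :=
  fun x => p x * flat_tower m k.+1%:R^-1 0 (rho x).

Lemma testf_cutoff m p k : smth p -> testf (cutoff m p k).
Proof.
move=> sp; have e0 : 0 < k.+1%:R^-1 :> R by rewrite invr_gt0 ltr0n.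
split.
  apply: smoothM => //.
  by have [] := smooth_tower (@smooth_rho R d) (fun j t => is_derive_flat_tower m j t e0) 0.
exists k.+1%:R^-1 => // x; rewrite mulf_eq0 negb_or => /andP[_].
exact: flat_tower_supp.
Qed.

(** By [pds_tower] the derivatives of [cutoff] and of p rho^m have the same coefficients and differ
    only in the tower, whose levels up to m converge boundedly. This is what puts p rho^m in
    H^m_0. *)
Theorem cvg_cutoff m p s : smth p -> (size s <= m)%N ->
  cvgL2 mu B (fun k => pds s (cutoff m p k)) (pds s (fun x => p x * rho x ^+ m)).
Proof.
move=> sp sm; have [c [sc _ Hc]] := pds_tower s sp.
have e0 k : 0 < k.+1%:R^-1 :> R by rewrite invr_gt0 ltr0n.
have dF k j t := is_derive_flat_tower m j t (e0 k).
have E1 k := Hc _ (dF k).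
have E2 := Hc _ (is_derive_pow_tower m).
have -> : (fun x => p x * rho x ^+ m) = (fun x => p x * pow_tower m 0 (rho x)).
  by apply/funext => x; rewrite /pow_tower ffactn0 mul1r subn0.
have E3 : (fun k => pds s (cutoff m p k)) =
    (fun k x => \sum_(j < (size s).+1) c j x * flat_tower m k.+1%:R^-1 j (rho x)).
  by apply/funext => k; exact: E1.
rewrite E2 E3.
have sF k j : smth (flat_tower m k.+1%:R^-1 j \o @rho R d).
  exact: (smooth_tower (@smooth_rho R d) (dF k) j).2.
have sG j : smth (pow_tower m j \o @rho R d).
  exact: (smooth_tower (@smooth_rho R d) (is_derive_pow_tower m) j).2.
apply: cvgL2_sum => //.
- by move=> j k; exact: (smooth_sqint (smoothM (sc j) (sF k j))).
- by move=> j; exact: (smooth_sqint (smoothM (sc j) (sG j))).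
move=> j; have jm : (j <= m)%N by apply: leq_trans sm; rewrite -ltnS.
have [M HM] := continuous_bounded_ball (smooth_continuous (sc j)).
have [C HC] := @flat_tower_bounded R m j jm.
apply: (@cvgL2_bounded _ _ _ mu B mB unit_ball_lty _ _ (M * C)).
- move=> k; apply: continuous_measurable_ball.
  exact: (smooth_continuous (smoothM (sc j) (sF k j))).
- apply: continuous_measurable_ball.
  exact: (smooth_continuous (smoothM (sc j) (sG j))).
- move=> k x Bx; rewrite normrM ler_pM ?HM//.
  by apply: HC => //; exact: rho_le1.
- move=> x Bx; apply: cvgM; first exact: cvg_cst.
  by apply: flat_tower_cvg => //; exact/unit_ballE.
Qed.

End ball.

(** * Polynomials are total in L2 of the ball *)

Section polynomial_functions.
Context {R : realType} {d : nat}.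
Local Notation V := 'rV[R]_d.

(** The index is an upper bound for the degree, raised only by multiplication by a coordinate;
    statements about degrees then follow by induction on the derivation. *)
Inductive polyf : nat -> (V -> R) -> Prop :=
| polyf_cst n c : polyf n (cst c)
| polyfD n f g : polyf n f -> polyf n g -> polyf n (fun x => f x + g x)
| polyf_coordM n i f : polyf n f -> polyf n.+1 (fun x => x 0 i * f x).

Lemma polyfS n f : polyf n f -> polyf n.+1 f.
Proof. by elim=> *; [exact: polyf_cst|exact: polyfD|exact: polyf_coordM]. Qed.

Lemma polyf_le m n f : (m <= n)%N -> polyf m f -> polyf n f.
Proof.
move=> /subnKC <- pf; elim: (n - m)%N => [|k IH]; first by rewrite addn0.
by rewrite addnS; exact: polyfS.
Qed.

Lemma polyfZ n c f : polyf n f -> polyf n (fun x => c * f x).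
Proof.
elim=> {n f} [n a|n f g _ IHf _ IHg|n i f _ IH].
- exact: (polyf_cst n (c * a)).
- rewrite (_ : (fun x => _) = fun x => c * f x + c * g x); first exact: polyfD.
  by apply/funext => x; rewrite mulrDr.
- rewrite (_ : (fun x => _) = fun x : V => x 0 i * (c * f x)); first exact: polyf_coordM.
  by apply/funext => x; rewrite mulrCA.
Qed.

Lemma polyfN n f : polyf n f -> polyf n (fun x => - f x).
Proof.
move=> /(polyfZ (-1)); rewrite (_ : (fun x => -1 * f x) = fun x => - f x)//.
by apply/funext => x; rewrite mulN1r.
Qed.

Lemma polyfB n f g : polyf n f -> polyf n g -> polyf n (fun x => f x - g x).
Proof. by move=> pf pg; apply: polyfD => //; exact: polyfN. Qed.

Lemma polyfM m n f g : polyf m f -> polyf n g -> polyf (m + n) (fun x => f x * g x).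
Proof.
move=> pf pg; elim: pf => {m f} [m c|m f h _ IHf _ IHh|m i f _ IH].
- by apply: (polyf_le (leq_addl m n)); exact: polyfZ.
- rewrite (_ : (fun x => _) = fun x => f x * g x + h x * g x); first exact: polyfD.
  by apply/funext => x; rewrite mulrDl.
- rewrite (_ : (fun x => _) = fun x : V => x 0 i * (f x * g x)).
    by rewrite addSn; exact: polyf_coordM.
  by apply/funext => x; rewrite mulrA.
Qed.

Lemma polyf_coord i : polyf 1 (fun x : V => x 0 i).
Proof.
have := polyf_coordM i (polyf_cst 0 1).
by rewrite (_ : (fun x => _) = fun x : V => x 0 i)//; apply/funext => x; rewrite mulr1.
Qed.

Definition is_polyf f := exists n, polyf n f.

Lemma is_polyfM f g : is_polyf f -> is_polyf g -> is_polyf (fun x => f x * g x).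
Proof. by move=> [m pf] [n pg]; exists (m + n)%N; exact: polyfM. Qed.

Lemma is_polyfD f g : is_polyf f -> is_polyf g -> is_polyf (fun x => f x + g x).
Proof.
move=> [m pf] [n pg]; exists (maxn m n); apply: polyfD.
  exact: polyf_le (leq_maxl _ _) pf.
exact: polyf_le (leq_maxr _ _) pg.
Qed.

Lemma is_polyf_cst c : is_polyf (cst c). Proof. by exists 0%N; exact: polyf_cst. Qed.

Lemma is_polyfX f n : is_polyf f -> is_polyf (fun x => f x ^+ n).
Proof.
move=> pf; elim: n => [|n IH].
  by rewrite (_ : (fun x => _) = cst 1); [exact: is_polyf_cst|apply/funext => x; rewrite expr0].
rewrite (_ : (fun x => _) = fun x => f x * f x ^+ n); first exact: is_polyfM.
by apply/funext => x; rewrite exprS.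
Qed.

Lemma is_polyf_prod (I : Type) (r : seq I) (F : I -> V -> R) :
  (forall a, is_polyf (F a)) -> is_polyf (fun x => \prod_(a <- r) F a x).
Proof.
move=> pF; elim: r => [|a r IH].
  by rewrite (_ : (fun x => _) = cst 1); [exact: is_polyf_cst|apply/funext => x; rewrite big_nil].
rewrite (_ : (fun x => _) = fun x => F a x * \prod_(b <- r) F b x); first exact: is_polyfM.
by apply/funext => x; rewrite big_cons.
Qed.

Lemma polyf_smooth n f : polyf n f -> smth f.
Proof.
elim=> {n f} [n c|n f g _ sf _ sg|n i f _ sf]; first exact: smooth_cst.
  exact: smoothD.
exact: (smoothM (smooth_coord i) sf).
Qed.

End polynomial_functions.

(** * Polynomial approximation of a step function *)

Section step_polynomials.
Context {R : realType}.
Implicit Types (y u r : R).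

Lemma bernoulli_ge u n : -1 <= u -> 1 + n%:R * u <= (1 + u) ^+ n.
Proof.
move=> u1; elim: n => [|n IH]; first by rewrite mul0r addr0 expr0.
rewrite exprS; have h : 0 <= 1 + u by lra.
apply: le_trans (ler_wpM2l h IH).
rewrite -natr1 mulrDl mul1r; have : 0 <= n%:R * u ^+ 2 by rewrite mulr_ge0 ?sqr_ge0.
by rewrite expr2; lra.
Qed.

Lemma cvg_natMexp r : 0 <= r -> r < 1 -> (n%:R * r ^+ n) @[n --> \oo] --> (0 : R).
Proof.
(* By the arithmetic-geometric inequality r <= s^2, so n r^n is at most (n s^n) s^n, where n s^n is
   bounded by Bernoulli's inequality. *)
move=> r0 r1; pose s := (1 + r) / 2.
have s0 : 0 < s by rewrite /s; lra.
have s1 : s < 1 by rewrite /s; lra.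
have rs : r <= s ^+ 2.
  by have := sqr_ge0 (1 - r); rewrite /s !expr2; lra.
pose h := s^-1 - 1.
have h0 : 0 < h by rewrite subr_gt0 invf_gt1.
have ns n : n%:R * s ^+ n <= h^-1.
  have H : 1 + n%:R * h <= (s ^+ n)^-1.
    rewrite -exprVn (_ : s^-1 = 1 + h); last by rewrite /h addrCA subrr addr0.
    by apply: bernoulli_ge; lra.
  have sn : 0 < s ^+ n by rewrite exprn_gt0.
  rewrite -[leRHS]mul1r ler_pdivlMr// mulrAC -ler_pdivlMr// mul1r.
  by apply: le_trans H; rewrite lerDr.
have cs : (h^-1 * s ^+ n) @[n --> \oo] --> (0 : R).
  rewrite -(mulr0 h^-1); apply: cvgM; first exact: cvg_cst.
  by apply: cvg_expr; rewrite gtr0_norm.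
apply: (squeeze_cvgr _ (cvg_cst (0 : R)) cs).
near=> n; rewrite mulr_ge0 ?exprn_ge0//=.
apply: le_trans (_ : n%:R * s ^+ n * s ^+ n <= _).
  rewrite -mulrA ler_wpM2l// -exprMn -expr2; apply: lerXn2r => //.
  by rewrite nnegrE sqr_ge0.
by rewrite ler_wpM2r// exprn_ge0// ltW.
Unshelve. all: by end_near.
Qed.

(* Polynomials converging boundedly on [0, 1] to the indicator of [0, 1/2[. *)
Definition step_poly n y : R := (1 - y ^+ n) ^+ (n * 2 ^ n).

Lemma step_poly_itv n y : 0 <= y -> y <= 1 -> 0 <= step_poly n y <= 1.
Proof.
move=> y0 y1; have h0 : 0 <= y ^+ n by rewrite exprn_ge0.
have h1 : y ^+ n <= 1 by exact: exprn_ile1.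
by rewrite /step_poly exprn_ge0 ?exprn_ile1//; lra.
Qed.

(** Put N = n 2^n, so that N y^n = n (2y)^n. Below 1/2 Bernoulli gives the lower bound 1 - n (2y)^n;
    otherwise (1 - y^n)^N (1 + y^n)^N <= 1 while the second factor is at least 1 + n. The extra n in
    the exponent is what forces the limit 0 at y = 1/2 itself. *)
Lemma cvg_step_poly y : 0 <= y -> y <= 1 ->
  step_poly n y @[n --> \oo] --> ((y < 1 / 2)%R%:R : R).
Proof.
move=> y0 y1.
have h0 n : 0 <= y ^+ n by rewrite exprn_ge0.
have h1 n : y ^+ n <= 1 by exact: exprn_ile1.
have e n : (n * 2 ^ n)%:R * y ^+ n = n%:R * (2 * y) ^+ n :> R.
  by rewrite natrM natrX exprMn mulrA.
have [y2|y2] := ltP y (1 / 2).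
- have c : (1 - n%:R * (2 * y) ^+ n) @[n --> \oo] --> (1 : R).
    rewrite -[X in _ --> X](subr0 (1 : R)); apply: cvgB; first exact: cvg_cst.
    by apply: cvg_natMexp; lra.
  apply: (squeeze_cvgr _ c (cvg_cst (1 : R))).
  near=> n; rewrite (andP (step_poly_itv n y0 y1)).2 andbT -e.
  have := @bernoulli_ge (- y ^+ n) (n * 2 ^ n); rewrite mulrN; apply.
  by have := h1 n; lra.
- have c : n.+1%:R^-1 @[n --> \oo] --> (0 : R) by exact: cvg_harmonic.
  apply: (squeeze_cvgr _ (cvg_cst (0 : R)) c).
  near=> n; rewrite (andP (step_poly_itv n y0 y1)).1 /=.
  have p1 : 1 + n%:R <= (1 + y ^+ n) ^+ (n * 2 ^ n) :> R.
    apply: le_trans (@bernoulli_ge (y ^+ n) (n * 2 ^ n) _); last by have := h0 n; lra.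
    rewrite lerD2l e ler_peMr// exprn_ege1//; lra.
  have q : (1 - y ^+ n) ^+ (n * 2 ^ n) * (1 + y ^+ n) ^+ (n * 2 ^ n) <= 1.
    rewrite -exprMn exprn_ile1//.
      by rewrite mulr_ge0//; have := h0 n; have := h1 n; lra.
    by have := sqr_ge0 (y ^+ n); rewrite expr2; lra.
  rewrite -[leRHS]mul1r ler_pdivlMr ?ltr0n//; apply: le_trans q.
  rewrite /step_poly ler_wpM2l//; last by rewrite -natr1 addrC.
  by rewrite exprn_ge0//; have := h1 n; lra.
Unshelve. all: by end_near.
Qed.

End step_polynomials.

(** * From polynomials to orthants, and from orthants to Borel sets *)

Section orthogonality.
Context {R : realType} {d : nat}.
Local Notation V := 'rV[R]_d.
Local Notation B := (unit_ball R d).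
Local Notation mu := (@lebesgue_rV R d).
Let mB : measurable B := measurable_unit_ball.

Definition orthant (a : 'I_d -> R) : set V := [set x | forall i, x 0 i < a i].

Lemma measurable_orthant a : measurable (orthant a).
Proof.
rewrite (_ : orthant a = \bigcap_(i in [set: 'I_d]) ((fun x : V => x 0 i : R) @^-1` `]-oo, a i[%classic)).
  apply: fin_bigcap_measurable => [|i _]; first exact: finite_finset.
  by rewrite -[X in measurable X]setTI; apply: (measurable_coord i).
apply/seteqP; split => [x H i _|x H i] /=; first by rewrite in_itv /=; exact: H.
by have := H i I; rewrite /= in_itv.
Qed.

(** Orthants are stable under intersection, which coordinate half-spaces are not; this is the
    generating family for Dynkin's lemma. *)
Lemma measurable_rVE : @measurable _ V = <<s [set orthant a | a in setT] >>.
Proof.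
set G := [set orthant a | a in setT].
apply/seteqP; split; last first.
  apply: smallest_sub; first exact: sigma_algebra_measurable.
  by move=> _ [a _ <-]; exact: measurable_orthant.
apply: smallest_sub; first exact: smallest_sigma_algebra.
rewrite -bigcup_seq => A [i _ [Y mY <-]] /=.
suff mc : measurable_fun (setT : set (g_sigma_algebraType G)) (fun x : g_sigma_algebraType G => (x : V) 0 i : R).
  exact: mc.
apply: (measurability _ (RGenInftyO.measurableE R)).
move=> _ [_ [a ->] <-]; rewrite setTI.
(* A half-space is the increasing union of orthants whose other sides recede to infinity. *)
rewrite (_ : _ @^-1` _ = \bigcup_n orthant (fun j => if j == i then a else n%:R)).
  by apply: bigcupT_measurable => n; apply: sub_sigma_algebra; exists (fun j => if j == i then a else n%:R).
apply/seteqP; split => [x|x [n _ H]] /=; rewrite in_itv /=; last first.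
  by have := H i; rewrite eqxx.
move=> xa; have [M HM] : exists M : R, forall j, `|x 0 j| <= M.
  exists (\sum_j `|x 0 j|) => j; rewrite (bigD1 j)//= lerDl.
  by rewrite sumr_ge0.
exists (Num.truncn M).+1 => // j; case: eqVneq => [->//|_].
apply: le_lt_trans (ler_norm _) (le_lt_trans (HM j) _).
by rewrite truncnS_gt.
Qed.

Lemma sqint_indic A : measurable A -> sqint mu B (fun x => \1_A x).
Proof.
move=> mA; apply: (bounded_sqint mB unit_ball_lty (M := 1)).
  by apply: measurable_funTS; exact: measurable_indic.
by move=> x _; rewrite indicE; case: (_ \in _); rewrite ?normr1 ?normr0 ?ler01.
Qed.

Lemma ip_indic g A : measurable A ->
  ip mu B g (fun x => \1_A x) = \int[mu]_(x in B `&` A) g x.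
Proof.
move=> mA; rewrite /ip Rintegral_mkcondr; apply: eq_Rintegral => x _.
by rewrite patchE indicE; case: ifP => _; rewrite ?mulr1 ?mulr0.
Qed.

(** Coordinates in the ball lie strictly between -1 and 1, so clamping the sides of an orthant does
    not change its trace on the ball, and it keeps the rescaled variable of [orthogonal_orthant] in
    [0, 1]. *)
Definition clamp (t : R) : R := Num.max (-1) (Num.min 1 t).

Lemma clamp_itv t : -1 <= clamp t <= 1.
Proof.
rewrite /clamp le_max lexx /= ge_max ge_min lexx /= andbT; lra.
Qed.

Lemma lt_clamp (s t : R) : -1 < s -> s < 1 -> (s < clamp t) = (s < t).
Proof.
by move=> s0 s1; rewrite /clamp lt_max lt_min s1 /= (ltNge s (-1)) (ltW s0).
Qed.

(** The indicator of the orthant is the bounded limit on the ball of products of step polynomials,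
    one per coordinate, each rescaled so that its jump sits at the side of the orthant. *)
Lemma orthogonal_orthant g a : sqint mu B g ->
  (forall p, is_polyf p -> ip mu B g p = 0) -> \int[mu]_(x in B `&` orthant a) g x = 0.
Proof.
move=> sg gp; rewrite -ip_indic; last exact: measurable_orthant.
pose y i (x : V) : R := 1 / 2 + (x 0 i - clamp (a i)) / 4.
pose p n (x : V) : R := \prod_(i < d) step_poly n (y i x).
have pp n : is_polyf (p n).
  apply: is_polyf_prod => i; apply: is_polyfX.
  rewrite (_ : (fun x => _) = fun x => 1 + (-1) * (y i x) ^+ n); last first.
    by apply/funext => x; rewrite mulN1r.
  apply: is_polyfD; first exact: is_polyf_cst.
  apply: is_polyfM; first exact: is_polyf_cst.
  apply: is_polyfX; rewrite /y.
  rewrite (_ : (fun x => _) = fun x : V => (1 / 2 - clamp (a i) / 4) + 4^-1 * x 0 i); last first.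
    by apply/funext => x; field.
  apply: is_polyfD; first exact: is_polyf_cst.
  by apply: is_polyfM; [exact: is_polyf_cst|exists 1%N; exact: polyf_coord].
have yB i x : B x -> 0 <= y i x <= 1.
  move=> /unit_ball_cube/(_ i); rewrite ler_norml => /andP[h1 h2].
  by have /andP[h3 h4] := clamp_itv (a i); rewrite /y; apply/andP; split; lra.
have cp : cvgL2 mu B p (fun x => \1_(orthant a) x).
  apply: (cvgL2_bounded mB unit_ball_lty (M := 1)).
  - move=> n; have [k pn] := pp n.
    by apply: continuous_measurable_ball; exact: smooth_continuous (polyf_smooth pn).
  - by have [] := sqint_indic (measurable_orthant a).
  - move=> n x Bx; rewrite /p normr_prod; apply: prodr_ile1 => i _.
    have /andP[y0 y1] := yB i x Bx; have /andP[s0 s1] := step_poly_itv n y0 y1.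
    by rewrite normr_ge0 ger0_norm.
  - move=> x Bx.
    have -> : \1_(orthant a) x = \prod_(i < d) ((y i x < 1 / 2)%R%:R : R).
      have E i : (y i x < 1 / 2) = (x 0 i < a i).
        have : -1 < x 0 i < 1.
          rewrite -ltr_norml -(@ltr_pXn2r _ 2)// ?nnegrE// expr1n real_normK ?num_real//.
          apply: le_lt_trans Bx; rewrite (bigD1 i)//= lerDl.
          by rewrite sumr_ge0// => j _; exact: sqr_ge0.
        move=> /andP[x0 x1]; rewrite -(lt_clamp (a i) x0 x1) /y.
        by apply/idP/idP; lra.
      under eq_bigr => i _ do rewrite E.
      rewrite indicE; case: (boolP (x \in _)) => [|]; rewrite ?notin_setE ?inE => H.
        by rewrite big1// => i _; rewrite H.
      have /existsNP[i /negP] := H; rewrite -leNgt => xi.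
      by rewrite (bigD1 i)//= ltNge xi mul0r.
    rewrite /p; elim: (index_enum _) => [|i r IH].
      under eq_fun do rewrite big_nil.
      by rewrite big_nil; exact: cvg_cst.
    under eq_fun do rewrite big_cons.
    rewrite big_cons; apply: cvgM => //.
    by have /andP[y0 y1] := yB i x Bx; exact: cvg_step_poly.
have sp n : sqint mu B (p n).
  by have [k pn] := pp n; exact: smooth_sqint (polyf_smooth pn).
have := cvgL2_ip mB (fun=> sg) sp sg (sqint_indic (measurable_orthant a))
  (cvgL2_cst mu mB g) cp.
have -> : (fun n => ip mu B g (p n)) = fun=> 0 by apply/funext => n; exact: gp.
by move=> H; have := cvg_unique _ H (cvg_cst (0 : R)); apply.
Qed.

(** The sets over which g integrates to zero form a Dynkin system containing the orthants, hence all
    measurable sets; the sets where g is nonnegative and negative then give a zero integral of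
    |g|. *)
Theorem orthogonal_polyf g : sqint mu B g ->
  (forall p, is_polyf p -> ip mu B g p = 0) -> ae_eq mu B g (cst 0).
Proof.
move=> sg gp.
have Ig : mu.-integrable B (EFin \o g) by exact: (sqint_integrable mB unit_ball_lty sg).
have IgA A : measurable A -> mu.-integrable (B `&` A) (EFin \o g).
  move=> mA; apply: (integrableS mB _ _ Ig); [exact: measurableI|exact: subIsetl].
have mg A : measurable A -> measurable_fun (B `&` A) (EFin \o g).
  by move=> mA; have /integrableP[] := IgA _ mA.
have H A : measurable A -> (\int[mu]_(x in B `&` A) (g x)%:E = 0)%E.
  move=> mA; move: (mA); rewrite measurable_rVE => sA.
  move: A sA {mA}; apply: (dynkin_induction measurable_rVE).
  - move=> _ _ [a _ <-] [b _ <-]; exists (fun i => Num.min (a i) (b i)) => //.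
    apply/seteqP; split => [x H|x [Ha Hb] i]; last by rewrite lt_min Ha Hb.
    by split => i; have := H i; rewrite lt_min => /andP[].
  - rewrite setIT -(fineK (integrable_fin_num mB Ig)); congr EFin.
    rewrite -[LHS]/(\int[mu]_(x in B) g x) -[RHS](gp (cst 1) (is_polyf_cst 1)).
    by apply: eq_Rintegral => x _; rewrite /= mulr1.
  - move=> _ [a _ <-]; have mo := measurable_orthant a.
    rewrite -(fineK (integrable_fin_num (measurableI _ _ mB mo) (IgA _ mo))).
    by congr EFin; exact: orthogonal_orthant.
  - move=> S mS HS.
    have mSC := measurableC mS.
    have E : (\int[mu]_(x in B) (g x)%:E = \int[mu]_(x in B `&` S) (g x)%:E +
       \int[mu]_(x in B `&` ~` S) (g x)%:E)%E.
      rewrite -integral_setU; [|exact: measurableI|exact: measurableI| |].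
      - by rewrite -setIUr setUv setIT.
      - by rewrite -setIUr setUv setIT; have /integrableP[] := Ig.
      - by apply/disj_setPS => x [[_ ?] [_ ?]].
    move: E; rewrite HS add0e => <-.
    rewrite -(fineK (integrable_fin_num mB Ig)); congr EFin.
    rewrite -[LHS]/(\int[mu]_(x in B) g x) -[RHS](gp (cst 1) (is_polyf_cst 1)).
    by apply: eq_Rintegral => x _; rewrite /= mulr1.
  - move=> F mF tF HF; rewrite setI_bigcupr integral_bigcup.
    + by rewrite eseries0.
    + by apply: trivIset_setIl.
    + by move=> k; apply: measurableI.
    + by rewrite -setI_bigcupr; apply: IgA; exact: bigcup_measurable.
have [mg0 _] := sg.
pose P := B `&` (g @^-1` `[0, +oo[%classic).
have mP : measurable P by apply: mg0 => //; exact: measurable_itv.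
have : (\int[mu]_(x in B) `|(EFin \o g) x| = 0)%E.
  have -> : B = (B `&` P) `|` (B `&` ~` P) by rewrite -setIUr setUv setIT.
  rewrite integral_setU; [|exact: measurableI|by apply: measurableI => //; exact: measurableC| |].
  - have -> : (\int[mu]_(x in B `&` P) `|(EFin \o g) x| = \int[mu]_(x in B `&` P) (g x)%:E)%E.
      apply: eq_integral => x; rewrite inE => -[_ [_ /=]]; rewrite in_itv /= andbT => g0.
      by rewrite ger0_norm.
    have -> : (\int[mu]_(x in B `&` ~` P) `|(EFin \o g) x| = \int[mu]_(x in B `&` ~` P) ((-1)%:E * (g x)%:E))%E.
      apply: eq_integral => x; rewrite inE => -[Bx nP] /=.
      rewrite -EFinM mulN1r ltr0_norm// ltNge; apply/negP => g0; apply: nP; split => //=.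
      by rewrite in_itv /= g0.
    have mPC := measurableC mP.
    by rewrite (integralZl (measurableI _ _ mB mPC) (IgA _ mPC)) !H// mule0 adde0.
  - rewrite -setIUr setUv setIT; apply/measurableT_comp => //.
    by have /integrableP[] := Ig.
  - by apply/disj_setPS => x [[_ ?] [_ ?]].
have mgB : measurable_fun B (EFin \o g) by have /integrableP[] := Ig.
move=> /(ae_eq_integral_abs mu mB mgB); apply: filterS => x /= h Bx.
by have [] := h Bx.
Qed.

End orthogonality.

(** * The operators (-Delta)^m (p rho^m) *)

(* An endomorphism of a finite-dimensional space of functions which is injective
   modulo equality on D is surjective modulo equality on D. *)
Section finite_dimensional.
Context {R : realType} {X : Type}.
Variables (D : X -> Prop) (P : (X -> R) -> Prop) (T : (X -> R) -> X -> R).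

Definition lin n (e : 'I_n -> X -> R) (a : 'I_n -> R) : X -> R :=
  fun x => \sum_(i < n) a i * e i x.

Definition spans n (e : 'I_n -> X -> R) := (forall i, P (e i)) /\
  forall f, P f -> exists a, forall x, D x -> f x = lin e a x.

Hypothesis P_lin : forall n (e : 'I_n -> X -> R) a, (forall i, P (e i)) -> P (lin e a).
Hypothesis T_lin : forall n (e : 'I_n -> X -> R) a, (forall i, P (e i)) ->
  T (lin e a) = lin (fun i => T (e i)) a.
Hypothesis T_P : forall f, P f -> P (T f).
Hypothesis T_inj : forall f, P f -> (forall x, D x -> T f x = 0) -> forall x, D x -> f x = 0.
Hypothesis fin : exists n (e : 'I_n -> X -> R), spans e.

(** The relation is solved for the j-th generator, which is then eliminated from every
    combination. *)
Lemma spans_drop n (e : 'I_n.+1 -> X -> R) a j : spans e -> a j != 0 ->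
  (forall x, D x -> lin e a x = 0) -> spans (fun i => e (lift j i)).
Proof.
move=> [Pe He] aj ea; split => [i|f Pf]; first exact: Pe.
have [b Hb] := He f Pf.
exists (fun i => b (lift j i) - b j / a j * a (lift j i)) => x Dx.
have split_j c : lin e c x = c j * e j x + \sum_(i < n) c (lift j i) * e (lift j i) x.
  rewrite /lin (bigD1_ord j)//=.
rewrite Hb// split_j.
have := ea x Dx; rewrite split_j => h.
have -> : e j x = - (a j)^-1 * \sum_(i < n) a (lift j i) * e (lift j i) x.
  apply: (mulfI aj); rewrite mulrA mulrN mulfV// mulN1r.
  by apply/eqP; rewrite -addr_eq0 h.
rewrite /lin; under [RHS]eq_bigr => i _ do rewrite mulrBl -(mulrA (b j / a j)).
by rewrite big_split /= sumrN -mulr_sumr addrC; congr (_ + _); ring.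
Qed.

(** A shortest spanning family is independent on D, so T acts on coordinates by a square matrix;
    [T_inj] makes its left kernel trivial, and the inverse matrix solves the equation. *)
Lemma surj_of_inj f : P f -> exists2 g, P g & forall x, D x -> T g x = f x.
Proof.
pose Q n := `[< exists e : 'I_n -> X -> R, spans e >].
have exQ : exists n, Q n by have [n [e He]] := fin; exists n; apply/asboolP; exists e.
have [n /asboolP[e se] minn] := ex_minnP exQ.
have indep a : (forall x, D x -> lin e a x = 0) -> forall j, a j = 0.
  move=> ea j; apply/eqP; apply: contrapT => /negP aj.
  case: n e se minn a ea j aj => [|n] e se minn a ea j aj; first by case: j aj.
  have := minn n; rewrite ltnn => H; suff : false by [].
  by apply: H; apply/asboolP; eexists; exact: (spans_drop se aj ea).
have [Pe He] := se => Pf.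
have /choice[M HM] : forall i, exists a : 'I_n -> R, forall x, D x -> T (e i) x = lin e a x.
  by move=> i; apply: He; exact: T_P.
pose A : 'M[R]_n := \matrix_(i, j) M i j.
have TA (v : 'rV[R]_n) x : D x -> T (lin e (v 0)) x = lin e ((v *m A) 0) x.
  move=> Dx; rewrite T_lin// /lin.
  under eq_bigr => i _ do rewrite HM// /lin mulr_sumr.
  rewrite exchange_big /=; apply: eq_bigr => j _.
  rewrite mxE mulr_suml; apply: eq_bigr => i _.
  by rewrite mxE mulrA.
have : row_free A.
  rewrite -kermx_eq0; apply/rowV0P => v /sub_kermxP vA.
  apply/rowP => j; rewrite mxE; apply: indep => x Dx.
  apply: (T_inj (P_lin _ Pe)) => // y Dy; rewrite TA// vA.
  by rewrite /lin big1// => i _; rewrite mxE mul0r.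
rewrite row_free_unit => uA.
have [b Hb] := He f Pf.
exists (lin e (((\row_j b j) *m invmx A) 0)); first exact: P_lin.
move=> x Dx; rewrite TA// mulmxKV// Hb//.
by apply: eq_bigr => i _; rewrite mxE.
Qed.

End finite_dimensional.

(** * Factorization, maximum principle and the lower bound *)

Section polyharmonic_on_polynomials.
Context {R : realType} {d : nat}.
Hypothesis d_gt0 : (0 < d)%N.
Local Notation V := 'rV[R]_d.
Local Notation B := (unit_ball R d).
Local Notation mu := (@lebesgue_rV R d).
Let mB : measurable B := measurable_unit_ball.
Implicit Types (f g p : V -> R).

Lemma pd_coordM i j f : smth f ->
  pd i (fun x : V => x 0 j * f x) = fun x => (i == j)%:R * f x + x 0 j * pd i f x.
Proof. by move=> sf; rewrite (partialMs i (smooth_coord j) sf) partial_coord. Qed.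

Lemma polyf_coord_pd n i j f : polyf n f -> polyf n (fun x : V => x 0 i * pd j f x).
Proof.
elim=> {n f} [n c|n f g pf If pg Ig|n k f pf IH].
- rewrite (_ : (fun x => _) = cst 0); first exact: polyf_cst.
  by apply/funext => x; rewrite partial_cst mulr0.
- rewrite (partialDs j (polyf_smooth pf) (polyf_smooth pg)).
  rewrite (_ : (fun x => _) = fun x : V => x 0 i * pd j f x + x 0 i * pd j g x).
    exact: polyfD.
  by apply/funext => x; rewrite mulrDr.
- rewrite (pd_coordM j k (polyf_smooth pf)).
  rewrite (_ : (fun x => _) = fun x : V => (j == k)%:R * (x 0 i * f x) + x 0 k * (x 0 i * pd j f x)).
    by apply: polyfD; [apply: polyfZ; exact: polyf_coordM|exact: polyf_coordM].
  by apply/funext => x; ring.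
Qed.

Lemma polyf_pd n j f : polyf n f -> polyf n (pd j f).
Proof.
elim=> {n f} [n c|n f g pf If pg Ig|n k f pf IH].
- by rewrite partial_cst; exact: polyf_cst.
- by rewrite (partialDs j (polyf_smooth pf) (polyf_smooth pg)); exact: polyfD.
- rewrite (pd_coordM j k (polyf_smooth pf)); apply: polyfD; last exact: polyf_coordM.
  by apply: polyfS; exact: polyfZ.
Qed.

(** The square of x_i d_j, which keeps the degree, differs from this operator only by a multiple of
    x_i d_j. *)
Lemma polyf_coord2_pd2 n i j f : polyf n f ->
  polyf n (fun x : V => x 0 i ^+ 2 * pd j (pd j f) x).
Proof.
move=> pf; have h := polyf_coord_pd i j (polyf_coord_pd i j pf).
rewrite (pd_coordM j i (polyf_smooth (polyf_pd j pf))) in h.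
rewrite (_ : (fun x => _) = fun x : V => x 0 i * ((j == i)%:R * pd j f x + x 0 i * pd j (pd j f) x)
  - (j == i)%:R * (x 0 i * pd j f x)).
  by apply: polyfB => //; apply: polyfZ; exact: polyf_coord_pd.
by apply/funext => x; rewrite expr2; ring.
Qed.

Lemma polyf_sum n (I : Type) (r : seq I) (F : I -> V -> R) :
  (forall a, polyf n (F a)) -> polyf n (fun x => \sum_(a <- r) F a x).
Proof.
move=> pF; elim: r => [|a r IH].
  by rewrite (_ : (fun x => _) = cst 0); [exact: polyf_cst|apply/funext => x; rewrite big_nil].
rewrite (_ : (fun x => _) = fun x => F a x + \sum_(b <- r) F b x); first exact: polyfD.
by apply/funext => x; rewrite big_cons.
Qed.

Definition qcoef k : R := 2 * k.+1%:R * (2 * k%:R + d%:R).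

Lemma qcoef_gt0 k : 0 < qcoef k.
Proof. by rewrite mulr_gt0 ?mulr_gt0 ?ltr0n// ltr_wpDl ?mulr_ge0// ltr0n. Qed.

(** On the sphere rho = 0 leaves a radial derivative plus a positive multiple of f, which drives
    [max_principle]. The quadratic weight rho also compensates the two orders of Delta, so degrees
    do not grow. *)
Definition Qop k f : V -> R := fun x =>
  - (rho x * lap f x) + 4 * k.+1%:R * euler f x + qcoef k * f x.

Lemma polyf_Qop n k f : polyf n f -> polyf n (Qop k f).
Proof.
move=> pf; apply: polyfD; last exact: polyfZ.
apply: polyfD; last by apply: polyfZ; apply: polyf_sum => i; exact: polyf_coord_pd.
rewrite (_ : (fun x => _) = fun x : V => \sum_(i < d) \sum_(j < d) (x 0 i ^+ 2 * pd j (pd j f) x)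
   - lap f x).
  apply: polyfB; last by apply: polyf_sum => i; do 2 apply: polyf_pd.
  by apply: polyf_sum => i; apply: polyf_sum => j; exact: polyf_coord2_pd2.
apply/funext => x; rewrite /rho mulrBl mul1r opprB; congr (_ - _).
by rewrite /lap mulr_suml; apply: eq_bigr => i _; rewrite mulr_sumr.
Qed.

Lemma QopD k f g : smth f -> smth g ->
  Qop k (fun x => f x + g x) = fun x => Qop k f x + Qop k g x.
Proof.
move=> sf sg; apply/funext => x; rewrite /Qop lapD//.
have -> : euler (fun x => f x + g x) x = euler f x + euler g x.
  rewrite /euler -big_split /=; apply: eq_bigr => i _.
  by rewrite partialDs// mulrDr.
by ring.
Qed.

Lemma QopZ k c f : smth f -> Qop k (fun x => c * f x) = fun x => c * Qop k f x.
Proof.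
move=> sf; apply/funext => x; rewrite /Qop lapZ//.
have -> : euler (fun x => c * f x) x = c * euler f x.
  rewrite /euler mulr_sumr; apply: eq_bigr => i _.
  by rewrite partialZ// mulrCA.
by ring.
Qed.

Lemma Qop_cst k c : Qop k (cst c) = cst (qcoef k * c).
Proof.
apply/funext => x; rewrite /Qop /lap /euler !big1 => [|i _|i _].
- by rewrite !mulr0 oppr0 !add0r.
- by rewrite partial_cst mulr0.
- by rewrite !partial_cst.
Qed.

Definition plap m f : V -> R := fun x => (-1) ^+ m * iter m lap f x.
Definition Lop m p : V -> R := plap m (fun x => p x * rho x ^+ m).

Lemma smooth_rhoX m p : smth p -> smth (fun x : V => p x * rho x ^+ m).
Proof.
move=> sp; elim: m => [|m IH].
  by rewrite (_ : (fun x => _) = p)//; apply/funext => x; rewrite expr0 mulr1.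
rewrite (_ : (fun x => _) = fun x : V => rho x * (p x * rho x ^+ m)).
  by apply: smoothM => //; exact: smooth_rho.
by apply/funext => x; rewrite exprS; ring.
Qed.

Lemma Lop0 p : Lop 0 p = p.
Proof. by apply/funext => x; rewrite /Lop /plap expr0 mul1r /= expr0 mulr1. Qed.

(** This is [lapn_rhoM] at f = p rho^m; the additional sign turns the bracket into [Qop m]. *)
Lemma LopS m p : smth p -> Lop m.+1 p = Qop m (Lop m p).
Proof.
move=> sp; have sr := smooth_rhoX m sp.
rewrite /Lop /plap QopZ; last exact: smooth_lapn.
rewrite (_ : (fun x => p x * rho x ^+ m.+1) = fun x : V => rho x * (p x * rho x ^+ m)).
  rewrite lapn_rhoM//; apply/funext => x; rewrite /Qop -iterS exprS /qcoef; ring.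
by apply/funext => x; rewrite exprS; ring.
Qed.

Lemma polyf_Lop n m p : polyf n p -> polyf n (Lop m p).
Proof.
move=> pp; elim: m => [|m IH]; first by rewrite Lop0.
by rewrite LopS; [exact: polyf_Qop|exact: polyf_smooth pp].
Qed.

Definition Ccoef m : R := \prod_(k < m) qcoef k.

Lemma Ccoef_gt0 m : 0 < Ccoef m.
Proof. by apply: prodr_gt0 => i _; exact: qcoef_gt0. Qed.

Lemma CcoefS m : Ccoef m.+1 = Ccoef m * qcoef m.
Proof. by rewrite /Ccoef big_ord_recr. Qed.

Lemma Lop1 m : Lop m (cst 1) = cst (Ccoef m).
Proof.
elim: m => [|m IH]; first by rewrite Lop0 /Ccoef big_ord0.
rewrite LopS; last exact: smooth_cst.
by rewrite IH Qop_cst CcoefS mulrC.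
Qed.

(** At t = 1 this is the Euler field, whose sign at a boundary maximum is read off along the ray. *)
Lemma is_derive_ray n p x t : polyf n p ->
  is_derive t (1 : R) (fun s => p (s *: x)) (\sum_(i < d) x 0 i * pd i p (t *: x)).
Proof.
elim=> {n p} [n c|n f g pf If pg Ig|n k f pf IH].
- apply: (is_derive_ext (is_derive_cst c t 1)) => //.
  by rewrite big1// => i _; rewrite partial_cst mulr0.
- apply: (is_derive_ext (is_deriveD If Ig)) => //.
  rewrite -big_split /=; apply: eq_bigr => i _.
  by rewrite (partialDs i (polyf_smooth pf) (polyf_smooth pg)) mulrDr.
- have Dk : is_derive t (1 : R) (fun s : R => s * x 0 k) (x 0 k).
    apply: (is_derive_ext (is_deriveM (is_derive_id t 1) (is_derive_cst (x 0 k) t 1))) => //.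
    by rewrite /GRing.scale /= mulr0 mulr1 add0r.
  apply: (is_derive_ext (is_deriveM Dk IH)).
    by move=> s; rewrite mulrfctE mxE.
  rewrite /GRing.scale /=.
  under [RHS]eq_bigr => i _ do rewrite (pd_coordM i k (polyf_smooth pf)) mulrDr mxE.
  rewrite big_split /= addrC; congr (_ + _).
    by rewrite mulr_sumr; apply: eq_bigr => i _; rewrite mulrCA.
  rewrite (bigD1 k)//= eqxx mul1r big1 ?addr0; first exact: mulrC.
  by move=> i /negbTE ->; rewrite mul0r mulr0.
Qed.

(** If the second derivative were positive at 0 it would stay so nearby, and two mean value theorems
    would produce a value above the maximum. *)
Lemma local_max_derive2 (g g1 g2 : R -> R) e : 0 < e ->
  (forall t : R, is_derive t (1 : R) g (g1 t)) ->
  (forall t : R, is_derive t (1 : R) g1 (g2 t)) -> continuous g2 ->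
  (forall t, `|t| < e -> g t <= g 0) -> g1 0 = 0 /\ g2 0 <= 0.
Proof.
move=> e0 dg dg1 cg2 gmax.
have cont (w dw : R -> R) a b : (forall s : R, is_derive s (1 : R) w (dw s)) ->
    {within `[a, b]%classic, continuous w}.
  move=> H; apply: continuous_subspaceT => s.
  by apply/differentiable_continuous/derivable1_diffP; have [] := H s.
have g10 : g1 0 = 0.
  have ee : - e <= e by lra.
  have i0 : (0 : R) \in `]- e, e[ by rewrite in_itv /= oppr_lt0 e0.
  have Hm t : t \in `]- e, e[ -> g t <= g 0 by rewrite in_itv /= -ltr_norml; exact: gmax.
  have [_ E] := @derive1_at_max _ g (- e) e 0 ee (fun t _ => @ex_derive _ _ _ _ _ _ _ (dg t)) i0 Hm.
  by have [_ <-] := dg 0.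
split => //; rewrite leNgt; apply/negP => g20.
have /cvgrPdist_lt/(_ _ g20)/nbhs_ballP[a a0 Ha] := cg2 0.
pose h := Num.min a e / 2.
have h0 : 0 < h by rewrite divr_gt0// lt_min a0.
have hh : h < Num.min a e by rewrite /h; have : 0 < Num.min a e by [rewrite lt_min a0]; lra.
move: hh; rewrite lt_min => /andP[ha he].
have [c] := MVT h0 (fun s _ => dg s) (cont _ _ _ _ dg).
rewrite in_itv /= subr0 => /andP[c0 ch] E1.
have [c' ] := MVT c0 (fun s _ => dg1 s) (cont _ _ _ _ dg1).
rewrite in_itv /= g10 !subr0 => /andP[c'0 c'c] E2.
have : `|g2 0 - g2 c'| < g2 0.
  apply: Ha; rewrite -ball_normE /= sub0r normrN gtr0_norm//.
  by apply: lt_trans c'c _; exact: lt_trans ch ha.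
rewrite ltr_norml => /andP[_ hpos].
have g2c : 0 < g2 c' by lra.
have : 0 < g h - g 0 by rewrite E1 E2; apply: mulr_gt0 => //; exact: mulr_gt0.
by rewrite subr_gt0 ltNge gmax// gtr0_norm.
Qed.

Lemma rho_scale (t : R) (x : V) : rho (t *: x) = 1 - t ^+ 2 * (1 - rho x).
Proof.
rewrite /rho opprB addrCA subrr addr0 mulr_sumr; congr (_ - _).
by apply: eq_bigr => i _; rewrite mxE exprMn.
Qed.

Lemma closed_ball_le f (b : R) x : continuous f -> (forall y, B y -> f y <= b) ->
  0 <= rho x -> f x <= b.
Proof.
move=> cf fb rx.
have H : f ((1 - n.+1%:R^-1) *: x) @[n --> \oo] --> f x.
  apply: (@continuous_cvg _ _ _ _ _ _ f _ (cf x)).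
  rewrite -[X in _ --> X]scale1r; apply: cvgZl.
  rewrite -[X in _ --> X](subr0 (1 : R)); apply: cvgB; first exact: cvg_cst.
  exact: cvg_harmonic.
rewrite -(cvg_lim _ H)//; apply: limr_le; first by apply/cvg_ex; eexists; exact: H.
apply: nearW => n; apply: fb; apply/unit_ballE; rewrite rho_scale subr_gt0.
have n0 : 0 < n.+1%:R^-1 :> R by rewrite invr_gt0 ltr0n.
have n1 : n.+1%:R^-1 <= 1 :> R by rewrite invf_le1 ?ltr0n// ler1n.
move: n0 n1; set e := (X in 1 - X) => n0 n1.
apply: le_lt_trans (_ : (1 - e) ^+ 2 < 1).
  by rewrite ler_piMr ?sqr_ge0// lerBlDr lerDl.
by rewrite expr_lt1 ?subr_ge0// ltrBlDr ltrDl.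
Qed.

(** Take a maximum of p on the closed ball. Inside, the gradient vanishes and the Laplacian is
    nonpositive; on the sphere rho removes the Laplacian and the radial derivative is nonnegative.
    Either way only the zero-order term of [Qop] remains as a lower bound, whatever the sign of
    p. *)
Lemma max_principle n k p : polyf n p -> exists2 x, 0 <= rho x &
  (forall y, B y -> p y <= p x) /\ qcoef k * p x <= Qop k p x.
Proof.
move=> pp; have sp := polyf_smooth pp; have cp := smooth_continuous sp.
pose K : set V := [set x | 0 <= rho x].
have cK : compact K.
  apply: (subclosed_compact _ (@compact_cube R d)); last by move=> x; exact: rho_ge0_cube.
  apply: (preimage_closed (f := @rho R d) (D := [set t : R | 0 <= t])); last exact: closed_ge.
  by move=> y _; exact: continuous_rho.
have K0 : K !=set0.
  by exists 0; rewrite /K /= /rho big1 ?subr0// => i _; rewrite mxE expr0n.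
have [x] := EVT_max_rV K0 cK (continuous_subspaceT cp).
rewrite inE => Kx xmax.
have xmax' y : 0 <= rho y -> p y <= p x by move=> ry; apply: xmax; rewrite inE.
exists x => //; split; first by move=> y /unit_ballE/ltW; exact: xmax'.
rewrite /Qop -subr_ge0 addrK.
move: Kx; rewrite /K /= le_eqVlt => /predU1P[r0|rx].
- rewrite -r0 mul0r oppr0 add0r mulr_ge0//.
  have D1 := is_derive_ray x 1 pp.
  rewrite scale1r -/(euler p x) in D1.
  have pray t : 0 <= t -> t <= 1 -> p (t *: x) <= p x.
    move=> t0 t1; apply: xmax'; rewrite rho_scale -r0 subr0 mulr1 subr_ge0.
    exact: exprn_ile1.
  rewrite leNgt; apply/negP => en.
  have [D1a D1b] := D1.
  have EH : (fun h : R => h^-1 *: (((fun s : R => p (s *: x)) \o shift 1) (h *: 1) - p (1 *: x))) =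
      (fun h => h^-1 * (p ((h + 1) *: x) - p x)).
    by apply/funext => h; rewrite /= [h *: 1]mulr1 scale1r.
  have H : (fun h : R => h^-1 * (p ((h + 1) *: x) - p x)) @ 0^' --> euler p x.
    by rewrite -EH -D1b; exact: D1a.
  have /cvgrPdist_lt/(_ (- euler p x)) := H.
  rewrite oppr_gt0 => /(_ en) [a /= a0 Ha].
  (* A negative step, short enough for the derivative estimate and for (1 + h) x to remain on the
     segment from 0 to x. *)
  pose h := - (Num.min a 1 / 2).
  have m0 : 0 < Num.min a 1 by rewrite lt_min a0 ltr01.
  have ma : Num.min a 1 <= a by rewrite ge_min lexx.
  have m1 : Num.min a 1 <= 1 by rewrite ge_min lexx orbT.
  have hn : h < 0 by rewrite /h; lra.
  have := Ha h; rewrite /ball /= sub0r normrN ltr0_norm// => /(_ _ _).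
  have h1 : - h < a by rewrite /h; lra.
  have h2 : h != 0 by rewrite lt_eqF.
  move=> /(_ h1 h2).
  have P0 : p ((h + 1) *: x) - p x <= 0 by rewrite subr_le0; apply: pray; rewrite /h; lra.
  have : 0 <= h^-1 * (p ((h + 1) *: x) - p x) by rewrite mulr_le0// invr_le0 ltW.
  by move=> hp; rewrite ltr_norml => /andP[hq _]; move: hp hq; lra.
- have loc i : pd i p x = 0 /\ pd i (pd i p) x <= 0.
    have : nbhs x ((@rho R d) @^-1` [set t | 0 < t]).
      by apply: continuous_rho; exact: (open_nbhs_nbhs (conj (@open_gt _ 0) rx)).
    move=> /nbhs_ballP[a a0 Ha].
    have spi := smooth_partial i sp.
    have := @local_max_derive2 (fun t : R => p (t *: delta_mx 0 i + x))
      (fun t : R => pd i p (t *: delta_mx 0 i + x))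
      (fun t : R => pd i (pd i p) (t *: delta_mx 0 i + x)) a a0.
    rewrite !scale0r !add0r; apply.
    + by move=> t; exact: is_derive_line_pd.
    + by move=> t; exact: is_derive_line_pd.
    + move=> t; apply/differentiable_continuous/derivable1_diffP.
      by have [] := is_derive_line_pd i x t (smooth_partial i spi).
    + move=> t ta; apply: xmax'; apply: ltW; apply: Ha; split => // j l.
      rewrite ord1 -ball_normE /= add_scale_delta opprD addrCA subrr addr0 normrN normrM.
      apply: le_lt_trans ta; rewrite ler_piMr//.
      by case: (_ == _); rewrite ?normr1 ?normr0 ?ler01.
  rewrite addr_ge0//.
    rewrite oppr_ge0; apply: mulr_ge0_le0; first exact: ltW.
    by apply: sumr_le0 => i _; exact: (loc i).2.
  rewrite /euler big1 ?mulr0// => i _.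
  by rewrite (loc i).1 mulr0.
Qed.

Lemma Qop_le n k p b : polyf n p -> (forall x, B x -> Qop k p x <= b) ->
  forall x, B x -> p x <= b / qcoef k.
Proof.
move=> pp Hb x Bx; have [y ry [Hy Hq]] := max_principle k pp.
apply: le_trans (Hy x Bx) _; rewrite ler_pdivlMr ?qcoef_gt0// mulrC.
apply: le_trans Hq _; apply: closed_ball_le Hb ry.
exact: smooth_continuous (polyf_smooth (polyf_Qop k pp)).
Qed.

Lemma Qop_norm_le n k p b : polyf n p -> (forall x, B x -> `|Qop k p x| <= b) ->
  forall x, B x -> `|p x| <= b / qcoef k.
Proof.
move=> pp Hb x Bx; rewrite ler_norml; apply/andP; split; last first.
  by apply: (Qop_le pp) => // y By; apply: le_trans (ler_norm _) (Hb y By).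
rewrite lerNl -mulN1r; apply: (Qop_le (polyfZ (-1) pp)) => // y By.
rewrite QopZ; last exact: polyf_smooth pp.
by rewrite mulN1r; apply: le_trans (ler_norm _) _; rewrite normrN; exact: Hb.
Qed.

(** The factors are peeled off from the outermost inwards, each dividing the bound by its value on
    constants. *)
Lemma Lop_norm_le n m p b : polyf n p -> (forall x, B x -> `|Lop m p x| <= b) ->
  forall x, B x -> `|p x| <= b / Ccoef m.
Proof.
move=> pp; elim: m b => [|m IH] b Hb.
  by move: Hb; rewrite Lop0 /Ccoef big_ord0 divr1.
move=> x Bx; rewrite CcoefS invfM mulrCA mulrC; apply: IH => // {x Bx}.
apply: (Qop_norm_le (polyf_Lop m pp)) => x Bx.
by rewrite -LopS; [exact: Hb|exact: polyf_smooth pp].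
Qed.

Lemma polyf_finite n : exists N (e : 'I_N -> V -> R), spans B (polyf n) e.
Proof.
suff [I [e [pe He]]] : exists (I : finType) (e : I -> V -> R), (forall i, polyf n (e i)) /\
    forall f, polyf n f -> exists a : I -> R, f = fun x => \sum_i a i * e i x.
  exists #|I|, (fun i => e (enum_val i)); split => [i|f /He[a ->]]; first exact: pe.
  exists (fun i => a (enum_val i)) => x _; rewrite /lin.
  by rewrite (reindex_onto enum_rank enum_val) /= => [|i _]; [|exact: enum_valK];
    apply: eq_big => i; rewrite ?enum_rankK ?eqxx.
have sumD (I : finType) (e : I -> V -> R) f g (a b : I -> R) :
    f = (fun x => \sum_i a i * e i x) -> g = (fun x => \sum_i b i * e i x) ->
    (fun x => f x + g x) = fun x => \sum_i (a i + b i) * e i x.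
  by move=> -> ->; apply/funext => x; rewrite -big_split /=; apply: eq_bigr => i _; rewrite mulrDl.
elim: n => [|n [I [e [pe He]]]].
  exists unit, (fun _ (_ : V) => 1); split; first by move=> _; exact: (polyf_cst 0 1).
  suff H k f : polyf k f -> k = 0%N -> exists a : unit -> R, f = fun x => \sum_i a i * 1.
    by move=> f pf; exact: (H 0%N f pf erefl).
  elim=> {k f} [n c|n f g _ If _ Ig n0|n i f _ _]//.
    by exists (fun=> c); apply/funext => x; rewrite (big_pred1 tt) ?mulr1// => -[].
  have [a Ha] := If n0; have [b Hb] := Ig n0; exists (fun i => a i + b i); exact: sumD.
(* Generators for the next degree: the old ones together with their products by a coordinate. *)
exists (I + 'I_d * I)%type, (fun u => match u with inl i => e i | inr (k, i) => fun x => x 0 k * e i x end).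
have inlE f : polyf n f -> exists a : I + 'I_d * I -> R, f = fun x => \sum_u a u *
    (match u with inl i => e i | inr (k, i) => fun x => x 0 k * e i x end) x.
  move=> /He[a ->]; exists (fun u => if u is inl i then a i else 0).
  apply/funext => x; rewrite big_sumType /= [X in _ + X]big1 ?addr0// => -[k i] _.
  by rewrite mul0r.
split; first by move=> [i|[k i]]; [exact: polyfS|exact: polyf_coordM].
suff H k f : polyf k f -> k = n.+1 -> exists a : I + 'I_d * I -> R, f = fun x => \sum_u a u *
    (match u with inl i => e i | inr (k, i) => fun x => x 0 k * e i x end) x.
  by move=> f pf; exact: (H n.+1 f pf erefl).
elim=> {k f} [n' c _|n' f g _ If _ Ig n0|n' k f pf _ [nn]].
- by apply: inlE; exact: polyf_cst.
- by have [a Ha] := If n0; have [b Hb] := Ig n0; exists (fun i => a i + b i); exact: sumD.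
- rewrite nn in pf; have [a ->] := He f pf.
  exists (fun u => if u is inr (l, i) then (if l == k then a i else 0) else 0).
  apply/funext => x; rewrite big_sumType /= [X in X + _]big1 ?add0r; last by move=> i _; rewrite mul0r.
  rewrite [RHS](eq_bigr (fun p : 'I_d * I => (if p.1 == k then a p.2 else 0) * (x 0 p.1 * e p.2 x))); last by case.
  rewrite -(pair_bigA _ (fun l i => (if l == k then a i else 0) * (x 0 l * e i x))) /=.
  rewrite [RHS](bigD1 k)//= [X in _ + X]big1 ?addr0.
    by rewrite mulr_sumr; apply: eq_bigr => i _; rewrite eqxx mulrCA.
  by move=> l /negbTE lk; rewrite big1// => i _; rewrite lk mul0r.
Qed.

Lemma polyf_lin n N (e : 'I_N -> V -> R) a : (forall i, polyf n (e i)) -> polyf n (lin e a).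
Proof. by move=> pe; apply: polyf_sum => i; exact: polyfZ. Qed.

Lemma Qop_lin n k N (e : 'I_N -> V -> R) a : (forall i, polyf n (e i)) ->
  Qop k (lin e a) = lin (fun i => Qop k (e i)) a.
Proof.
move=> pe; rewrite /lin; elim: (index_enum _) => [|i r IH].
  rewrite (_ : (fun x => _) = cst 0); last by apply/funext => x; rewrite big_nil.
  by rewrite Qop_cst mulr0; apply/funext => x; rewrite big_nil.
rewrite (_ : (fun x => _) = fun x => a i * e i x + \sum_(j <- r) a j * e j x); last first.
  by apply/funext => x; rewrite big_cons.
have se j := polyf_smooth (pe j).
rewrite QopD; [|exact: smoothZ|by apply: smooth_sum => j; exact: smoothZ].
by rewrite QopZ// IH; apply/funext => x; rewrite big_cons.
Qed.

Lemma Qop_surj n k f : polyf n f -> exists2 g, polyf n g & forall x, B x -> Qop k g x = f x.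
Proof.
apply: (surj_of_inj (D := B) (P := polyf n) (T := Qop k)).
- exact: polyf_lin.
- by move=> *; exact: Qop_lin.
- exact: polyf_Qop.
- move=> g pg gz x Bx; apply/eqP; rewrite -normr_le0.
  have := @Qop_norm_le n k g 0 pg _ x Bx; rewrite mul0r; apply => y By.
  by rewrite gz// normr0.
- exact: polyf_finite.
Qed.

Lemma pd_local f g i : (forall x, B x -> f x = g x) -> smth f ->
  forall x, B x -> pd i f x = pd i g x.
Proof.
move=> fg sf x Bx; apply/esym/partialE.
have nfg : \forall y \near x, f y = g y.
  have : nbhs x B by apply: open_nbhs_nbhs; split => //; exact: open_unit_ball.
  by apply: filterS.
exact: (near_eq_is_derive nfg (smooth_is_derive i x sf)).
Qed.

(** Surjectivity provides solutions up to equality on the ball; to compose the factors, each must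
    depend only on values in that open set. *)
Lemma Qop_local k f g : (forall x, B x -> f x = g x) -> smth f -> 
  forall x, B x -> Qop k f x = Qop k g x.
Proof.
move=> fg sf x Bx; rewrite /Qop fg//; congr (- (_ * _) + _ * _ + _).
  apply: eq_bigr => i _; apply: pd_local => //; last exact: smooth_partial.
  exact: pd_local.
by apply: eq_bigr => i _; congr (_ * _); exact: pd_local.
Qed.

Lemma Lop_surj n m f : polyf n f -> exists2 g, polyf n g & forall x, B x -> Lop m g x = f x.
Proof.
elim: m f => [|m IH] f pf; first by exists f => // x _; rewrite Lop0.
have [h ph Hh] := Qop_surj m pf; have [g pg Hg] := IH h ph.
exists g => // x Bx; rewrite LopS; last exact: polyf_smooth pg.
by rewrite -Hh//; apply: Qop_local => //; exact: polyf_smooth (polyf_Lop m pg).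
Qed.

(* Since |p| <= sup |L p| / C, the identity int u L p = lam int u rho^m p improves
   any bound |int u q| <= S sup |q| to the factor lam / C. *)
Theorem eigenvalue_ge_core m u lam : sqint mu B u -> 0 <= lam -> lam < Ccoef m ->
  (forall p, is_polyf p -> ip mu B u (Lop m p) = lam * ip mu B u (fun x => p x * rho x ^+ m)) ->
  ae_eq mu B u (cst 0).
Proof.
move=> su l0 lC Hu; have C0 := Ccoef_gt0 m.
have Iu := sqint_integrable mB unit_ball_lty su.
pose S := \int[mu]_(x in B) `|u x|.
have spf q : is_polyf q -> sqint mu B q.
  by move=> [n pq]; exact: smooth_sqint (polyf_smooth pq).
have S0 : 0 <= S by apply: Rintegral_ge0.
have base q b : sqint mu B q -> (forall x, B x -> `|q x| <= b) -> `|ip mu B u q| <= S * b.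
  move=> sq qb; have Iuq := sqint_mul mB su sq.
  apply: le_trans (le_normr_Rintegral mB Iuq) _.
  rewrite -RintegralZr//; last exact: integrable_norm.
  apply: le_Rintegral => //.
  - by apply: (@integrable_norm _ _ _ _ _ (fun x => u x * q x)).
  - rewrite (_ : _ \o _ = (fun x => b%:E * (`|u x|)%:E)%E); last first.
      by apply/funext => x /=; rewrite -EFinM mulrC.
    by apply: (integrableZl mB); exact: integrable_norm Iu.
  - by move=> x Bx; rewrite normrM ler_wpM2l// qb.
have key N : forall q n b, polyf n q -> (forall x, B x -> `|q x| <= b) ->
    `|ip mu B u q| <= (lam / Ccoef m) ^+ N * S * b.
  elim: N => [|N IH] q n b pq qb.
    by rewrite expr0 mul1r; apply: base => //; apply: spf; exists n.
  (* Solving L p = q trades q for p rho^m, again a polynomial but of larger degree; this is why the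
     claim ranges over all degrees at each N. *)
  have [p pp Lp] := Lop_surj m pq.
  have pC x : B x -> `|p x| <= b / Ccoef m.
    by apply: (Lop_norm_le pp) => y By; rewrite Lp//; exact: qb.
  have -> : ip mu B u q = lam * ip mu B u (fun x => p x * rho x ^+ m).
    rewrite -Hu; last by exists n.
    by apply: eq_Rintegral => x; rewrite inE => Bx; rewrite Lp.
  have [k pk] : is_polyf (fun x : V => p x * rho x ^+ m).
    apply: is_polyfM; first by exists n.
    apply: is_polyfX; apply: is_polyfD; first exact: is_polyf_cst.
    rewrite (_ : (fun x => _) = fun x : V => -1 * \sum_(i < d) x 0 i ^+ 2); last first.
      by apply/funext => x; rewrite mulN1r.
    apply: is_polyfM; first exact: is_polyf_cst.
    exists 2%N; apply: polyf_sum => i.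
    rewrite (_ : (fun x => _) = fun x : V => x 0 i * x 0 i); last first.
      by apply/funext => x; rewrite expr2.
    exact: (polyfM (polyf_coord i) (polyf_coord i)).
  have bk x : B x -> `|p x * rho x ^+ m| <= b / Ccoef m.
    move=> Bx; have r0 : 0 <= rho x by move/unit_ballE : Bx => /ltW.
    rewrite normrM; apply: le_trans (pC x Bx); rewrite ler_piMr// normrX ger0_norm//.
    by apply: exprn_ile1 => //; exact: rho_le1.
  rewrite normrM (ger0_norm l0); apply: le_trans (ler_wpM2l l0 (IH _ _ _ pk bk)) _.
  rewrite le_eqVlt; apply/orP; left; apply/eqP; rewrite exprS.
  by ring.
apply: (orthogonal_polyf su) => q [n pq].
have [b qb] := continuous_bounded_ball (smooth_continuous (polyf_smooth pq)).
apply/eqP; rewrite -normr_le0.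
have H : ((lam / Ccoef m) ^+ N * S * b) @[N --> \oo] --> (0 : R).
  rewrite -(mul0r b) -(mul0r S); apply: cvgM; last exact: cvg_cst.
  apply: cvgM; last exact: cvg_cst; apply: cvg_expr.
  by rewrite ger0_norm ?divr_ge0 ?(ltW C0)// ltr_pdivrMr// mul1r.
rewrite -(cvg_lim _ H)//; apply: limr_ge; first by apply/cvg_ex; eexists; exact: H.
by apply: nearW => N; exact: (key N q n b pq qb).
Qed.

End polyharmonic_on_polynomials.

(** * Energy estimates and compactness *)

Section energy.
Context {R : realType} {d : nat}.
Hypothesis d_gt0 : (0 < d)%N.
Local Notation V := 'rV[R]_d.
Local Notation B := (unit_ball R d).
Local Notation mu := (@lebesgue_rV R d).
Let mB : measurable B := measurable_unit_ball.
Implicit Types (f g : V -> R).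
Local Notation "<< f , g >>" := (ip mu B f g).

(* int nabla^k f . nabla^k g, integrated by parts *)
Definition energy k f g : R := (-1) ^+ k * << f, iter k lap g >>.

Lemma energy0 f : energy 0 f f = nsq mu B f.
Proof. by rewrite /energy expr0 mul1r ipff. Qed.

Lemma energyC k f g : testf f -> testf g -> energy k f g = energy k g f.
Proof.
move=> tf tg; rewrite /energy ipC -ip_lapn//; last exact: testf_smooth.
Qed.

Lemma energyDl k f g h : testf f -> testf g -> testf h ->
  energy k (fun x => f x + g x) h = energy k f h + energy k g h.
Proof.
move=> tf tg th; rewrite /energy ipDl ?mulrDr//; try exact: testf_sqint.
exact/testf_sqint/testf_lapn.
Qed.

Lemma energyZl k c f h : testf f -> testf h ->
  energy k (fun x => c * f x) h = c * energy k f h.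
Proof.
move=> tf th; rewrite /energy ipZl 1?mulrCA//; first exact: testf_sqint.
exact/testf_sqint/testf_lapn.
Qed.

Lemma energy_quad k f g t : testf f -> testf g ->
  energy k (fun x => f x + t * g x) (fun x => f x + t * g x) =
  energy k f f + 2 * t * energy k f g + t ^+ 2 * energy k g g.
Proof.
move=> tf tg; have tz := testfZ t tg; have ts := testfD tf tz.
rewrite (energyDl k tf tz ts) (energyC k tf ts) (energyC k tz ts).
rewrite (energyDl k tf tz tf) (energyDl k tf tz tz) (energyZl k t tg tf).
rewrite (energyC k tf tz) (energyZl k t tg tf) (energyZl k t tg tz).
by rewrite (energyC k tg tz) (energyZl k t tg tg) (energyC k tg tf); ring.
Qed.

Lemma energyS_smooth k f g : testf f -> smth g ->
  energy k.+1 f g = \sum_(i < d) energy k (pd i f) (pd i g).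
Proof.
move=> tf sg; have sl := smooth_lapn k sg.
rewrite /energy -mulr_sumr exprS mulN1r mulNr -mulrN; congr (_ * _).
rewrite ipC /= {1}/lap ip_suml//; last first.
- exact: testf_sqint.
- by move=> i; apply: smooth_sqint; do 2 apply: smooth_partial.
rewrite -sumrN; apply: eq_bigr => i _.
rewrite ipC -ip_pd//; last exact: smooth_partial.
by rewrite partial_lapn.
Qed.

Lemma energyS k f g : testf f -> testf g ->
  energy k.+1 f g = \sum_(i < d) energy k (pd i f) (pd i g).
Proof. by move=> tf /testf_smooth; exact: energyS_smooth. Qed.

Lemma energy_ge0 k f : testf f -> 0 <= energy k f f.
Proof.
elim: k f => [|k IH] f tf; first by rewrite energy0 nsq_ge0.
by rewrite energyS// sumr_ge0// => i _; apply: IH; exact: testf_pd.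
Qed.

(** Integrating the derivative of x_i f^2 gives int f^2 = -2 int x_i f d_i f; Cauchy-Schwarz and
    |x_i| <= 1 finish, with 4 the square of that 2. *)
Lemma poincare f i : testf f -> nsq mu B f <= 4 * nsq mu B (pd i f).
Proof.
move=> tf; have sf := testf_smooth tf.
have sxf := smoothM (smooth_coord i) sf.
have spf := smooth_partial i sf.
have ssf := smooth_sqint sf; have ssx := smooth_sqint sxf; have ssp := smooth_sqint spf.
have sxp := smooth_sqint (smoothM (smooth_coord i) spf).
have E : nsq mu B f = - 2 * << pd i f, fun x => coord i x * f x >>.
  have := ip_pd i tf sxf.
  rewrite (pd_coordM i i sf) eqxx.
  have -> : << f, fun x : V => 1 * f x + x 0 i * pd i f x >> =
      nsq mu B f + << pd i f, fun x => coord i x * f x >>.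
    rewrite ipC; under [LHS]eq_Rintegral do rewrite mul1r.
    rewrite -/(ip mu B (fun x : V => f x + x 0 i * pd i f x) f) ipDl// ipff; congr (_ + _).
    by apply: eq_Rintegral => x _; rewrite /coord; ring.
  by lra.
have le1 : nsq mu B (fun x => coord i x * f x) <= nsq mu B f.
  apply: le_Rintegral => //; [exact: (proj2 ssx)|exact: (proj2 ssf)|].
  move=> x /unit_ball_cube/(_ i) h; rewrite exprMn ler_piMl ?sqr_ge0//.
  by rewrite /coord -real_normK ?num_real// exprn_ile1.
have CS := ip_cauchy_schwarz mB ssp ssx.
have n0 := nsq_ge0 mu B f; have p0 := nsq_ge0 mu B (pd i f).
have [->|nz] := eqVneq (nsq mu B f) 0; first by rewrite mulr_ge0.
have npos : 0 < nsq mu B f by rewrite lt_neqAle eq_sym nz.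
rewrite -(ler_pM2r npos) -expr2 {1}E exprMn -mulrA.
rewrite (_ : (- 2) ^+ 2 = 4); last by rewrite sqrrN -natrX.
by rewrite ler_pM2l//; apply: le_trans CS _; exact: ler_wpM2l.
Qed.

Lemma energy_poincare k f : testf f -> energy k f f <= 4 * energy k.+1 f f.
Proof.
elim: k f => [|k IH] f tf.
  rewrite energyS// energy0 (bigD1 (Ordinal d_gt0))//= energy0 mulrDr.
  apply: le_trans (poincare (Ordinal d_gt0) tf) _; rewrite lerDl mulr_ge0// sumr_ge0// => i _.
  by apply: energy_ge0; exact: testf_pd.
rewrite energyS// [in leRHS]energyS// mulr_sumr; apply: ler_sum => i _.
by apply: IH; exact: testf_pd.
Qed.

Lemma energy_le k m f : testf f -> (k <= m)%N -> energy k f f <= 4 ^+ (m - k) * energy m f f.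
Proof.
move=> tf /subnKC <-; rewrite addKn; elim: (m - k)%N => [|n IH].
  by rewrite expr0 mul1r addn0.
apply: le_trans IH _; rewrite exprSr -mulrA ler_pM2l ?exprn_gt0//.
by rewrite addnS energy_poincare.
Qed.

(** The energy is a sum of nonnegative terms over directions; at each letter of the word only its
    own direction is kept. *)
Lemma nsq_pds_le s f : testf f -> nsq mu B (pds s f) <= energy (size s) f f.
Proof.
elim/last_ind: s f => [|s i IH] f tf; first by rewrite energy0.
rewrite size_rcons energyS// (bigD1 i)//= /pds foldr_rcons -/(pds _ _).
apply: le_trans (IH _ (testf_pd i tf)) _; rewrite lerDl sumr_ge0// => j _.
by apply: energy_ge0; exact: testf_pd.
Qed.

Lemma nsq_pds_le_energy m s f : testf f -> (size s <= m)%N ->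
  nsq mu B (pds s f) <= 4 ^+ m * energy m f f.
Proof.
move=> tf sm; apply: le_trans (nsq_pds_le s tf) _.
apply: le_trans (energy_le tf sm) _.
by rewrite ler_wpM2r ?energy_ge0// ler_weXn2l ?leq_subr// ler1n.
Qed.

(** Cauchy-Schwarz for the nonnegative form energy - c nsq. With c the infimum, the factor of a
    minimizing sequence tends to 0, which yields the weak equation. *)
Lemma energy_cauchy_schwarz k f g c : testf f -> testf g ->
  (forall h, testf h -> c * nsq mu B h <= energy k h h) ->
  (energy k f g - c * << f, g >>) ^+ 2 <=
  (energy k f f - c * nsq mu B f) * (energy k g g - c * nsq mu B g).
Proof.
move=> tf tg Hc; apply: discriminant_le0 => t.
have := Hc _ (testfD tf (testfZ t tg)); rewrite -subr_ge0.
rewrite energy_quad// nsqD//; [|exact: testf_sqint|exact/testf_sqint/testfZ].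
rewrite ipC ipZl//; [|exact: testf_sqint..].
rewrite nsqZ//; last exact: testf_sqint.
by rewrite (ipC _ _ g f); congr (_ <= _); ring.
Qed.

Lemma sup_bound_pds f x : testf f -> f x ^+ 2 <= 4 ^+ d * nsq mu B (pds (all_dirs d) f).
Proof.
move=> tf; have sf := testf_smooth tf; have cf := testf_cube_supp tf.
have tp := testf_pds (all_dirs d) tf.
rewrite -lee_fin [leRHS]EFinM; apply: le_trans (sqr_le_all_dirs x sf cf) _.
apply: lee_wpmul2l; first by rewrite lee_fin exprn_ge0.
have tp2 : testf (fun x => pds (all_dirs d) f x ^+ 2).
  rewrite (_ : (fun x => _) = fun x => pds (all_dirs d) f x * pds (all_dirs d) f x).
    by apply: testf_mul => //; exact: testf_smooth.
  by apply/funext => y; rewrite expr2.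
have I2 := cube_supp_integrable (smooth_continuous (testf_smooth tp2)) (testf_cube_supp tp2).
rewrite /nsq (testf_integral tp2) /Rintegral fineK//.
exact: (integrable_fin_num measurableT I2).
Qed.

Lemma sup_bound f x : testf f -> f x ^+ 2 <= 4 ^+ d * energy d f f.
Proof.
move=> tf; apply: le_trans (sup_bound_pds x tf) _.
rewrite ler_pM2l ?exprn_gt0//; apply: le_trans (nsq_pds_le _ tf) _.
by rewrite size_all_dirs.
Qed.

(** The gradient costs one derivative more than the function, which is where the condition d < m
    comes from. *)
Lemma sup_bound_pd f i x : testf f -> pd i f x ^+ 2 <= 4 ^+ d * energy d.+1 f f.
Proof.
move=> tf; apply: le_trans (sup_bound x (testf_pd i tf)) _.
rewrite ler_pM2l ?exprn_gt0// energyS// (bigD1 i)//= lerDl sumr_ge0// => j _.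
by apply: energy_ge0; exact: testf_pd.
Qed.

Lemma lipschitz_of_pd f (M e : R) (x y : V) : smth f -> (forall i z, `|pd i f z| <= M) ->
  (forall i, `|x 0 i - y 0 i| <= e) -> `|f x - f y| <= M * e *+ d.
Proof.
move=> sf HM xy.
have M0 : 0 <= M by apply: le_trans (HM (Ordinal d_gt0) 0).
(* A path from y to x that changes one coordinate at a time, so that only partial derivatives are
   needed. *)
pose z k : V := \row_i (if (i < k)%N then x 0 i else y 0 i).
have step k : (k <= d)%N -> `|f (z k) - f y| <= M * e *+ k.
  elim: k => [|k IH] kd.
    by rewrite (_ : z 0%N = y) ?subrr ?normr0//; apply/rowP => i; rewrite mxE.
  have -> : f (z k.+1) - f y = (f (z k.+1) - f (z k)) + (f (z k) - f y) by rewrite addrA subrK.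
  rewrite mulrSr addrC; apply: le_trans (ler_normD _ _) _.
  apply: lerD; first exact: IH (ltnW kd).
  pose i := Ordinal kd; pose t := x 0 i - y 0 i.
  have zk : z k.+1 = t *: delta_mx 0 i + z k.
    apply/rowP => j; rewrite add_scale_delta !mxE ltnS leq_eqVlt.
    have [->|ji] := eqVneq j i; first by rewrite eqxx ltnn /= mulr1 /t subrK.
    by rewrite mulr0 add0r -[(j : nat) == k]/(j == i) (negbTE ji).
  pose g (s : R) := f (s *: delta_mx 0 i + z k).
  have dg s : is_derive s (1 : R) g (pd i f (s *: delta_mx 0 i + z k)) by exact: is_derive_line_pd.
  have cg a b : {within `[a, b]%classic, continuous g}.
    apply: continuous_subspaceT => s.
    apply: differentiable_continuous; apply/derivable1_diffP; exact: (@ex_derive _ _ _ _ _ _ _ (dg s)).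
  have g0 : g 0 = f (z k) by rewrite /g scale0r add0r.
  have gt : g t = f (z k.+1) by rewrite /g zk.
  rewrite -gt -g0.
  have [t0|t0] := leP 0 t.
    have [c _ ->] := MVT_segment t0 (fun s _ => dg s) (cg _ _).
    by rewrite normrM subr0; apply: ler_pM => //; exact: xy.
  have [c _ E] := MVT_segment (ltW t0) (fun s _ => dg s) (cg _ _).
  by rewrite distrC E normrM sub0r normrN; apply: ler_pM => //; exact: xy.
have -> : x = z d by apply/rowP => i; rewrite mxE ltn_ord.
exact: step.
Qed.

Lemma grid N (x : V) : cube x -> exists c : {ffun 'I_d -> 'I_(2 * N.+1).+1},
  forall i, `|x 0 i - (-1 + (c i)%:R / N.+1%:R)| <= N.+1%:R^-1.
Proof.
move=> cx; have n0 : 0 < N.+1%:R :> R by rewrite ltr0n.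
pose k i := Num.truncn ((x 0 i + 1) * N.+1%:R).
have xi i : 0 <= (x 0 i + 1) * N.+1%:R <= (2 * N.+1)%:R.
  have := cx i; rewrite ler_norml => /andP[h1 h2].
  rewrite natrM; apply/andP; split; first by rewrite mulr_ge0//; lra.
  by rewrite ler_pM2r//; lra.
have kl i : (k i < (2 * N.+1).+1)%N.
  have /andP[h1 h2] := xi i.
  rewrite ltnS -(ler_nat R); apply: le_trans h2.
  by rewrite truncn_le.
exists [ffun i => Ordinal (kl i)] => i; rewrite ffunE /=.
have /andP[h1 _] := xi i.
have /andP[t1 t2] := truncn_itv h1.
have -> : x 0 i - (-1 + (k i)%:R / N.+1%:R) = ((x 0 i + 1) * N.+1%:R - (k i)%:R) / N.+1%:R.
  by rewrite mulrBl mulfK ?pnatr_eq0// opprD opprK addrA.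
rewrite normrM [X in _ * X]ger0_norm ?invr_ge0 ?(ltW n0)//.
rewrite ler_piMl ?invr_ge0 ?(ltW n0)// ger0_norm ?subr_ge0//.
by rewrite lerBlDr nat1r ltW.
Qed.

(** An ultrafilter on a compact segment has a cluster point, and for an ultrafilter a cluster point
    is a limit. *)
Lemma ultra_limit (U : set_system nat) (a : nat -> R) M : UltraFilter U ->
  (forall k, `|a k| <= M) -> exists l : R, a @ U --> l.
Proof.
move=> UU aM.
have KU : (a @ U) `[- M, M]%classic.
  apply: (@filterS _ U _ setT) => [k _|]; last exact: filterT.
  by rewrite /= in_itv /= -ler_norml.
have [l [_ Hl]] := @segment_compact R (- M) M (a @ U) _ KU.
exists l => A Al /=.
have [//|UA] := in_ultra_setVsetC (a @^-1` A) UU.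
by have [x [/= nAx Ax]] := Hl (~` A) A UA Al.
Qed.

Lemma filter_finset (U : set_system nat) (I : finType) (P : I -> set nat) : Filter U ->
  (forall i, U (P i)) -> U [set k | forall i, P i k].
Proof.
move=> FU UP.
suff H (s : seq I) : U [set k | forall i, i \in s -> P i k].
  by apply: (filterS _ (H (enum I))) => k Hk i; apply: Hk; rewrite mem_enum.
elim: s => [|i s IH]; first by apply: (filterS _ (@filterT _ U _)).
apply: (filterS _ (filterI (UP i) IH)) => k [Pi Hs] j.
by rewrite inE => /predU1P[->|/Hs].
Qed.

(** Along one ultrafilter refining infinity, limits exist at all points at once, which replaces
    diagonal extraction. The index [n j] is chosen so that the first j + 1 grids are already within
    tolerance, and the gradient bound covers the gaps. *)
Theorem compactness (F : nat -> V -> R) M : (forall k, testf (F k)) ->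
  (forall k x, `|F k x| <= M) -> (forall k i x, `|pd i (F k) x| <= M) ->
  exists n : nat -> nat, (forall j, (j <= n j)%N) /\
    forall e, 0 < e -> exists N, forall j l, (N <= j)%N -> (N <= l)%N ->
      forall x, `|F (n j) x - F (n l) x| <= e.
Proof.
move=> tF FM dFM.
have [U [UU Uoo]] := @ultraFilterLemma nat \oo _.
have /choice[L HL] : forall x, exists l : R, (F ^~ x) @ U --> l.
  by move=> x; apply: ultra_limit => k; exact: FM.
pose pt N (c : {ffun 'I_d -> 'I_(2 * N.+1).+1}) : V := \row_i (-1 + (c i)%:R / N.+1%:R).
pose good N : set nat := [set k | forall c, `|F k (@pt N c) - L (pt N c)| <= N.+1%:R^-1].
have Ugood N : U (good N).
  apply: filter_finset => c; have e0 : 0 < N.+1%:R^-1 :> R by rewrite invr_gt0 ltr0n.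
  have /cvgrPdist_le/(_ _ e0) := HL (pt N c).
  by apply: filterS => k; rewrite distrC.
have Ugoods j : U [set k | forall i : 'I_j.+1, good i k].
  by apply: filter_finset => i; exact: Ugood.
have /choice[n Hn] : forall j, exists k, (j <= k)%N /\ forall i : 'I_j.+1, good i k.
  move=> j; have Uj : U [set k | (j <= k)%N] by apply: Uoo; exists j.
  by have [k [? ?]] := filter_ex (filterI Uj (Ugoods j)); exists k.
exists n; split=> [j|e e0]; first by have [] := Hn j.
have M0 : 0 <= M by apply: le_trans (FM 0%N 0).
(* Two displacements to the grid, each costing M d / (N + 1), and two distances to the limit, each
   at most 1 / (N + 1). *)
pose K := 2 * M *+ d + 2.
have K0 : 0 < K by rewrite /K ltr_wpDl// mulrn_wge0// mulr_ge0.
have [N HN] : exists N : nat, K / N.+1%:R <= e.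
  exists (Num.truncn (K / e)); rewrite ler_pdivrMr ?ltr0n// mulrC -ler_pdivrMr//.
  by rewrite ltW// truncnS_gt.
exists N => j l Nj Nl x; apply: le_trans HN.
have [cx|ncx] := pselect (cube x); last first.
  have z k : F k x = 0 by have [//|/(testf_cube_supp (tF k))] := eqVneq (F k x) 0.
  by rewrite !z subrr normr0 divr_ge0// ltW.
have [c Hc] := grid N cx; pose p := pt N c.
have xp i : `|x 0 i - p 0 i| <= N.+1%:R^-1 by rewrite mxE.
have lip k := lipschitz_of_pd (testf_smooth (tF k)) (dFM k) xp.
have gp k : (N <= k)%N -> `|F (n k) p - L p| <= N.+1%:R^-1.
  by move=> Nk; have [_ H] := Hn k; exact: (H (Ordinal (Nk : (N < k.+1)%N)) c).
have -> : F (n j) x - F (n l) x = (F (n j) x - F (n j) p) + (F (n j) p - L p)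
   - (F (n l) p - L p) - (F (n l) x - F (n l) p) by ring.
have a1 := lip (n j); have a2 := lip (n l); have a3 := gp j Nj; have a4 := gp l Nl.
apply: le_trans (ler_normB _ _) _; apply: le_trans (lerD (ler_normB _ _) (lexx _)) _.
apply: le_trans (lerD (lerD (ler_normD _ _) (lexx _)) (lexx _)) _.
have -> : K / N.+1%:R = M * N.+1%:R^-1 *+ d + N.+1%:R^-1 + N.+1%:R^-1 + M * N.+1%:R^-1 *+ d.
  rewrite /K -[2 * M *+ d]mulr_natr -[M * _ *+ d]mulr_natr.
  by move: (d%:R : R) (N.+1%:R^-1 : R) => a b; ring.
by rewrite !lerD.
Qed.

End energy.

(** * Minimizing sequences for the Rayleigh quotient *)

Section minimizer.
Context {R : realType} {d : nat}.
Hypothesis d_gt0 : (0 < d)%N.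
Local Notation V := 'rV[R]_d.
Local Notation B := (unit_ball R d).
Local Notation mu := (@lebesgue_rV R d).
Let mB : measurable B := measurable_unit_ball.
Implicit Types (f g : V -> R).

(** The pointwise bound [sup_bound_pds] read backwards: a test function nonzero at the origin has a
    mixed derivative of positive norm. *)
Lemma testf_nsq_gt0 : exists2 h : V -> R, testf h & 0 < nsq mu B h.
Proof.
pose f : V -> R := cutoff 0 (cst 1) 1; have tf : testf f by apply: testf_cutoff; exact: smooth_cst.
exists (pds (all_dirs d) f); first exact: testf_pds.
have tp := testf_pds (all_dirs d) tf.
have f0 : f 0 != 0.
  have r0 : rho (0 : V) = 1.
    by rewrite /rho big1 ?subr0// => i _; rewrite mxE expr0n.
  rewrite /f /cutoff /flat_tower r0 ifT; last by rewrite invf_lt1// ltr1n.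
  by rewrite /= mul1r hornerC !expr0 !mul1r gt_eqF// expR_gt0.
have := sup_bound_pds 0 tf.
have : 0 < f 0 ^+ 2 by rewrite exprn_even_gt0.
move=> /lt_le_trans /[apply]; by rewrite pmulr_rgt0 ?exprn_gt0.
Qed.

Lemma nsq_le_sup f e : sqint mu B f -> 0 <= e -> (forall x, `|f x| <= e) ->
  nsq mu B f <= fine (mu B) * e ^+ 2.
Proof.
move=> sf e0 He; rewrite mulrC.
have fB := @unit_ball_lty R d.
have -> : e ^+ 2 * fine (mu B) = \int[mu]_(x in B) cst (e ^+ 2) x by rewrite Rintegral_cst.
apply: le_Rintegral => //; first exact: (proj2 sf).
  apply: (@bounded_integrable _ _ _ _ _ mB fB _ (e ^+ 2)) => [|x _]; first exact: measurable_cst.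
  by rewrite /= ger0_norm// sqr_ge0.
by move=> x _; rewrite /= -real_normK ?num_real// lerXn2r// nnegrE.
Qed.

Lemma energyB k f g : testf f -> testf g ->
  energy k (fun x => f x - g x) (fun x => f x - g x) =
  2 * energy k f f + 2 * energy k g g - energy k (fun x => f x + g x) (fun x => f x + g x).
Proof.
move=> tf tg; have := energy_quad k (-1) tf tg; have := energy_quad k 1 tf tg.
have -> : (fun x : V => f x + 1 * g x) = fun x => f x + g x by apply/funext => x; rewrite mul1r.
have -> : (fun x : V => f x + -1 * g x) = fun x => f x - g x by apply/funext => x; rewrite mulN1r.
by move=> -> ->; ring.
Qed.

(** The infimum runs over test functions, where the energy is an explicit integral;
    [rayleigh_le_nabla] carries the inequality over to H^m_0. *)
Definition rayleigh_inf m : R :=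
  inf [set energy m f f | f in [set f : V -> R | testf f /\ nsq mu B f = 1]].

Let E m := [set energy m f f | f in [set f : V -> R | testf f /\ nsq mu B f = 1]].

Let scale f : testf f -> 0 < nsq mu B f ->
  nsq mu B (fun x => (Num.sqrt (nsq mu B f))^-1 * f x) = 1.
Proof.
move=> tf nf; rewrite nsqZ//; last exact: testf_sqint.
by rewrite exprVn sqr_sqrtr ?ltW// mulVf// gt_eqF.
Qed.

Let has_infE m : has_inf (E m).
Proof.
split.
  have [h th nh] := testf_nsq_gt0.
  pose f x := (Num.sqrt (nsq mu B h))^-1 * h x.
  by exists (energy m f f); exists f => //; split; [exact: testfZ|exact: scale].
by exists 0 => _ [f [tf _] <-]; exact: energy_ge0.
Qed.

Lemma rayleigh_inf_ge0 m : 0 <= rayleigh_inf m.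
Proof.
apply: lb_le_inf; first by have [] := has_infE m.
by move=> _ [f [tf _] <-]; exact: energy_ge0.
Qed.

Lemma rayleigh_inf_le m f : testf f -> rayleigh_inf m * nsq mu B f <= energy m f f.
Proof.
move=> tf; have := nsq_ge0 mu B f; rewrite le_eqVlt => /orP[/eqP <-|nf].
  by rewrite mulr0 energy_ge0.
have : rayleigh_inf m <= (nsq mu B f)^-1 * energy m f f.
  apply: ge_inf; first by have [] := has_infE m.
  exists (fun x => (Num.sqrt (nsq mu B f))^-1 * f x).
    by split; [exact: testfZ|exact: scale].
  have tz := testfZ (Num.sqrt (nsq mu B f))^-1 tf.
  rewrite (energyZl m _ tf tz) (energyC m tf tz) (energyZl m _ tf tf) mulrA -expr2.
  by rewrite exprVn sqr_sqrtr// ltW.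
by rewrite [X in _ <= X -> _]mulrC ler_pdivlMr.
Qed.

(** Bounded energy gives bounded values and gradients, hence a uniformly Cauchy subsequence, which
    is Cauchy in L2. The parallelogram identity, with the infimum bounding the energy of sums from
    below, upgrades this to Cauchy in energy. *)
Theorem minimizing_sequence m : (d < m)%N -> exists G : nat -> V -> R,
  [/\ forall j, testf (G j), forall j, nsq mu B (G j) = 1,
    energy m (G j) (G j) @[j --> \oo] --> rayleigh_inf m,
    forall e, 0 < e -> exists N, forall j l, (N <= j)%N -> (N <= l)%N ->
      nsq mu B (fun x => G j x - G l x) <= e &
    forall e, 0 < e -> exists N, forall j l, (N <= j)%N -> (N <= l)%N ->
      energy m (fun x => G j x - G l x) (fun x => G j x - G l x) <= e].
Proof.
move=> dm; set lam := rayleigh_inf m.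
have l0 : 0 <= lam by exact: rayleigh_inf_ge0.
have /choice[F HF] : forall k : nat, exists f : V -> R,
    [/\ testf f, nsq mu B f = 1 & energy m f f < lam + k.+1%:R^-1].
  move=> k; have e0 : 0 < k.+1%:R^-1 :> R by rewrite invr_gt0 ltr0n.
  by have [_ [f [tf nf] <-] He] := inf_adherent e0 (has_infE m); exists f.
have tF k : testf (F k) by have [] := HF k.
have EF k : energy m (F k) (F k) <= lam + 1.
  have [_ _ /ltW/le_trans] := HF k; apply; rewrite lerD2l.
  by rewrite invf_le1 ?ler1n ?ltr0n.
(* A bound for squares of values and first derivatives: 4^d from the Sobolev estimate, 4^m from
   lowering the order of the energy, lam + 1 from the choice of [F]. *)
pose K := 4 ^+ d * (4 ^+ m * (lam + 1)) : R.
have EK k n : (n <= m)%N -> 4 ^+ d * energy n (F k) (F k) <= K.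
  move=> nm; rewrite ler_pM2l ?exprn_gt0//; apply: le_trans (energy_le d_gt0 (tF k) nm) _.
  apply: ler_pM; [by rewrite exprn_ge0|exact: energy_ge0| |exact: EF].
  by rewrite ler_weXn2l ?leq_subr// ler1n.
have sqb (a : R) : a ^+ 2 <= K -> `|a| <= 1 + K.
  move=> h; have n0 := normr_ge0 a; rewrite -real_normK ?num_real// in h.
  have := sqr_ge0 (`|a| - 1); rewrite sqrrB; lra.
have FK k x : `|F k x| <= 1 + K.
  by apply: sqb; apply: le_trans (sup_bound x (tF k)) (EK _ _ (ltnW dm)).
have dFK k i x : `|pd i (F k) x| <= 1 + K.
  by apply: sqb; apply: le_trans (sup_bound_pd i x (tF k)) (EK _ _ dm).
have [n [jn Hn]] := compactness d_gt0 tF FK dFK.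
pose G j := F (n j).
have tG j : testf (G j) by exact: tF.
have nG j : nsq mu B (G j) = 1 by have [] := HF (n j).
have EG j : energy m (G j) (G j) <= lam + j.+1%:R^-1.
  have [_ _ /ltW/le_trans] := HF (n j); apply; rewrite lerD2l.
  by rewrite lef_pV2 ?posrE ?ltr0n// ler_nat ltnS.
have EG' j : lam <= energy m (G j) (G j).
  by have := rayleigh_inf_le m (tG j); rewrite nG mulr1.
have CG e : 0 < e -> exists N, forall j l, (N <= j)%N -> (N <= l)%N ->
    nsq mu B (fun x => G j x - G l x) <= e.
  move=> e0; pose M := fine (mu B) + 1.
  have M0 : 0 < M by rewrite ltr_wpDl// fine_ge0.
  pose a := Num.sqrt (e / M).
  have a0 : 0 < a by rewrite sqrtr_gt0 divr_gt0.
  have [N HN] := Hn _ a0; exists N => j l Nj Nl.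
  have := nsq_le_sup (testf_sqint (testfB (tG j) (tG l))) (ltW a0) (HN j l Nj Nl).
  move=> /le_trans; apply.
  rewrite sqr_sqrtr; last by rewrite ltW// divr_gt0.
  rewrite mulrCA ger_pMr// ler_pdivrMr// mul1r.
  by rewrite /M lerDl.
exists G; split => //.
  apply: (@squeeze_cvgr _ _ _ _ (cst lam) (fun j => lam + j.+1%:R^-1)).
  - by apply: nearW => j; rewrite EG EG'.
  - exact: cvg_cst.
  - rewrite -[X in _ --> X]addr0; apply: cvgD; first exact: cvg_cst.
    exact: cvg_harmonic.
move=> e e0; have l1 : 0 < lam + 1 by rewrite ltr_wpDl.
(* Since the squared norm of the sum is 4 minus that of the difference, the terms in 4 lam cancel:
   e/2 remains from lam times the L2 distance and e/2 from two energies within e/8 of lam. *)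
have c0 : 0 < e / 2 / (lam + 1) by rewrite !divr_gt0.
have [N HN] := CG _ c0.
have [N' HN'] : exists N' : nat, 8 / e <= N'.+1%:R.
  by exists (Num.truncn (8 / e)); rewrite ltW// truncnS_gt.
exists (maxn N N') => j l; rewrite !geq_max => /andP[Nj N'j] /andP[Nl N'l].
rewrite energyB//.
have H1 := rayleigh_inf_le m (testfD (tG j) (tG l)).
have sj := testf_sqint (tG j); have sl := testf_sqint (tG l).
have := HN j l Nj Nl; rewrite nsqB// !nG => H2.
rewrite nsqD// !nG -/lam in H1.
have h k : (N' <= k)%N -> energy m (G k) (G k) <= lam + e / 8.
  move=> N'k; apply: le_trans (EG k) _; rewrite lerD2l -[e / 8]invrK invf_div.
  rewrite lef_pV2 ?posrE ?divr_gt0 ?ltr0n//; apply: le_trans HN' _.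
  by rewrite ler_nat ltnS.
have hj := h j N'j; have hl := h l N'l.
have H3 : lam * (1 - 2 * ip mu B (G j) (G l) + 1) <= e / 2.
  apply: (@le_trans _ _ (lam * (e / 2 / (lam + 1)))); first exact: ler_wpM2l.
  rewrite mulrCA ger_pMr ?divr_gt0// ler_pdivrMr// mul1r lerDl; lra.
move: H1 H3 hj hl; set p := ip _ _ _ _; set a := energy _ _ _; set b := energy _ _ _; set c := energy _ _ _.
rewrite !mulrDr mulrN; lra.
Qed.

End minimizer.

(** * The space H^m_0 of the ball *)

Section sobolev_ball.
Context {R : realType} {d : nat}.
Hypothesis d_gt0 : (0 < d)%N.
Local Notation V := 'rV[R]_d.
Local Notation B := (unit_ball R d).
Local Notation mu := (@lebesgue_rV R d).
Let mB : measurable B := measurable_unit_ball.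
Implicit Types (f g u v : V -> R) (s : seq 'I_d) (phi psi : nat -> V -> R).
Local Notation sqi := (sqint mu B).
Local Notation "f =ae g" := (ae_eq mu B f g) (at level 70).

Lemma Rintegral_sum_ip (I : Type) (r : seq I) (F G : I -> V -> R) :
  (forall i, sqi (F i)) -> (forall i, sqi (G i)) ->
  \int[mu]_(x in B) (\sum_(i <- r) F i x * G i x) = \sum_(i <- r) ip mu B (F i) (G i).
Proof.
move=> sF sG; elim: r => [|i r IH].
  rewrite big_nil -[RHS](Rintegral0 mu mB).
  by apply: eq_Rintegral => x _; rewrite big_nil.
rewrite big_cons -IH -RintegralD//; last 2 first.
- exact: sqint_mul.
- rewrite (_ : _ \o _ = fun x => (\sum_(j <- r) (F j x * G j x)%:E)%E).
    by apply: integrable_sum => // j _; exact: sqint_mul.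
  by apply/funext => x; rewrite /= sumEFin.
by apply: eq_Rintegral => x _; rewrite big_cons.
Qed.

Lemma cvgr_sum (I : Type) (r : seq I) (a : I -> nat -> R) (l : I -> R) :
  (forall i, a i k @[k --> \oo] --> l i) ->
  (\sum_(i <- r) a i k) @[k --> \oo] --> \sum_(i <- r) l i.
Proof.
move=> H; elim: r => [|i r IH].
  by rewrite big_nil; under eq_fun do rewrite big_nil; exact: cvg_cst.
by rewrite big_cons; under eq_fun do rewrite big_cons; exact: cvgD.
Qed.

(** Truncations with exponent 0 are test functions tending to a given polynomial in L2, so the
    totality of polynomials applies. *)
Lemma orthogonal_testf g : sqi g -> (forall f, testf f -> ip mu B g f = 0) -> g =ae cst 0.
Proof.
move=> sg Hg; apply: orthogonal_polyf => // p [n /polyf_smooth sp].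
have tc k := testf_cutoff 0 k sp.
have /= := cvg_cutoff (s := [::]) sp (leqnn 0).
rewrite (_ : (fun x => _) = p); last by apply/funext => x; rewrite expr0 mulr1.
move=> H; have := cvgL2_ip mB (fun=> sg) (fun k => testf_sqint (tc k)) sg (smooth_sqint sp)
  (cvgL2_cst mu mB g) H.
rewrite (_ : (fun k => _) = cst 0); last by apply/funext => k; exact: Hg.
by move=> /(cvg_unique (@Rhausdorff R)) /(_ (cvg_cst _)).
Qed.

Lemma weak_derivativeP s u g : weak_derivative B s u g <->
  forall f, testf f -> ip mu B u (pds s f) = (-1) ^+ size s * ip mu B g f.
Proof.
split=> H f; first by move=> /test_functionP/H; rewrite -pdsE.
by move=> /test_functionP/H; rewrite pdsE.
Qed.

Lemma weak_derivative_unique s u g h : sqi g -> sqi h ->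
  weak_derivative B s u g -> weak_derivative B s u h -> g =ae h.
Proof.
move=> sg sh /weak_derivativeP Hg /weak_derivativeP Hh.
have : (fun x => g x - h x) =ae cst 0.
  apply: orthogonal_testf => [|f tf]; first exact: sqintB.
  rewrite ipBl//; last exact: testf_sqint.
  have := Hg f tf; rewrite Hh// => /mulfI; rewrite signr_eq0 => /(_ isT) ->.
  by rewrite subrr.
apply: filterS => x H Bx; apply/eqP; rewrite -subr_eq0; apply/eqP; exact: H.
Qed.

(** The representative chosen by [weakD] can be replaced by any candidate, up to a null set. *)
Lemma weakDP s u g : sqi g -> weak_derivative B s u g ->
  [/\ sqi (weakD B s u), weak_derivative B s u (weakD B s u) & weakD B s u =ae g].
Proof.
move=> sg wg; have [sw ww] : (L2 B `&` weak_derivative B s u) (weakD B s u).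
  by apply: (@xgetPex _ (cst 0) (L2 B `&` weak_derivative B s u)); exists g.
by split => //; exact: weak_derivative_unique ww wg.
Qed.

(** Weak derivatives are closed under L2 limits: integration by parts holds along the sequence and
    both sides converge. *)
Lemma cvgL2_weak_derivative phi s u g : (forall k, testf (phi k)) -> sqi u -> sqi g ->
  cvgL2 mu B phi u -> cvgL2 mu B (fun k => pds s (phi k)) g -> weak_derivative B s u g.
Proof.
move=> tphi su sg cu cg; apply/weak_derivativeP => f tf.
have tpf := testf_pds s tf.
have H1 := cvgL2_ip mB (fun k => testf_sqint (testf_pds s (tphi k))) (fun=> testf_sqint tf)
  sg (testf_sqint tf) cg (cvgL2_cst mu mB f).
have H2 := cvgL2_ip mB (fun k => testf_sqint (tphi k)) (fun=> testf_sqint tpf)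
  su (testf_sqint tpf) cu (cvgL2_cst mu mB (pds s f)).
have H3 : ip mu B (phi k) (pds s f) @[k --> \oo] --> (-1) ^+ size s * ip mu B g f.
  suff -> : (fun k => ip mu B (phi k) (pds s f)) =
      fun k => (-1) ^+ size s * ip mu B (pds s (phi k)) f.
    by apply: cvgM; [exact: cvg_cst|exact: H1].
  apply/funext => k /=; rewrite ip_pds//; last exact: testf_smooth.
  by rewrite mulrA -expr2 sqrr_sign mul1r.
exact: (cvg_unique (@Rhausdorff R) H2 H3).
Qed.

Lemma sobolev0_weakD m u s : sobolev0 B m u -> (size s <= m)%N ->
  sqi (weakD B s u) /\ weak_derivative B s u (weakD B s u).
Proof. by move=> [[_ H] _] /H [g [sg wg]]; have [] := weakDP sg wg. Qed.

Lemma sobolev0_sqint m u : sobolev0 B m u -> sqi u.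
Proof. by case=> [[]]. Qed.

Lemma weakD_nil u : sqi u -> weakD B [::] u =ae u.
Proof.
move=> su; have [] // := @weakDP [::] u u su.
by apply/weak_derivativeP => f _; rewrite expr0 mul1r.
Qed.

(* phi need only be smooth, not compactly supported, so that a smooth member of
   the space may be approximated by itself. *)
Definition approx m phi u := [/\ sobolev0 B m u, forall k, smth (phi k) &
  forall s, (size s <= m)%N -> cvgL2 mu B (fun k => pds s (phi k)) (weakD B s u)].

(** A membership criterion for H^m_0 in which the limits of the derivatives may be any functions;
    they are identified with the weak derivatives afterwards. *)
Lemma approx_testf m phi u : (forall k, testf (phi k)) -> sqi u -> cvgL2 mu B phi u ->
  (forall s, (size s <= m)%N -> exists2 g, sqi g & cvgL2 mu B (fun k => pds s (phi k)) g) ->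
  approx m phi u.
Proof.
move=> tphi su cu H.
have Hw s : (size s <= m)%N ->
    sqi (weakD B s u) /\ cvgL2 mu B (fun k => pds s (phi k)) (weakD B s u).
  move=> /H[g sg cg]; have [sw _ wg] := weakDP sg (cvgL2_weak_derivative tphi su sg cu cg).
  split => //; apply: (cvgL2_ae mB _ sg sw _ cg).
    by move=> k; exact/testf_sqint/testf_pds.
  by apply: filterS wg => x h Bx; rewrite h.
split; [|by move=> k; exact: testf_smooth|by move=> s /Hw[]].
split; last first.
  exists phi; split=> [k|s sm]; first exact/test_functionP.
  have [_] := Hw s sm; rewrite /cvgL2 /nsq.
  by under eq_fun do rewrite pdsE.
split => // s /H[g sg cg]; exists g; split => //.
exact: cvgL2_weak_derivative cg.
Qed.

Lemma approx_exists m u : sobolev0 B m u -> exists2 phi, (forall k, testf (phi k)) & approx m phi u.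
Proof.
move=> su; have [_ [phi [tphi Hphi]]] := su.
have tphi' k : testf (phi k) by exact/test_functionP.
exists phi => //; split => // [k|s sm]; first exact: testf_smooth.
by have := Hphi s sm; under eq_fun do rewrite -pdsE.
Qed.

Lemma approx_sqint m phi u k s : approx m phi u -> sqi (pds s (phi k)).
Proof. by move=> [_ sphi _]; exact/smooth_sqint/smooth_partials. Qed.

Lemma approx_cvg m phi u : approx m phi u -> cvgL2 mu B phi u.
Proof.
move=> H; have [su sphi Hphi] := H; have squ := sobolev0_sqint su.
have [sw _] := sobolev0_weakD su (leq0n m : (size [::] <= m)%N).
apply: (cvgL2_ae mB _ sw squ (weakD_nil squ) (Hphi [::] (leq0n m))).
by move=> k; exact: (approx_sqint k [::] H).
Qed.

Lemma approx_smooth m phi u w : approx m phi u -> smth w ->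
  (forall s, (size s <= m)%N -> cvgL2 mu B (fun k => pds s (phi k)) (pds s w)) ->
  approx m (fun=> w) u.
Proof.
move=> H sw Hw; have [su sphi Hphi] := H; split=> // s sm.
have [swD _] := sobolev0_weakD su sm.
have sp := smooth_sqint (smooth_partials s sw).
apply: (cvgL2_ae mB _ sp swD); [by []| |exact: cvgL2_cst].
exact: (cvgL2_unique mB (fun k => approx_sqint k s H) sp swD (Hw s sm) (Hphi s sm)).
Qed.

Let pds_lap s f : smth f -> pds s (lap f) = fun x => \sum_(i < d) pds (s ++ [:: i; i]) f x.
Proof.
move=> sf; rewrite /lap partials_sum; last by move=> i; do 2 apply: smooth_partial.
by apply/funext => x; apply: eq_bigr => i _; rewrite /pds foldr_cat.
Qed.

Let size_cat2 m s (i : 'I_d) : (size s <= m)%N -> (size (s ++ [:: i; i]) <= m.+2)%N.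
Proof. by rewrite size_cat addn2. Qed.

Lemma cvgL2_lap m phi u s : approx m.+2 phi u -> (size s <= m)%N ->
  sqi (fun x => \sum_(i < d) weakD B (s ++ [:: i; i]) u x) /\
  cvgL2 mu B (fun k => pds s (lap (phi k))) (fun x => \sum_(i < d) weakD B (s ++ [:: i; i]) u x).
Proof.
move=> H sm; have [su sphi Hphi] := H.
have sw i : sqi (weakD B (s ++ [:: i; i]) u).
  by have [] := sobolev0_weakD su (size_cat2 i sm).
split; first exact: sqint_sum.
rewrite (_ : (fun k => pds s (lap (phi k))) =
   fun k x => \sum_(i < d) pds (s ++ [:: i; i]) (phi k) x).
  apply: (@cvgL2_sum _ _ _ mu B mB _ _ (fun i k => pds (s ++ [:: i; i]) (phi k))) => // i.
    by move=> k; exact: (approx_sqint _ _ H).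
  exact/Hphi/size_cat2.
by apply/funext => k; rewrite pds_lap.
Qed.

(** The iterated Laplacian of the statement is built from chosen representatives. This keeps
    membership along the iteration and identifies derivatives of the representative with sums of
    derivatives of u. *)
Lemma sobolev0_laplacian m u : sobolev0 B m.+2 u -> sobolev0 B m (laplacian B u) /\
  forall s, (size s <= m)%N ->
    weakD B s (laplacian B u) =ae (fun x => \sum_(i < d) weakD B (s ++ [:: i; i]) u x).
Proof.
move=> su; have [phi tphi H] := approx_exists su.
have [sl cl] := cvgL2_lap H (leq0n m : (size [::] <= m)%N).
have tl k : testf (lap (phi k)) by exact: testf_lap.
have [s0 _ Hl] : approx m (fun k => lap (phi k)) (laplacian B u).
  apply: approx_testf => // s sm; have [? ?] := cvgL2_lap H sm.
  by eexists; eassumption.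
split => // s sm; have [sw cw] := cvgL2_lap H sm; have [sw' _] := sobolev0_weakD s0 sm.
by apply: (cvgL2_unique mB _ sw' sw (Hl s sm) cw) => k; exact/testf_sqint/testf_pds.
Qed.

Lemma approx_lap m phi u : approx m.+2 phi u ->
  approx m (fun k => lap (phi k)) (laplacian B u).
Proof.
move=> H; have [su sphi Hphi] := H; have [sl wl] := sobolev0_laplacian su.
split => // [k|s sm]; first exact: smooth_lap.
have [sw cw] := cvgL2_lap H sm; have [sw' _] := sobolev0_weakD sl sm.
apply: (cvgL2_ae mB _ sw sw' _ cw).
  by move=> k; exact/smooth_sqint/smooth_partials/smooth_lap.
by apply: filterS (wl s sm) => x h Bx; rewrite h.
Qed.

Lemma approx_lapn j m phi u : approx (j.*2 + m) phi u ->
  approx m (fun k => iter j lap (phi k)) (iter j (laplacian B) u).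
Proof.
elim: j m => [//|j IH] m; rewrite doubleS !addSn -!addnS => /IH.
exact: approx_lap.
Qed.

(** Moving j of the Laplacians onto f reduces the energy to order 0 or 1, the two cases of
    [nabla_dot]. *)
Lemma energy_double k j f g : testf f -> smth g ->
  energy (k + j.*2) f g = energy k (iter j lap f) (iter j lap g).
Proof.
move=> tf sg; rewrite /energy exprD -muln2 mulnC exprM sqrrN !expr1n mulr1.
rewrite (ip_lapn j tf (smooth_lapn k (smooth_lapn j sg))) -!iterD.
by congr (_ * ip mu B f (iter _ lap g)); rewrite mul2n -addnn !addnA [(k + j)%N]addnC.
Qed.

(** Links the integrated-by-parts form with that of the statement: m./2 Laplacians pass to the limit
    on each side, leaving an L2 product of functions or of gradients by parity. *)
Theorem cvg_energy m phi psi u v : (forall k, testf (phi k)) ->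
  approx m phi u -> approx m psi v ->
  energy m (phi k) (psi k) @[k --> \oo] --> \int[mu]_(x in B) nabla_dot B m u v x.
Proof.
move=> tphi Hu Hv; have [_ spsi _] := Hv.
have mE : m = (m./2.*2 + odd m)%N by rewrite addnC odd_double_half.
have Lu : approx (odd m) (fun k => iter m./2 lap (phi k)) (iter m./2 (laplacian B) u).
  by apply: approx_lapn; rewrite -mE.
have Lv : approx (odd m) (fun k => iter m./2 lap (psi k)) (iter m./2 (laplacian B) v).
  by apply: approx_lapn; rewrite -mE.
have -> : (fun k => energy m (phi k) (psi k)) =
    fun k => energy (odd m) (iter m./2 lap (phi k)) (iter m./2 lap (psi k)).
  by apply/funext => k; rewrite -energy_double// addnC -mE.
have tl k : testf (iter m./2 lap (phi k)) by exact: testf_lapn.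
rewrite /nabla_dot.
set U := fun k => iter m./2 lap (phi k) in Lu tl *.
set W := fun k => iter m./2 lap (psi k) in Lv *.
move: (iter _ _ u) (iter _ _ v) Lu Lv => u' v'; case: (odd m) => Lu Lv.
  have [su' sU HU] := Lu; have [sv' sW HW] := Lv.
  have sq i := sobolev0_weakD su' (leqnn 1 : (size [:: i] <= 1)%N).
  have sq' i := sobolev0_weakD sv' (leqnn 1 : (size [:: i] <= 1)%N).
  have -> : \int[mu]_(x in B) (\sum_(i < d) weakD B [:: i] u' x * weakD B [:: i] v' x) =
      \sum_(i < d) ip mu B (weakD B [:: i] u') (weakD B [:: i] v').
    by apply: Rintegral_sum_ip => i; [have [] := sq i|have [] := sq' i].
  have -> : (fun k => energy true (U k) (W k)) =
      fun k => \sum_(i < d) ip mu B (pds [:: i] (U k)) (pds [:: i] (W k)).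
    apply/funext => k; rewrite energyS_smooth; [|exact: tl|exact: sW].
    by apply: eq_bigr => i _; rewrite /energy expr0 mul1r.
  apply: cvgr_sum => i; apply: cvgL2_ip => //.
  - by move=> k; exact: approx_sqint Lu.
  - by move=> k; exact: approx_sqint Lv.
  - by have [] := sq i.
  - by have [] := sq' i.
  - exact: HU.
  - exact: HW.
have [su' _ _] := Lu; have [sv' _ _] := Lv.
rewrite (_ : (fun k => energy false (U k) (W k)) = fun k => ip mu B (U k) (W k)); last first.
  by apply/funext => k; rewrite /energy expr0 mul1r.
apply: cvgL2_ip => //.
- by move=> k; exact: (approx_sqint k [::] Lu).
- by move=> k; exact: (approx_sqint k [::] Lv).
- exact: sobolev0_sqint su'.
- exact: sobolev0_sqint sv'.
- exact: approx_cvg Lu.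
- exact: approx_cvg Lv.
Qed.

End sobolev_ball.

(** * Bounds for the first eigenvalue *)

Section eigenvalue.
Context {R : realType} {d : nat}.
Hypothesis d_gt0 : (0 < d)%N.
Local Notation V := 'rV[R]_d.
Local Notation B := (unit_ball R d).
Local Notation mu := (@lebesgue_rV R d).
Let mB : measurable B := measurable_unit_ball.
Implicit Types (f g u v : V -> R) (s : seq 'I_d).
Local Notation rayleigh := (@rayleigh_inf R d).
Local Notation sqi := (sqint mu B).
Local Notation "f =ae g" := (ae_eq mu B f g) (at level 70).

Lemma rayleigh_le_nabla m v : sobolev0 B m v ->
  rayleigh m * nsq mu B v <= \int[mu]_(x in B) nabla_dot B m v v x.
Proof.
move=> sv; have [psi tpsi Hpsi] := approx_exists sv.
have sqv := sobolev0_sqint sv.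
have H1 := cvg_energy tpsi Hpsi Hpsi.
have H2 := cvgL2_ip mB (fun k => testf_sqint (tpsi k)) (fun k => testf_sqint (tpsi k))
  sqv sqv (approx_cvg Hpsi) (approx_cvg Hpsi).
have H3 : rayleigh m * ip mu B (psi k) (psi k) @[k --> \oo] -->
    rayleigh m * ip mu B v v.
  by apply: cvgM; [exact: cvg_cst|exact: H2].
rewrite -ipff; apply: (ler_cvg_to H3 H1).
by apply: nearW => k; rewrite ipff; exact: rayleigh_inf_le.
Qed.

Let pdsB s f g : smth f -> smth g ->
  pds s (fun x => f x - g x) = fun x => pds s f x - pds s g x.
Proof.
move=> sf sg; have -> : (fun x => f x - g x) = fun x => f x + -1 * g x.
  by apply/funext => x; rewrite mulN1r.
rewrite partialsD//; last exact: smoothZ.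
by rewrite partialsZ//; apply/funext => x; rewrite mulN1r.
Qed.

Lemma ae0_nsq u : sqi u -> u =ae cst 0 -> nsq mu B u = 0.
Proof.
move=> su u0; rewrite -(nsq_ae_eq mB su (sqint0 mu B) u0).
by apply: eq_Rintegral => x _; rewrite subr0.
Qed.

(** Cauchy in energy means Cauchy in every derivative of order at most m, so the minimizing sequence
    has a limit in H^m_0, of norm 1 and hence nonzero. *)
Theorem dirichlet_eigenvalue_rayleigh m : (d < m)%N ->
  dirichlet_eigenvalue B m (rayleigh m).
Proof.
move=> dm; set lam := rayleigh m.
have [G [tG nG EG _ CG]] := @minimizing_sequence R d d_gt0 m dm.
have sG k s : sqi (pds s (G k)) by exact/testf_sqint/testf_pds.
have CC s : (size s <= m)%N -> exists2 g, sqi g & cvgL2 mu B (fun k => pds s (G k)) g.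
  move=> sm; have [//|e e0|g [sg cg]] := @sqint_complete _ _ R mu B mB unit_ball_lty (fun k => pds s (G k)).
    have [|N HN] := CG (e / 4 ^+ m); first by rewrite divr_gt0 ?exprn_gt0.
    exists N => k l Nk Nl; rewrite -pdsB; [|exact: testf_smooth..].
    apply: le_trans (nsq_pds_le_energy d_gt0 (testfB (tG k) (tG l)) sm) _.
    by rewrite mulrC -ler_pdivlMr ?exprn_gt0//; exact: HN.
  by exists g.
have [u su cu] := CC [::] (leq0n m).
have Hu : approx m G u by exact: approx_testf.
have [sob _ _] := Hu.
have nu : nsq mu B u = 1.
  have := cvgL2_ip mB (fun k => testf_sqint (tG k)) (fun k => testf_sqint (tG k)) su su cu cu.
  rewrite (_ : (fun k => _) = cst 1); last by apply/funext => k; rewrite ipff nG.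
  by move=> /(cvg_unique (@Rhausdorff R) (cvg_cst _)); rewrite ipff.
exists u; split => // [/(ae0_nsq su)|v sv]; first by rewrite nu => /eqP; rewrite oner_eq0.
have [psi tpsi Hpsi] := approx_exists sv; have sqv := sobolev0_sqint sv.
have cv := approx_cvg Hpsi.
have H1 := cvg_energy tG Hu Hpsi.
have H2 := cvgL2_ip mB (fun k => testf_sqint (tG k)) (fun k => testf_sqint (tpsi k)) su sqv cu cv.
have H3 := cvg_energy tpsi Hpsi Hpsi.
have H4 := cvgL2_ip mB (fun k => testf_sqint (tpsi k)) (fun k => testf_sqint (tpsi k)) sqv sqv cv cv.
have Ha : energy m (G k) (psi k) - lam * ip mu B (G k) (psi k) @[k --> \oo] -->
    \int[mu]_(x in B) nabla_dot B m u v x - lam * ip mu B u v.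
  by apply: cvgB; [exact: H1|apply: cvgM; [exact: cvg_cst|exact: H2]].
have Hc : energy m (psi k) (psi k) - lam * ip mu B (psi k) (psi k) @[k --> \oo] -->
    \int[mu]_(x in B) nabla_dot B m v v x - lam * ip mu B v v.
  by apply: cvgB; [exact: H3|apply: cvgM; [exact: cvg_cst|exact: H4]].
have Hb : energy m (G k) (G k) - lam * ip mu B (G k) (G k) @[k --> \oo] --> (0 : R).
  rewrite -[X in _ --> X](subrr lam); apply: cvgB; first exact: EG.
  rewrite (_ : (fun k => _) = cst lam); first exact: cvg_cst.
  by apply/funext => k; rewrite ipff nG mulr1.
(* In the limit of [energy_cauchy_schwarz] the factor of [G k] is 0, so the square of the defect in
   the weak equation is at most 0. *)
have := ler_cvg_to (cvgM Ha Ha) (cvgM Hb Hc).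
rewrite mul0r -expr2 => H.
have {}H : (\int[mu]_(x in B) nabla_dot B m u v x - lam * ip mu B u v) ^+ 2 <= 0.
  apply: H; apply: nearW => k /=; rewrite -expr2 !ipff.
  by apply: energy_cauchy_schwarz => // h th; exact: rayleigh_inf_le.
apply/eqP; rewrite -subr_eq0 -sqrf_eq0; apply/eqP/le_anti.
by rewrite H sqr_ge0.
Qed.

(** Testing the equation of any eigenvalue with its own eigenfunction bounds it below by the
    infimum, which is itself attained as an eigenvalue. *)
Theorem first_eigenvalue_rayleigh m : (d < m)%N -> first_eigenvalue B m = rayleigh m.
Proof.
move=> dm; have ev := dirichlet_eigenvalue_rayleigh dm.
have lb lam : dirichlet_eigenvalue B m lam -> rayleigh m <= lam.
  move=> [u [sob nz /(_ u sob) E]]; have su := sobolev0_sqint sob.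
  have := rayleigh_le_nabla sob; rewrite E -/(ip mu B u u) ipff.
  have : 0 < nsq mu B u.
    rewrite lt_neqAle nsq_ge0 andbT eq_sym; apply/eqP => /(nsq_eq0 mB su).
    exact: nz.
  by move=> /ler_pM2r ->.
apply: xget_unique; first by split.
by move=> lam [evl lbl]; apply/le_anti; rewrite lb// lbl.
Qed.

Lemma approx_rhoX m p : smth p ->
  approx m (fun k => cutoff m p k) (fun x : V => p x * rho x ^+ m).
Proof.
move=> sp; have sv := smooth_rhoX m sp; apply: approx_testf.
- by move=> k; exact: testf_cutoff.
- exact: smooth_sqint.
- exact: (cvg_cutoff (s := [::]) sp (leq0n m)).
- move=> s sm; exists (pds s (fun x : V => p x * rho x ^+ m)); last exact: cvg_cutoff.
  exact/smooth_sqint/smooth_partials.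
Qed.

(** Only u is approximated by test functions; p rho^m is smooth and serves as its own approximation,
    so all m Laplacians fall on it. *)
Lemma nabla_dot_rhoX m p u : smth p -> sobolev0 B m u ->
  \int[mu]_(x in B) nabla_dot B m u (fun x : V => p x * rho x ^+ m) x = ip mu B u (Lop m p).
Proof.
move=> sp sob; have [phi tphi Hphi] := approx_exists sob.
have sv := smooth_rhoX m sp.
have Hv : approx m (fun=> fun x : V => p x * rho x ^+ m) (fun x : V => p x * rho x ^+ m).
  by apply: approx_smooth (approx_rhoX m sp) sv _ => s sm; exact: cvg_cutoff.
have H1 := cvg_energy tphi Hphi Hv.
have sL : smth (Lop m p) by apply: smoothZ; exact: smooth_lapn.
have sqL := smooth_sqint sL.
have H2 := cvgL2_ip mB (fun k => testf_sqint (tphi k)) (fun=> sqL) (sobolev0_sqint sob) sqL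
  (approx_cvg Hphi) (cvgL2_cst mu mB _).
suff E : (fun k => energy m (phi k) (fun x : V => p x * rho x ^+ m)) =
    fun k => ip mu B (phi k) (Lop m p).
  by apply: (cvg_unique (@Rhausdorff R) H1); rewrite E.
apply/funext => k; rewrite /energy ipC -ipZl//; last 2 first.
- exact/smooth_sqint/smooth_lapn.
- exact: testf_sqint.
by rewrite ipC.
Qed.

Theorem Ccoef_le_rayleigh m : (d < m)%N -> (@Ccoef R d m) <= rayleigh m.
Proof.
move=> dm; rewrite leNgt; apply/negP => lt.
have [u [sob nz Hu]] := dirichlet_eigenvalue_rayleigh dm; apply: nz.
apply: (eigenvalue_ge_core d_gt0 (sobolev0_sqint sob) (rayleigh_inf_ge0 m) lt).
move=> p [n /polyf_smooth sp]; have [sv _ _] := approx_rhoX m sp.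
by have := Hu _ sv; rewrite (nabla_dot_rhoX sp sob).
Qed.

Definition rho_int a : R := \int[mu]_(x in B) rho x ^+ a.

Lemma rayleigh_le_Ccoef m :
  rayleigh m * rho_int m.*2 <= (@Ccoef R d m) * rho_int m.
Proof.
have s1 : smth (cst 1 : V -> R) by exact: smooth_cst.
have [sob _ _] := approx_rhoX m s1.
have sv := smooth_sqint (smooth_rhoX m s1).
have := rayleigh_le_nabla sob; rewrite nabla_dot_rhoX// Lop1 ipC.
rewrite (_ : cst (@Ccoef R d m) = fun x : V => (@Ccoef R d m) * cst 1 x); last first.
  by apply/funext => x; rewrite mulr1.
rewrite ipZl//; last exact: smooth_sqint.
rewrite (_ : nsq _ _ _ = rho_int m.*2); last first.
  by apply: eq_Rintegral => x _; rewrite mul1r -exprM muln2.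
by rewrite (_ : ip _ _ _ _ = rho_int m)//; apply: eq_Rintegral => x _; rewrite !mul1r.
Qed.

Lemma smooth_rhoXn a : smth (fun x : V => rho x ^+ a).
Proof.
have -> : (fun x : V => rho x ^+ a) = fun x => cst 1 x * rho x ^+ a.
  by apply/funext => x; rewrite mul1r.
by apply: smooth_rhoX; exact: smooth_cst.
Qed.

Lemma rho_int_gt0 a : 0 < rho_int a.*2.
Proof.
have sr := smooth_sqint (smooth_rhoXn a).
have -> : rho_int a.*2 = nsq mu B (fun x : V => rho x ^+ a).
  by apply: eq_Rintegral => x _; rewrite -exprM muln2.
rewrite lt_neqAle nsq_ge0 andbT eq_sym; apply/eqP => /(nsq_eq0 mB sr) Z.
(* Since rho is positive on the ball, a null power of rho would make the ball null and every norm
   zero. *)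
have [h th] := @testf_nsq_gt0 R d; rewrite (@ae0_nsq h) ?ltxx//; first exact: testf_sqint.
apply: filterS Z => x H Bx; exfalso; move: (H Bx) => /= /eqP.
by rewrite expf_eq0 => /andP[_]; rewrite gt_eqF//; exact/unit_ballE.
Qed.

Lemma pd_rhoX i n (x : V) : pd i (fun x : V => rho x ^+ n.+1) x =
  - 2 * n.+1%:R * x 0 i * rho x ^+ n.
Proof.
elim: n x => [|n IH] x.
  rewrite (_ : (fun x => _) = @rho R d); last by apply/funext => y; rewrite expr1.
  by rewrite partial_rho expr0; ring.
rewrite (_ : (fun x => _) = fun y : V => rho y * rho y ^+ n.+1); last first.
  by apply/funext => y; rewrite exprS.
rewrite partialMs; [|exact: smooth_rho|exact: smooth_rhoXn].
by rewrite partial_rho IH !exprS -(natr1 n.+1); ring.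
Qed.

(** The divergence of x rho^(n+1) integrates to 0, and |x|^2 = 1 - rho turns it into this relation.
    The field vanishes on the sphere without compact support, hence the passage through cutoffs. *)
Lemma rho_int_rec n : (2 * n.+1%:R + d%:R) * rho_int n.+1 = 2 * n.+1%:R * rho_int n.
Proof.
have s1 : sqi (cst 1) by apply: smooth_sqint; exact: smooth_cst.
have sq a := smooth_sqint (smooth_rhoXn a).
pose w i : V -> R := fun x => coord i x * rho x ^+ n.+1.
have sw i : smth (w i) by apply: smoothM; [exact: smooth_coord|exact: smooth_rhoXn].
have sqp i : sqi (pd i (w i)) by exact/smooth_sqint/smooth_partial.
have Z i : ip mu B (pd i (w i)) (cst 1) = 0.
  have cv : cvgL2 mu B (fun k => pds [:: i] (cutoff n.+1 (coord i) k)) (pds [:: i] (w i)).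
    by apply: cvg_cutoff => //; exact: smooth_coord.
  have tc k : testf (cutoff n.+1 (coord i : V -> R) k) by apply: testf_cutoff; exact: smooth_coord.
  have := cvgL2_ip mB (fun k => testf_sqint (testf_pds [:: i] (tc k))) (fun=> s1) (sqp i) s1
    cv (cvgL2_cst mu mB _).
  rewrite (_ : (fun k => _) = cst 0); last first.
    apply/funext => k; rewrite -[RHS](testf_integral_pd i (tc k)).
    by apply: eq_Rintegral => x _; rewrite mulr1.
  by move=> /(cvg_unique (@Rhausdorff R) (cvg_cst _)).
have : ip mu B (fun x => \sum_(i < d) pd i (w i) x) (cst 1) = 0.
  by rewrite ip_suml// big1.
rewrite (_ : (fun x => \sum_(i < d) _) = fun x => (2 * n.+1%:R + d%:R) * rho x ^+ n.+1
    - 2 * n.+1%:R * rho x ^+ n); last first.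
  apply/funext => x; have E i : pd i (w i) x =
      rho x ^+ n.+1 - 2 * n.+1%:R * rho x ^+ n * x 0 i ^+ 2.
    rewrite /w (pd_coordM i i (smooth_rhoXn n.+1)) eqxx pd_rhoX /= mul1r expr2; ring.
  under eq_bigr do rewrite E.
  rewrite sumrB sumr_const card_ord -mulr_sumr -mulr_natr.
  rewrite (_ : \sum_(i < d) x 0 i ^+ 2 = 1 - rho x); last by rewrite /rho subKr.
  rewrite exprS; ring.
rewrite ipBl//; [|exact: sqintZ..]; rewrite !ipZl// => /eqP; rewrite subr_eq0 => /eqP.
have E a : ip mu B (fun x : V => rho x ^+ a) (cst 1) = rho_int a.
  by apply: eq_Rintegral => x _; rewrite mulr1.
by rewrite !E.
Qed.

Lemma rho_int_ge0 a : 0 <= rho_int a.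
Proof. by apply: Rintegral_ge0 => x /unit_ballE/ltW r0; rewrite exprn_ge0. Qed.

(** By the recursion, passing from n to n + 1 costs 1 + d / (2 (n + 1)), at most exp (d / (2m)) for
    n >= m; taking k = m produces the constant exp (d/2). *)
Lemma rho_int_le m k : (0 < m)%N ->
  rho_int m <= expR (d%:R / (2 * m%:R)) ^+ k * rho_int (m + k).
Proof.
move=> m0; have m0' : 0 < m%:R :> R by rewrite ltr0n.
elim: k => [|k IH]; first by rewrite expr0 mul1r addn0.
apply: le_trans IH _; rewrite exprSr -mulrA ler_pM2l ?exprn_gt0 ?expR_gt0// addnS.
have n0 : 0 < (m + k).+1%:R :> R by rewrite ltr0n.
have -> : rho_int (m + k) = (1 + d%:R / (2 * (m + k).+1%:R)) * rho_int (m + k).+1.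
  apply: (@mulfI _ (2 * (m + k).+1%:R)); first by rewrite mulf_neq0// gt_eqF.
  rewrite -rho_int_rec mulrA; congr (_ * _).
  by move: n0; move: ((m + k).+1%:R : R) => t n0; field; rewrite gt_eqF.
apply: ler_wpM2r; first exact: rho_int_ge0.
apply: le_trans (expR_ge1Dx _) _; rewrite ler_expR.
apply: ler_wpM2l => //; rewrite lef_pV2 ?posrE ?mulr_gt0// ler_pM2l// ler_nat.
by rewrite -addnS leq_addr.
Qed.

Theorem rayleigh_le_expR m : (0 < m)%N ->
  rayleigh m <= expR (d%:R / 2) * (@Ccoef R d m).
Proof.
move=> m0; rewrite -(ler_pM2r (rho_int_gt0 m)).
apply: le_trans (rayleigh_le_Ccoef m) _.
rewrite mulrAC mulrC ler_pM2r ?Ccoef_gt0//.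
have := rho_int_le m m0; rewrite addnn -expRM_natl.
rewrite (_ : m%:R * (d%:R / (2 * m%:R)) = d%:R / 2)//.
by rewrite invfM mulrCA [X in _ * X]mulrCA mulfV ?mulr1// pnatr_eq0 -lt0n.
Qed.

End eigenvalue.

(** * Asymptotics *)

Section log_asymptotics.
Context {R : realType}.
Implicit Types (x t k b : R).

Lemma ge0_of_derive (h h' : R -> R) x : h 0 = 0 -> 0 <= x ->
  (forall t, 0 <= t -> is_derive t (1 : R) h (h' t)) ->
  (forall t, 0 <= t -> 0 <= h' t) -> 0 <= h x.
Proof.
move=> h0 x0 dh h'0.
have cont : {within `[0, x]%classic, continuous h}.
  apply: derivable_within_continuous => t; rewrite in_itv /= => /andP[t0 _].
  exact: (@ex_derive _ _ _ _ _ _ _ (dh t t0)).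
have dh' t : t \in `]0, x[%R -> is_derive t (1 : R) h (h' t).
  by rewrite in_itv /= => /andP[/ltW t0 _]; exact: dh.
have [c] := MVT_segment x0 dh' cont.
rewrite in_itv /= h0 !subr0 => /andP[c0 _] ->.
by rewrite mulr_ge0// h'0.
Qed.

Let is_derive_ln1D t : 0 <= t -> is_derive t (1 : R) (fun s : R => ln (1 + s)) (1 + t)^-1.
Proof.
move=> t0; have p : 0 < 1 + t by rewrite ltr_pwDl.
have d1 : is_derive t (1 : R) (fun s : R => 1 + s) 1.
  by apply: is_derive_eq; rewrite add0r mulr1.
have := @is_derive1_comp R (@ln R) (fun s : R => 1 + s) t _ _ (is_derive1_ln p) d1.
by rewrite mulr1.
Qed.

Lemma ln1Dx_ge x : 0 <= x -> x - x ^+ 2 / 2 <= ln (1 + x).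
Proof.
move=> x0; rewrite -subr_ge0.
apply: (ge0_of_derive (h := fun s => ln (1 + s) - (s - s ^+ 2 / 2))
  (h' := fun s => (1 + s)^-1 - (1 - s))) => // [|t t0|t t0].
- by rewrite addr0 ln1 expr0n /= mul0r !subrr.
- have := is_derive_ln1D t0 => H.
  have H2 : is_derive t (1 : R) (fun s : R => s - s ^+ 2 / 2) (1 - t).
    by apply: is_derive_eq; rewrite /GRing.scale /=; field.
  exact: is_deriveB.
- have p : 0 < 1 + t by rewrite ltr_pwDl.
  rewrite (_ : _ - _ = t ^+ 2 / (1 + t)); last by field; rewrite gt_eqF.
  by rewrite divr_ge0 ?sqr_ge0// ltW.
Qed.

(** In [log_step] this is used at x = 1/t under a factor of order t, so an error of order x^3 is
    needed to obtain 1/t^2. *)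
Lemma ln1Dx_le x : 0 <= x -> ln (1 + x) <= x - x ^+ 2 / 2 + x ^+ 3 / 3.
Proof.
move=> x0; rewrite -subr_ge0.
apply: (ge0_of_derive (h := fun s => (s - s ^+ 2 / 2 + s ^+ 3 / 3) - ln (1 + s))
  (h' := fun s => (1 - s + s ^+ 2) - (1 + s)^-1)) => // [|t t0|t t0].
- by rewrite addr0 ln1 !expr0n /= !mul0r subr0 addr0 subrr.
- have := is_derive_ln1D t0 => H.
  have H2 : is_derive t (1 : R) (fun s : R => s - s ^+ 2 / 2 + s ^+ 3 / 3) (1 - t + t ^+ 2).
    by apply: is_derive_eq; rewrite /GRing.scale /=; field.
  exact: is_deriveB.
- have p : 0 < 1 + t by rewrite ltr_pwDl.
  rewrite (_ : _ - _ = t ^+ 3 / (1 + t)); last by field; rewrite gt_eqF.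
  by rewrite divr_ge0 ?exprn_ge0// ltW.
Qed.

(* The increment at t of ln C_t minus its expansion, with k = d / 2. *)
Lemma log_step k t : 0 <= k -> 1 <= t ->
  `|ln (1 + k / t) - (2 * t + 1 + k) * ln (1 + t^-1) + 2| <= (1 + k + k ^+ 2) / t ^+ 2.
Proof.
move=> k0 t1; have t0 : 0 < t by exact: lt_le_trans t1.
rewrite -exprVn; have x0 : 0 < t^-1 by rewrite invr_gt0.
have x1 : t^-1 <= 1 by rewrite invf_le1.
have tx : t * t^-1 = 1 by rewrite mulfV// gt_eqF.
move: (t^-1) x0 x1 tx => x x0 x1 tx.
have kx0 : 0 <= k * x by rewrite mulr_ge0// ltW.
have w0 : 0 <= 2 * t + 1 + k by rewrite !addr_ge0// mulr_ge0// ltW.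
have a1 : ln (1 + k * x) <= k * x by apply: le_ln1Dx; apply: lt_le_trans kx0; rewrite ltrN10.
have a2 := ln1Dx_ge kx0.
have b1 := ler_wpM2l w0 (ln1Dx_ge (ltW x0)).
have b2 := ler_wpM2l w0 (ln1Dx_le (ltW x0)).
have E1 : (2 * t + 1 + k) * (x - x ^+ 2 / 2) = 2 + k * x - (1 + k) * x ^+ 2 / 2.
  have -> : (2 * t + 1 + k) * (x - x ^+ 2 / 2) =
    2 * (t * x) - (t * x) * x + (1 + k) * (x - x ^+ 2 / 2) by field.
  by rewrite tx; field.
have E2 : (2 * t + 1 + k) * (x - x ^+ 2 / 2 + x ^+ 3 / 3) =
    2 + k * x - (1 + k) * x ^+ 2 / 2 + 2 * x ^+ 2 / 3 + (1 + k) * x ^+ 3 / 3.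
  rewrite mulrDr E1; have -> : (2 * t + 1 + k) * (x ^+ 3 / 3) =
    2 * (t * x) * x ^+ 2 / 3 + (1 + k) * x ^+ 3 / 3 by rewrite [x ^+ 3]exprS; field.
  by rewrite tx; field.
rewrite E1 in b1; rewrite E2 in b2.
have x3 : (1 + k) * x ^+ 3 <= (1 + k) * x ^+ 2.
  by rewrite ler_wpM2l ?addr_ge0// exprS ler_piMl ?sqr_ge0.
have p0 : 0 <= x ^+ 2 by exact: sqr_ge0.
have p1 : 0 <= k * x ^+ 2 by rewrite mulr_ge0.
have p2 : 0 <= k ^+ 2 * x ^+ 2 by rewrite mulr_ge0 ?sqr_ge0.
rewrite exprMn in a2.
move: a1 a2 b1 b2 x3 p0 p1 p2.
set u1 := ln (1 + k * x); set u2 := _ * ln (1 + x).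
rewrite ler_norml => *; apply/andP; split; lra.
Qed.

(** For t >= 1, 1/t^2 is at most 2 (1/t - 1/(t+1)); the induction therefore carries the sharper
    bound 2c (1 - 1/(n+1)). *)
Lemma telescope_bound (a : nat -> R) c : 0 <= c ->
  (forall n, `|a n.+1 - a n| <= c / n.+1%:R ^+ 2) -> forall n, `|a n - a 0%N| <= 2 * c.
Proof.
move=> c0 H n; suff : `|a n - a 0%N| <= 2 * c * (1 - n.+1%:R^-1).
  move=> /le_trans; apply; apply: ler_piMr; first by rewrite mulr_ge0.
  by rewrite lerBlDr lerDl invr_ge0.
elim: n => [|n IH]; first by rewrite invr1 !subrr normr0 mulr0.
have -> : a n.+1 - a 0%N = (a n.+1 - a n) + (a n - a 0%N) by rewrite addrA subrK.
apply: le_trans (ler_normD _ _) _; apply: le_trans (lerD (H n) IH) _.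
rewrite -(natr1 n.+1); set t : R := n.+1%:R.
have t1 : 1 <= t by rewrite ler1n.
have t0 : 0 < t by exact: lt_le_trans t1.
rewrite -subr_ge0.
have -> : 2 * c * (1 - (t + 1)^-1) - (c / t ^+ 2 + 2 * c * (1 - t^-1)) =
   c * (t - 1) / (t ^+ 2 * (t + 1)).
  by field; rewrite !gt_eqF// ltr_wpDr.
by rewrite divr_ge0 ?mulr_ge0 ?subr_ge0 ?exprn_ge0// ?addr_ge0// ltW.
Qed.

Definition log_expansion k t : R := 2 * t * ln (2 * t) - 2 * t + k * ln t.

(** The upper half comes from exp x <= 1 / (1 - x), itself the inequality 1 + y <= exp y at y =
    -x. *)
Lemma expR_taylor x : x <= 2^-1 -> 0 <= expR x - 1 - x <= 2 * x ^+ 2.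
Proof.
move=> x2; have := expR_ge1Dx x; have := expR_ge1Dx (- x).
have x1 : 0 < 1 - x by lra.
rewrite expRN => h1 h2; apply/andP; split; first by lra.
have e0 := expR_gt0 x.
have h3 : expR x <= (1 - x)^-1.
  by rewrite -[expR x]invrK lef_pV2 ?posrE ?invr_gt0.
have h4 : expR x - 1 - x <= x ^+ 2 / (1 - x).
  rewrite (_ : x ^+ 2 / (1 - x) = (1 - x)^-1 - 1 - x); first by lra.
  by field; rewrite gt_eqF.
apply: le_trans h4 _; rewrite ler_pdivrMr// -subr_ge0.
rewrite (_ : _ - _ = x ^+ 2 * (2 * (2^-1 - x))); last by field.
by rewrite mulr_ge0 ?sqr_ge0 ?mulr_ge0 ?subr_ge0.
Qed.

(** Write L / (2t) = ln (2t) - 1 + tau with tau = (k ln t + r) / (2t). The exponential is (2t/e) exp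
    tau: its linear term gives (k/e) ln t + r/e, and the quadratic remainder stays bounded. *)
Lemma exp_log_expansion k b t L : 0 <= k -> 0 <= b -> 1 <= t -> 4 * (k + b) ^+ 2 <= t ->
  `|L - log_expansion k t| <= b ->
  `|expR (L / (2 * t)) - (2 * t / expR 1 + k / expR 1 * ln t)| <= 4 * (k + b) ^+ 2 + b.
Proof.
move=> k0 b0 t1 tQ HL; have t0 : 0 < t by exact: lt_le_trans t1.
(* From ln t <= 2 sqrt t one gets tau^2 <= (k + b)^2 / t, which the factor t of the main term turns
   into a constant. *)
pose s := Num.sqrt t; have s0 : 0 < s by rewrite sqrtr_gt0.
have ts : t = s ^+ 2 by rewrite sqr_sqrtr// ltW.
have s1 : 1 <= s by rewrite -[leLHS]sqrtr1 ler_wsqrtr.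
pose r := L - log_expansion k t; pose tau := (k * ln t + r) / (2 * t).
have lt0 : 0 <= ln t by exact: ln_ge0.
have lts : ln t <= 2 * s.
  by rewrite ts lnXn// -[ln s *+ 2]mulr_natl ler_pM2l// ltW// ln_sublinear.
have tau1 : `|tau| <= (k + b) / s.
  rewrite normrM [X in _ * X]ger0_norm ?invr_ge0 ?mulr_ge0 ?(ltW t0)//.
  rewrite ler_pdivrMr ?mulr_gt0//.
  have -> : (k + b) / s * (2 * t) = 2 * (k + b) * s by rewrite ts; field; rewrite gt_eqF.
  apply: le_trans (ler_normD _ _) _; rewrite normrM (ger0_norm k0) (ger0_norm lt0).
  have h1 : k * ln t <= k * (2 * s) by exact: ler_wpM2l.
  have h2 : b <= b * s by rewrite ler_peMr.
  apply: le_trans (lerD h1 HL) _; have := mulr_ge0 b0 (ltW s0).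
  rewrite (_ : 2 * (k + b) * s = k * (2 * s) + 2 * (b * s)); last by ring.
  by lra.
have tau2 : tau ^+ 2 <= (k + b) ^+ 2 / t.
  rewrite -(real_normK (num_real tau)) ts -expr_div_n.
  by rewrite lerXn2r ?nnegrE ?normr_ge0// divr_ge0 ?addr_ge0// ltW.
(* The hypothesis 4 (k + b)^2 <= t is the threshold that brings tau into the range of
   [expR_taylor]. *)
have tauh : tau <= 2^-1.
  apply: le_trans (ler_norm _) _; rewrite -(@ler_pXn2r _ 2)// ?nnegrE ?normr_ge0 ?invr_ge0//.
  rewrite real_normK ?num_real//; apply: le_trans tau2 _.
  rewrite ler_pdivrMr// exprVn -ler_pdivrMl ?invr_gt0 ?exprn_gt0// invrK.
  by rewrite (_ : 2 ^+ 2 = 4 :> R)// -natrX.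
have E : L / (2 * t) = ln (2 * t) + (- 1 + tau).
  have -> : L = 2 * t * ln (2 * t) - 2 * t + (k * ln t + r).
    by rewrite /r /log_expansion; ring.
  by rewrite /tau; field; rewrite gt_eqF.
have e1 : 1 <= expR 1 :> R by apply: le_trans (expR_ge1Dx 1); rewrite lerDl.
have e0 : 0 < expR 1 :> R by exact: expR_gt0.
rewrite E !expRD lnK ?posrE ?mulr_gt0// expRN.
have -> : 2 * t * ((expR 1)^-1 * expR tau) - (2 * t / expR 1 + k / expR 1 * ln t) =
    (2 * t * (expR tau - 1 - tau) + r) / expR 1.
  by rewrite /tau; field; rewrite !gt_eqF.
have /andP[T1 T2] := expR_taylor tauh.
rewrite normrM [X in _ * X]ger0_norm ?invr_ge0 ?(ltW e0)//.
have q0 : 0 <= 4 * (k + b) ^+ 2 + b by rewrite addr_ge0// mulr_ge0 ?sqr_ge0.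
rewrite ler_pdivrMr//; apply: (@le_trans _ _ (4 * (k + b) ^+ 2 + b)); last by rewrite ler_peMr.
apply: le_trans (ler_normD _ _) _; apply: lerD; last exact: HL.
rewrite ger0_norm ?mulr_ge0// ?(ltW t0)//.
apply: (@le_trans _ _ (2 * t * (2 * ((k + b) ^+ 2 / t)))).
  rewrite ler_pM2l ?mulr_gt0//; apply: le_trans T2 _; exact: ler_wpM2l.
by rewrite le_eqVlt; apply/orP; left; apply/eqP; field; rewrite gt_eqF.
Qed.

End log_asymptotics.

(** * Growth of the constants C_m and conclusion *)

Section Ccoef_asymptotics.
Context {R : realType} {d : nat}.
Hypothesis d_gt0 : (0 < d)%N.
Let k : R := d%:R / 2.

(** At t = n + 1 the new factor of C is (2t)^2 (1 + 1/t) (1 + k/t), so the error changes by exactly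
    the quantity of [log_step], which is summable. *)
Lemma ln_Ccoef : exists b : R, 0 <= b /\
  forall n, `|ln (@Ccoef R d n.+1) - log_expansion k n.+1%:R| <= b.
Proof.
have k0 : 0 <= k by rewrite divr_ge0.
pose a n := ln (@Ccoef R d n.+1) - log_expansion k n.+1%:R.
pose c := 1 + k + k ^+ 2.
have c0 : 0 <= c by rewrite !addr_ge0// sqr_ge0.
have step n : `|a n.+1 - a n| <= c / n.+1%:R ^+ 2.
  have t1 : 1 <= n.+1%:R :> R by rewrite ler1n.
  have t0 : 0 < n.+1%:R :> R by exact: lt_le_trans t1.
  apply: le_trans (log_step k0 t1); rewrite le_eqVlt; apply/orP; left; apply/eqP; congr `|_|.
  rewrite /a CcoefS [ln (_ * _)]lnM ?posrE ?Ccoef_gt0 ?qcoef_gt0//.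
  rewrite /qcoef -!(natr1 n.+1); move: (n.+1%:R : R) t1 t0 => t t1 t0.
  have p1 : 0 < 1 + t^-1 by rewrite ltr_wpDr// invr_ge0 ltW.
  have p2 : 0 < 1 + k / t by rewrite ltr_wpDr// divr_ge0// ltW.
  have E1 : 2 * (t + 1) = 2 * t * (1 + t^-1) by field; rewrite gt_eqF.
  have E2 : 2 * t + d%:R = 2 * t * (1 + k / t) by rewrite /k; field; rewrite gt_eqF.
  have E3 : ln (t + 1) = ln t + ln (1 + t^-1).
    rewrite -lnM ?posrE//; congr ln; by field; rewrite gt_eqF.
  have t20 : 0 < 2 * t by rewrite mulr_gt0.
  have E4 : ln (2 * t * (1 + t^-1)) = ln (2 * t) + ln (1 + t^-1) by rewrite lnM ?posrE.
  have E5 : ln (2 * t * (1 + k / t)) = ln (2 * t) + ln (1 + k / t) by rewrite lnM ?posrE.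
  have -> : ln (2 * (t + 1) * (2 * t + d%:R)) =
      ln (2 * t) + ln (1 + t^-1) + (ln (2 * t) + ln (1 + k / t)).
    by rewrite -E4 -E5 -lnM ?posrE ?mulr_gt0// E1 E2.
  rewrite /log_expansion E3 E1 E4.
  move: (ln (2 * t)) (ln (1 + t^-1)) (ln (1 + k / t)) => u v w.
  by field; rewrite gt_eqF.
exists (`|a 0%N| + 2 * c); split; first by rewrite addr_ge0// mulr_ge0.
move=> n; have := telescope_bound c0 step n; rewrite -/(a n) => H.
have -> : a n = a 0%N + (a n - a 0%N) by rewrite addrC subrK.
by apply: le_trans (ler_normD _ _) _; rewrite lerD2l.
Qed.

End Ccoef_asymptotics.

Theorem corollary3 (R : realType) (d : nat) (hd : (0 < d)%N) :
  (fun m : nat => first_eigenvalue (unit_ball R d) m `^ (2 * m%:R)^-1) =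
  (fun m : nat => 2 * m%:R / expR 1 + d%:R / (2 * expR 1) * ln m%:R)
    +O_\oo (fun=> 1 : R).
Proof.
have [b [b0 Hb]] := @ln_Ccoef R d hd.
pose k : R := d%:R / 2; have k0 : 0 <= k by rewrite divr_ge0.
(* The added k = d/2 is the logarithm of the factor lost in the upper bound for the eigenvalue. *)
pose b' := b + k; have b'0 : 0 <= b' by rewrite addr_ge0.
pose M := 4 * (k + b') ^+ 2 + b'.
apply/eqaddOP/bigO_exP; exists (M + 1).
  by rewrite ltr_wpDl// addr_ge0// mulr_ge0 ?sqr_ge0.
(* Two thresholds: m > d for the existence of the minimizer, and m beyond 4 (k + b')^2 for the
   Taylor estimate. *)
exists (maxn d.+1 (Num.truncn (4 * (k + b') ^+ 2)).+1) => // m /=.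
rewrite geq_max => /andP[dm mt].
have m0 : (0 < m)%N by exact: leq_ltn_trans dm.
have m1 : 1 <= m%:R :> R by rewrite ler1n.
have tQ : 4 * (k + b') ^+ 2 <= m%:R.
  by apply: le_trans (ltW (truncnS_gt _)) _; rewrite ler_nat.
rewrite normr1 mulr1.
rewrite -[X in `|X|]/(first_eigenvalue (unit_ball R d) m `^ (2 * m%:R)^-1 -
  (2 * m%:R / expR 1 + d%:R / (2 * expR 1) * ln m%:R)).
rewrite first_eigenvalue_rayleigh//.
have C0 := @Ccoef_gt0 R d hd m.
have l1 := @Ccoef_le_rayleigh R d hd m dm; have l2 := @rayleigh_le_expR R d hd m m0.
set lam := rayleigh_inf m in l1 l2 *.
have l0 : 0 < lam by exact: lt_le_trans l1.
have HL : `|ln lam - log_expansion k m%:R| <= b'.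
  have := Hb m.-1; rewrite prednK// => H.
  have h1 : ln (@Ccoef R d m) <= ln lam by rewrite ler_ln ?posrE.
  have h2 : ln lam <= k + ln (@Ccoef R d m).
    rewrite -[k]expRK -lnM ?posrE ?expR_gt0// ler_ln ?posrE//.
    by rewrite mulr_gt0// expR_gt0.
  have /andP[h3 h4] : - b <= ln (@Ccoef R d m) - log_expansion k m%:R <= b by rewrite -ler_norml.
  by rewrite ler_norml /b'; apply/andP; split; lra.
have := exp_log_expansion k0 b'0 m1 tQ HL.
rewrite /powR gt_eqF// [_^-1 * _]mulrC.
rewrite (_ : k / expR 1 = d%:R / (2 * expR 1)); last by rewrite /k invfM mulrA.
by move=> /le_trans; apply; rewrite -/M lerDl.
Qed.
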